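(* Let $p$ be a prime with $p \equiv 1 \pmod{12}$, let $b,c$ be positive integers with $p=b^{2}+bc+c^{2}$, let $m$ be an odd integer with $3\nmid m$, and let $\mathcal Q$ be a finite self-dual directly regular $4$-polytope of type $\{\{3,6\}_{(m,0)},\{6,3\}_{(m,0)}\}$ such that $p(p^{2}-1)$ does not divide $|\Gamma(\mathcal{Q})|$. Then there exists a properly self-dual chiral $4$-polytope, whose automorphism group is isomorphic to $L_{2}(p)\times \Gamma^{+}(\mathcal{Q})$, of type $\{\{3,6\}_{(m,0)},\{6,3\}_{(m,0)}\}$ if $p\mid m$, and of type $\{\{3,6\}_{(mb,mc)},\{6,3\}_{(mb,mc)}\}$ if $p\nmid m$.
   Context: An abstract $n$-polytope is a ranked poset (ranks $-1,\dots,n$) with a least and a greatest face, all flags of size $n+2$, strongly flag-connected, and satisfying the diamond condition; $\Gamma(\mathcal P)$ is its automorphism group. $\mathcal P$ is regular if $\Gamma(\mathcal P)$ is flag-transitive, and chiral if $\Gamma(\mathcal P)$ has exactly two flag orbits with adjacent flags always in distinct orbits. For regular $\mathcal P$, $\Gamma(\mathcal P)$ is generated by involutions $\rho_0,\dots,\rho_{n-1}$; the rotation subgroup $\Gamma^+(\mathcal P)$ is generated by $\sigma_i=\rho_{i-1}\rho_i$, has index at most $2$, and $\mathcal P$ is directly regular if the index is $2$. A polytope is of type $\{\mathcal P_1,\mathcal P_2\}$ if its facets are isomorphic to $\mathcal P_1$ and its vertex-figures to $\mathcal P_2$. A polytope is self-dual if it admits a duality (incidence-reversing bijection onto itself); a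 chiral polytope is properly self-dual if it admits a duality mapping each of the two flag orbits of $\Gamma(\mathcal P)$ onto itself. $\{6,3\}_{(b,c)}$ and $\{3,6\}_{(b,c)}$ denote the toroidal maps obtained from the hexagonal, respectively triangular, tessellation of the plane by factoring out the translation lattice generated by the vector $(b,c)$ (in the usual hexagonal-lattice coordinates) and its image under rotation by $60^\circ$ (the two maps are dual); they are regular if $bc=0$ or $b=c$ and chiral otherwise. $L_2(p)=PSL_2(p)$. *)

(* Defs.v *)
From HB Require Import structures.
From mathcomp Require Import all_boot all_order all_algebra all_fingroup.
From mathcomp Require Import center.

Set Implicit Arguments.
Unset Strict Implicit.
Unset Printing Implicit Defensive.

Import GRing.Theory.
Local Open Scope ring_scope.

Definition order_iso (S T : Type) (leS : S -> S -> Prop) (leT : T -> T -> Prop) : Prop :=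
  exists2 f : S -> T, bijective f & forall x y, leS x y <-> leT (f x) (f y).

Definition chain (d : Order.disp_t) (P : finPOrderType d) (A : {set P}) : bool :=
  [forall x in A, forall y in A, (x >=< y)%O].

Definition flag (d : Order.disp_t) (P : finPOrderType d) (A : {set P}) : bool :=
  maxset (@chain d P) A.

Definition adjacent (d : Order.disp_t) (P : finPOrderType d) (A B : {set P}) : bool :=
  [&& flag A, flag B, #|A :\: B| == 1%N & #|B :\: A| == 1%N].

Definition strongly_flag_connected (d : Order.disp_t) (P : finPOrderType d) : Prop :=
  forall A B : {set P}, flag A -> flag B ->
    connect [rel C D | [&& adjacent C D, A :&: B \subset C & A :&: B \subset D]] A B.

Record is_polytope (n : nat) (d : Order.disp_t) (P : finPOrderType d)
    (rank : P -> int) : Prop := IsPolytope {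
  polytope_rank_bounds : forall x, - 1 <= rank x <= n%:Z;
  polytope_rank_mono : forall x y, (x < y)%O -> rank x < rank y;
  polytope_least : exists x0 : P, forall x, (x0 <= x)%O;
  polytope_greatest : exists x1 : P, forall x, (x <= x1)%O;
  polytope_flag_size : forall A : {set P}, flag A -> #|A| = n.+2;
  polytope_connected : strongly_flag_connected P;
  polytope_diamond : forall x y : P, (x < y)%O -> rank y = rank x + 2%:Z ->
    #|[set z | (x < z < y)%O]| = 2%N
}.

(** Only finite polytopes are considered: a polytope with finite automorphism
    group and finitely many flag orbits is finite. *)
Record polytope (n : nat) : Type := Polytope {
  polytope_disp : Order.disp_t;
  face :> finPOrderType polytope_disp;
  rank : face -> int;
  polytopeP : is_polytope n rank
}.

Definition flags (n : nat) (P : polytope n) : {set {set P}} := [set A | flag A].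

Definition i_adjacent (n : nat) (P : polytope n) (i : nat) (A B : {set P}) : bool :=
  adjacent A B && [forall x in A :\: B, rank x == i%:Z].

Definition Gamma (n : nat) (P : polytope n) : {set {perm P}} :=
  [set g : {perm P} | [forall x, forall y, (g x <= g y)%O == (x <= y)%O]].

Lemma Gamma_group_set (n : nat) (P : polytope n) : group_set (Gamma P).
Proof.
apply/group_setP; split=> [|g h].
  by rewrite inE; apply/forallP=> x; apply/forallP=> y; rewrite !perm1.
rewrite !inE => /forallP hg /forallP hh.
apply/forallP=> x; apply/forallP=> y; rewrite !permM.
by rewrite (eqP (forallP (hh _) _)) (eqP (forallP (hg _) _)).
Qed.

Canonical Gamma_group (n : nat) (P : polytope n) : {group {perm P}} :=
  Group (Gamma_group_set P).

Definition flag_orbits (n : nat) (P : polytope n) : {set {set {set P}}} :=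
  orbit 'P^*%act (Gamma P) @: flags P.

Definition regular (n : nat) (P : polytope n) : Prop :=
  [transitive Gamma P, on flags P | 'P^*].

Definition chiral (n : nat) (P : polytope n) : Prop :=
  #|flag_orbits P| = 2%N /\
  forall A B : {set P}, adjacent A B -> B \notin orbit 'P^*%act (Gamma P) A.

(** For [P] regular and [A] a (base) flag, [rho A i] with [i < n] is the unique
    automorphism taking [A] to its [i]-adjacent flag. *)
Definition rho (n : nat) (P : polytope n) (A : {set P}) (i : nat) : {perm P} :=
  odflt 1%g [pick g in Gamma P | i_adjacent i A (g @: A)].

Definition Gamma_plus (n : nat) (P : polytope n) (A : {set P}) : {set {perm P}} :=
  <<[set (rho A i * rho A i.+1)%g | i : 'I_n.-1]>>%g.

Canonical Gamma_plus_group (n : nat) (P : polytope n) (A : {set P}) :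
    {group {perm P}} :=
  Eval hnf in [group of Gamma_plus A].

Definition directly_regular (n : nat) (P : polytope n) (A : {set P}) : Prop :=
  regular P /\ #|Gamma P : Gamma_plus A|%g = 2%N.

Definition duality (n : nat) (P : polytope n) (delta : {perm P}) : Prop :=
  forall x y : P, (delta x <= delta y)%O = (y <= x)%O.

Definition self_dual (n : nat) (P : polytope n) : Prop :=
  exists delta : {perm P}, duality delta.

Definition properly_self_dual (n : nat) (P : polytope n) : Prop :=
  exists2 delta : {perm P}, duality delta &
    forall O, O \in flag_orbits P -> [set delta @: A | A : {set P} in O] = O.

Definition has_type (n : nat) (P : polytope n) (S T : Type)
    (leS : S -> S -> Prop) (leT : T -> T -> Prop) : Prop :=
  (forall F : P, rank F = n%:Z - 1 ->
     order_iso (fun x y : {x : P | (x <= F)%O} => (sval x <= sval y)%O) leS) /\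
  (forall v : P, rank v = 0 ->
     order_iso (fun x y : {x : P | (v <= x)%O} => (sval x <= sval y)%O) leT).

(** The pair [(x, y)] is the point [x + y w] of the triangular lattice, where
    [w] is the complex number of modulus 1 and argument 60 degrees; hence
    [w ^ 2 = w - 1]. *)
Definition point : Type := (int * int)%type.

Definition rot60 (v : point) : point := (- v.2, v.1 + v.2).

Definition unit_vec (k : nat) : point := iter k rot60 (1, 0).

(** Every edge and every triangle of the tessellation is listed exactly once:
    those based at the lattice point [v] are the edges from [v] in the
    directions [1, w, w ^ 2], and the two triangles at [v] between consecutive
    such directions. *)
Inductive tess_face : Type :=
  | TEmpty
  | TVertex of point
  | TEdge of point & 'I_3
  | TTriangle of point & 'I_2
  | TPlane.

(** [TPlane] is treated separately in [tri_le]. *)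
Definition corners (f : tess_face) : seq point :=
  match f with
  | TVertex v => [:: v]
  | TEdge v k => [:: v; v + unit_vec k]
  | TTriangle v k => [:: v; v + unit_vec k; v + unit_vec k.+1]
  | TEmpty | TPlane => [::]
  end.

Definition tri_le (f g : tess_face) : Prop :=
  match f, g with
  | _, TPlane => True
  | TPlane, _ => False
  | _, _ => {subset corners f <= corners g}
  end.

(** The hexagonal tessellation is the dual of the triangular one: its tiles are
    centred at the lattice points, so both have the same translations. *)
Definition hex_le (f g : tess_face) : Prop := tri_le g f.

Definition translate (t : point) (f : tess_face) : tess_face :=
  match f with
  | TVertex v => TVertex (v + t)
  | TEdge v k => TEdge (v + t) k
  | TTriangle v k => TTriangle (v + t) k
  | TEmpty => TEmpty
  | TPlane => TPlane
  end.

Definition in_lattice (u : point) (t : point) : Prop :=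
  exists r s : int, t = u *~ r + rot60 u *~ s.

Definition translation_orbit (u : point) (f : tess_face) : tess_face -> Prop :=
  fun g => exists2 t, in_lattice u t & g = translate t f.

Definition torus_face (u : point) : Type :=
  {A : tess_face -> Prop | exists f, A = translation_orbit u f}.

Definition torus_le (le : tess_face -> tess_face -> Prop) (u : point)
    (A B : torus_face u) : Prop :=
  exists f g, [/\ sval A f, sval B g & le f g].

(** [{3,6}_u] and [{6,3}_u]. *)
Definition map36 (u : point) := torus_le tri_le (u := u).
Definition map63 (u : point) := torus_le hex_le (u := u).

Definition SL2 (p : nat) : {set {'GL_2(p)}} :=
  [set g : {'GL_2(p)} | \det (GLval g) == 1].

Lemma SL2_group_set (p : nat) : group_set (SL2 p).
Proof.
apply/group_setP; split=> [|g h]; first by rewrite inE /= det1.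
by rewrite !inE GL_MxE det_mulmx => /eqP-> /eqP->; rewrite mulr1.
Qed.

Canonical SL2_group (p : nat) : {group {'GL_2(p)}} := Group (SL2_group_set p).

Definition PSL2 (p : nat) : {set coset_of 'Z(SL2 p)} := (SL2 p / 'Z(SL2 p))%g.

Canonical PSL2_group (p : nat) : {group coset_of 'Z(SL2 p)} :=
  Eval hnf in [group of PSL2 p].

(* Main.v *)
(** Both [Gamma_plus Phi] and [PSL2 p] are generated by three elements that
    satisfy the relations of the rotations of a self-dual 4-polytope with
    triangulated toroidal facets. In [PSL2 p] the translations of the facet are
    unipotent, and [w = - b / c], a primitive sixth root of unity modulo [p],
    acts on them as the rotation by 60 degrees; so the translation by [(x, y)]
    is trivial exactly when [p] divides [c x - b y]. By Goursat's lemma, since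
    [PSL2 p] is simple and its order does not divide that of [Gamma_plus Phi],
    the pairs of corresponding generators generate the whole direct product.
    The cosets of the face stabilisers form a polytope, whose facets are the
    quotients of the tessellation by the translations trivial in both factors.
    If it were not chiral, the product would have an automorphism taking the
    translation by [(b, c)] to its mirror image, by [(- b - c, c)]. By simplicity
    that automorphism preserves the factor [Gamma_plus Phi], which contains the
    first translation but not the second. *)

Require Import Defs.
From HB Require Import structures.
From mathcomp Require Import all_boot all_order all_algebra all_fingroup.
From mathcomp Require Import center cyclic gseries finfield boolp zify ring.

Set Implicit Arguments.
Unset Strict Implicit.
Unset Printing Implicit Defensive.

Import Order.TTheory GRing.Theory Num.Theory.
Local Open Scope ring_scope.

(** * Finite groups *)

Section FiniteGroups.
Variable gT : finGroupType.
Local Open Scope group_scope.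
Implicit Types (g h : gT) (D : {set gT}) (H : {group gT}).

Lemma gen_ind D (Pr : gT -> Prop) :
    Pr 1 -> {in D, forall g, forall h, Pr h -> Pr (g * h)} ->
  {in <<D>>, forall g, Pr g}.
Proof.
move=> Pr1 PrM g /gen_prodgP[n [c cD ->]]; elim: n c cD => [|n IH] c cD.
  by rewrite big_ord0.
by rewrite big_ord_recl; apply: PrM => //; apply: IH.
Qed.

Lemma invg_sqr1 g : g ^+ 2 = 1 -> g^-1 = g.
Proof. by move=> g2; apply/eqP; rewrite eq_invg_mul -expg2 g2. Qed.

Lemma expgM_swap g h n : (g * h) ^+ n = 1 -> (h * g) ^+ n = 1.
Proof.
move=> gh; have -> : h * g = (g * h) ^ g by rewrite conjgE -mulgA mulKg.
by rewrite -conjXg gh conj1g.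
Qed.

Lemma prime_cycle_TI p g H : prime p -> g ^+ p = 1 -> g \notin H -> <[g]> :&: H = 1.
Proof.
move=> p_prime gp gH; have ntg : g != 1 by apply: contraNneq gH => ->.
by apply: prime_TIg; rewrite ?cycle_subG // -orderE (nt_prime_order p_prime gp).
Qed.

Lemma mem_cycle2 g h : g ^+ 2 = 1 -> h \in <[g]> -> h = 1 \/ h = g.
Proof.
move=> g2; have [->|ntg] := eqVneq g 1; first by rewrite cycle1 => /set1P->; left.
by rewrite cycle2g ?(nt_prime_order _ g2) // => /set2P.
Qed.

Lemma gen_dihedral g h :
  h ^+ 2 = 1 -> (g * h) ^+ 2 = 1 -> <<[set g; h]>> = <[g]> * <[h]>.
Proof.
move=> h2 gh2; rewrite -[<<_>>]/([set g] <*> [set h]) -joing_idl -joing_idr.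
rewrite norm_joinEr // cycle_subG; apply/normP; rewrite -cycleJ.
have -> : g ^ h = g^-1; last by rewrite cycleV.
apply: (mulgI g); rewrite mulgV conjgE (invg_sqr1 h2) !mulgA.
by rewrite -[g * h * g * h]mulgA -expg2.
Qed.

End FiniteGroups.

Section IntegerPowers.
Variable gT : groupType.
Local Open Scope group_scope.
Implicit Types (x y : gT) (a b : int).

Definition expgz x a : gT :=
  match a with Posz n => x ^+ n | Negz n => x ^- n.+1 end.

Lemma expgzS x a : expgz x (a + 1)%R = expgz x a * x.
Proof.
case: a => n; first by rewrite -PoszD addn1 /= expgSr.
have -> : (Negz n + 1 = - n%:Z)%R by rewrite NegzE -addn1 PoszD opprD subrK.
rewrite /= expgS invMg mulgKV; case: n => [|n]; last by rewrite -NegzE.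
by rewrite expg0 invg1.
Qed.

Lemma expgz_pred x a : expgz x (a - 1)%R = expgz x a * x^-1.
Proof. by rewrite -[in RHS](subrK 1%R a) expgzS mulgK. Qed.

Lemma expgzD x a b : expgz x (a + b)%R = expgz x a * expgz x b.
Proof.
elim/int_rect: b => [|n IH|n IH]; first by rewrite addr0 mulg1.
  by rewrite -addn1 PoszD addrA !expgzS IH mulgA.
by rewrite -addn1 PoszD opprD addrA !expgz_pred IH mulgA.
Qed.

Lemma expgzN x a : expgz x (- a)%R = (expgz x a)^-1.
Proof. by apply: (mulgI (expgz x a)); rewrite -expgzD subrr mulgV. Qed.

Lemma expVgz x a : expgz x^-1 a = (expgz x a)^-1.
Proof. by case: a => n /=; rewrite ?expVgn. Qed.

Lemma conjXgz x y a : (expgz x a) ^ y = expgz (x ^ y) a.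
Proof. by case: a => n /=; rewrite ?conjVg conjXg. Qed.

Lemma commuteXz x y a : commute x y -> commute x (expgz y a).
Proof. by case: a => n cxy; [|apply: commuteV]; apply: commuteX. Qed.

Lemma commuteXz2 x y a b : commute x y -> commute (expgz x a) (expgz y b).
Proof. by move=> cxy; apply/commuteXz/commute_sym/commuteXz/commute_sym. Qed.

Lemma expgzMg x y a : commute x y -> expgz (x * y) a = expgz x a * expgz y a.
Proof.
move=> cxy; case: a => n /=; rewrite expgMn // invMg.
by apply/commute_sym/commuteV/commute_sym/commuteV/commuteX2.
Qed.

End IntegerPowers.

Lemma groupXz (gT : finGroupType) (H : {group gT}) x a : x \in H -> expgz x a \in H.
Proof. by move=> xH; case: a => n /=; rewrite ?groupV groupX. Qed.

Lemma morphXz (aT bT : finGroupType) (D : {group aT}) (f : {morphism D >-> bT}) x a :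
  x \in D -> f (expgz x a) = expgz (f x) a.
Proof. by move=> xD; case: a => n /=; rewrite ?morphV ?groupX // morphX. Qed.

Section DirectProducts.
Variables (aT bT : finGroupType) (A : {group aT}) (B : {group bT}).
Hypotheses (simpleA : simple A) (ndvdAB : ~~ (#|A| %| #|B|)%N).
Local Open Scope group_scope.

Lemma goursat_simple (G : {group aT * bT}) :
  fst @* G = A -> snd @* G = B -> G = setX A B :> {set _}.
Proof.
move=> GA GB; pose K := [group of fst @* 'ker_G (@snd aT bT)].
have KG y : y \in K -> (y, 1) \in G.
  case/morphimP=> [[z1 z2]] _ /setIP[zG /(kerP _ (in_setT _)) /= z2E] ->.
  by rewrite -z2E.
have nKA : K <| A.
  rewrite /normal -GA morphimS ?subsetIl // morphim_norms // normsI ?normG //.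
  exact: subset_trans (subsetT _) (ker_norm _).
have [_ /(_ K nKA)[K1|KA]] := simpleP _ simpleA.
  case/negP: ndvdAB; have injG : 'injm (restrm (subsetT G) [morphism of @snd aT bT]).
    rewrite ker_restrm; apply/subsetP=> [[z1 z2]] zker; have [_ zK] := setIP zker.
    have : z1 \in K by apply/morphimP; exists (z1, z2); rewrite ?in_setT.
    rewrite [K : {set _}]K1 inE => /eqP->.
    by have /(kerP _ (in_setT _)) /= -> := zK; rewrite inE.
  have /= := card_injm injG (subxx G); rewrite morphim_restrm setIid GB => ->.
  by rewrite -GA; apply: dvdn_morphim.
have GP g : g \in G -> g.1 \in A /\ g.2 \in B.
  move=> gG; rewrite -GA -GB; split.
    by apply: (mem_morphim [morphism of fst]); rewrite ?in_setT.
  by apply: (mem_morphim [morphism of snd]); rewrite ?in_setT.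
apply/eqP; rewrite eqEsubset; apply/andP; split; apply/subsetP=> [[g1 g2]].
  by case/GP=> g1A g2B; apply/setXP.
case/setXP=> g1A; rewrite -GB => /morphimP[[h1 h2] _ hG /= ->].
have [/= h1A _] := GP _ hG.
have -> : (g1, h2) = ((g1 * h1^-1, 1) : aT * bT) * (h1, h2).
  by congr (_, _); rewrite /= ?mulgKV ?mul1g.
by rewrite groupM // KG // [K : {set _}]KA groupM ?groupV.
Qed.

Lemma simple_cofactor_char : setX 1 B \char setX A B.
Proof.
have sub1B : setX 1 B \subset setX A B by apply: setXS; rewrite ?sub1G.
have card1B : #|setX (1 : {set aT}) B| = #|B|.
  by rewrite (cardsX (1 : {set aT}) B) cards1 mul1n.
have nrm1B : setX A B \subset 'N(setX 1 B).
  apply/subsetP=> [[g1 g2]] /setXP[g1A g2B]; rewrite inE.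
  apply/subsetP=> _ /imsetP[[h1 h2] /setXP[/set1P-> h2B] ->].
  by apply/setXP; split; [apply/set1P/conj1g|apply: groupJ].
apply/charP; split=> // f injf fAB; apply/eqP.
rewrite eqEcard card_injm // leqnn andbT.
have sfAB : f @* setX 1 B \subset setX A B by have := morphimS f sub1B; rewrite fAB.
have nfAB : setX A B \subset 'N(f @* setX 1 B) by have := morphim_norms f nrm1B; rewrite fAB.
pose N := [group of fst @* (f @* setX 1 B)].
have nNA : N <| A.
  by rewrite /normal -[A : {set _}](morphim_fstX A B) morphimS //= morphim_norms.
have [_ /(_ N nNA)[N1|NA]] := simpleP _ simpleA.
  apply/subsetP=> -[g1 g2] gf; apply/setXP; split.
    have := mem_morphim [morphism of fst] (in_setT _) gf.
    by rewrite -[_ @* _]/(N : {set aT}) N1.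
  by have /setXP[] := subsetP sfAB _ gf.
case/negP: ndvdAB; rewrite -card1B -[in #|A|]NA -(card_injm injf sub1B).
exact: dvdn_morphim.
Qed.

End DirectProducts.

(** * Flags of posets and of polytopes *)

Section Chains.
Variables (d : Order.disp_t) (P : finPOrderType d).
Implicit Types (A B : {set P}) (x y z : P) (g : {perm P}).

Lemma chainP A : reflect {in A &, forall x y, (x >=< y)%O} (chain A).
Proof.
apply: (iffP forall_inP) => [cA x y xA yA|cA x xA].
  exact: (forall_inP (cA x xA)).
by apply/forall_inP=> y yA; apply: cA.
Qed.

Lemma chainS A B : A \subset B -> chain B -> chain A.
Proof.
by move=> /subsetP sAB /chainP cB; apply/chainP=> x y /sAB xB /sAB; apply: cB.
Qed.

Lemma chain_setU1 A z : chain A -> {in A, forall x, (z >=< x)%O} -> chain (z |: A).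
Proof.
move=> /chainP cA zA; apply/chainP=> x y /setU1P[->|xA] /setU1P[->|yA].
- exact: comparablexx.
- exact: zA.
- by rewrite comparable_sym zA.
- exact: cA.
Qed.

Lemma chain_imset g A : {mono g : x y / (x >=< y)%O} -> chain (g @: A) = chain A.
Proof.
move=> g_mono; apply/chainP/chainP=> [cgA x y xA yA|cA].
  by rewrite -g_mono cgA ?imset_f.
by move=> _ _ /imsetP[x xA ->] /imsetP[y yA ->]; rewrite g_mono cA.
Qed.

Lemma flag_chain A : flag A -> chain A.
Proof. exact: maxsetp. Qed.

Lemma chain_in_flag A : chain A -> exists2 B, flag B & A \subset B.
Proof. by case/maxset_exists=> B; exists B. Qed.

Lemma face_in_flag x : exists2 A, flag A & x \in A.
Proof.
have cx : chain [set x] by apply/chainP=> y z /set1P-> /set1P->; apply: comparablexx.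
by have [A fA] := chain_in_flag cx; rewrite sub1set; exists A.
Qed.

Lemma flag_sub_eq A B : flag A -> chain B -> A \subset B -> A = B.
Proof. by case/maxsetP=> _ maxA cB /(maxA B cB). Qed.

Lemma flag_comparable A z : flag A -> {in A, forall x, (z >=< x)%O} -> z \in A.
Proof.
move=> fA zA; rewrite (flag_sub_eq fA (chain_setU1 (flag_chain fA) zA)) ?setU11 //.
exact: subsetUr.
Qed.

Lemma flag_imset g A : {mono g : x y / (x >=< y)%O} -> flag A -> flag (g @: A).
Proof.
move=> g_mono fA; apply/maxsetP; rewrite chain_imset //; split=> [|B cB gAB].
  exact: flag_chain.
have gK : g @: (g @^-1: B) = B.
  by apply/setP=> x; rewrite -{1}[x](permKV g) mem_imset ?inE ?permKV //; apply: perm_inj.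
rewrite -gK chain_imset // in cB; rewrite -gK -(flag_sub_eq fA cB) //.
by apply/subsetP=> x xA; rewrite inE (subsetP gAB) ?imset_f.
Qed.

Lemma adjacent_setD1 A B a : flag A -> flag B -> #|A| = #|B| -> A != B ->
  A :\ a \subset B -> adjacent A B.
Proof.
move=> fA fB cardAB neqAB AaB; rewrite /adjacent fA fB.
have cardD : #|A :\: B| = #|B :\: A|.
  by apply/eqP; rewrite -(eqn_add2l #|A :&: B|) cardsID setIC cardsID cardAB.
rewrite -cardD andbb /= eqn_leq card_gt0 setD_eq0; apply/andP; split.
  rewrite -(cards1 a); apply/subset_leq_card/subsetP=> x /setDP[xA].
  by rewrite inE; apply: contraNT => xa; rewrite (subsetP AaB) // !inE xa.
by apply: contra neqAB => /(flag_sub_eq fA (flag_chain fB))->.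
Qed.

Section MonotoneMap.
Variables (dT : Order.disp_t) (T : orderType dT) (r : P -> T).
Hypothesis r_homo : {homo r : x y / (x < y)%O}.

Lemma chain_le A : chain A -> {in A &, {mono r : x y / (x <= y)%O}}.
Proof.
move=> /chainP cA x y xA yA; apply/idP/idP; last exact: ltW_homo.
by rewrite (comparable_leNgt (cA x y xA yA)) leNgt; apply: contra => /r_homo.
Qed.

Lemma chain_lt A : chain A -> {in A &, {mono r : x y / (x < y)%O}}.
Proof. by move=> cA; apply/leW_mono_in/chain_le. Qed.

Lemma chain_inj A : chain A -> {in A &, injective r}.
Proof. by move=> cA; apply/inc_inj_in/chain_le. Qed.

End MonotoneMap.
End Chains.

Section Polytope.
Variables (n : nat) (P : polytope n).
Implicit Types (A B C D : {set P}) (x y z : P) (i j : nat) (g h : {perm P}).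

Let rank_bounds := polytope_rank_bounds (polytopeP P).
Let rank_lt := polytope_rank_mono (polytopeP P).

Lemma flag_size A : flag A -> #|A| = n.+2.
Proof. exact: (polytope_flag_size (polytopeP P)). Qed.

Lemma chain_flag A : chain A -> #|A| = n.+2 -> flag A.
Proof.
move=> cA sA; have [B fB sAB] := chain_in_flag cA; suff -> : A = B by [].
by apply/eqP; rewrite eqEcard sAB sA flag_size /=.
Qed.

Lemma flag_le A : flag A -> {in A &, forall x y, (x <= y)%O = (rank x <= rank y)}.
Proof. by move=> /flag_chain cA x y xA yA; rewrite (chain_le rank_lt cA). Qed.

Lemma flag_lt A : flag A -> {in A &, forall x y, (x < y)%O = (rank x < rank y)}.
Proof. by move=> /flag_chain cA x y xA yA; rewrite (chain_lt rank_lt cA). Qed.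

Lemma flag_rank_inj A : flag A -> {in A &, injective (@rank n P)}.
Proof. by move/flag_chain; apply: chain_inj. Qed.

Lemma flag_face_of_rank A (i : int) : flag A -> -1 <= i <= n%:Z ->
  exists2 x, x \in A & rank x = i.
Proof.
move=> fA /andP[i_ge i_le]; pose f x : 'I_n.+2 := inord `|rank x + 1|.
have fE x : rank x = (f x : nat)%:Z - 1.
  by have rx := rank_bounds x; rewrite /f inordK; lia.
have f_inj : {in A &, injective f}.
  by move=> x y xA yA fxy; apply: (flag_rank_inj fA); rewrite ?fE ?fxy.
have fA_T : f @: A = setT.
  by apply/eqP; rewrite eqEcard subsetT cardsT card_ord card_in_imset ?flag_size /=.
have := in_setT (inord `|i + 1| : 'I_n.+2); rewrite -fA_T => /imsetP[x xA /esym fx].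
by exists x; rewrite // fE fx inordK; lia.
Qed.

Lemma rank_unique (f : P -> int) : (forall x, -1 <= f x <= n%:Z) ->
  {homo f : x y / (x < y)%O >-> x < y} -> f =1 @rank n P.
Proof.
move=> f_bounds f_lt x; apply/le_anti/andP; split.
  have [k] : exists k : nat, rank x = n%:Z - k%:Z.
    by exists (absz (n%:Z - rank x)); have := rank_bounds x; lia.
  elim: k x => [|k IH] x rx; first by have := f_bounds x; lia.
  have [A fA xA] := face_in_flag x; have := rank_bounds x => rx_bounds.
  have [|y yA ry] := flag_face_of_rank (i := rank x + 1) fA; first by lia.
  have /f_lt : (x < y)%O by rewrite (flag_lt fA) // ry; lia.
  by have := IH y; lia.
have [k] : exists k : nat, rank x = k%:Z - 1.
  by exists (absz (rank x + 1)); have := rank_bounds x; lia.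
elim: k x => [|k IH] x rx; first by have := f_bounds x; lia.
have [A fA xA] := face_in_flag x; have := rank_bounds x => rx_bounds.
have [|y yA ry] := flag_face_of_rank (i := rank x - 1) fA; first by lia.
have /f_lt : (y < x)%O by rewrite (flag_lt fA) // ry; lia.
by have := IH y; lia.
Qed.

Definition greatest_face : P := sval (cid (polytope_greatest (polytopeP P))).

Lemma le_greatest_face x : (x <= greatest_face)%O.
Proof. by rewrite /greatest_face; case: cid. Qed.

Lemma greatest_face_in_flag A : flag A -> greatest_face \in A.
Proof.
move=> fA; apply: flag_comparable => // x _.
by rewrite comparable_sym /Order.comparable le_greatest_face.
Qed.

Lemma rank_greatest_face : rank greatest_face = n%:Z.
Proof.
have [A fA _] := face_in_flag greatest_face.
have [|x xA rx] := flag_face_of_rank (i := n%:Z) fA; first by lia.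
have := le_greatest_face x; rewrite (flag_le fA) ?greatest_face_in_flag // rx.
by have := rank_bounds greatest_face; lia.
Qed.

Lemma i_adjacent_flags i A B : i_adjacent i A B -> flag A /\ flag B.
Proof. by case/andP=> /and4P[]. Qed.

Lemma i_adjacentP i A B : flag A -> flag B ->
  reflect (A != B /\ {in A, forall x, rank x != i%:Z -> x \in B}) (i_adjacent i A B).
Proof.
move=> fA fB; apply: (iffP andP) => [[/and4P[_ _ cardD _] /forall_inP rD]|[neqAB AB]].
  split=> [|x xA rx]; first by apply: contraTneq cardD => ->; rewrite setDv cards0.
  by apply: contraR rx => xB; apply: rD; rewrite inE xB.
have rD : {in A :\: B, forall x, rank x = i%:Z}.
  by move=> x /setDP[xA]; apply: contraNeq => /(AB x xA).
have [a aD] : exists a, a \in A :\: B.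
  apply/set0Pn; rewrite setD_eq0; apply: contra neqAB => sAB.
  by rewrite (flag_sub_eq fA (flag_chain fB) sAB).
split; last by apply/forall_inP=> x /rD->.
apply: (@adjacent_setD1 _ _ _ _ a); rewrite ?flag_size //.
apply/subsetP=> x /setD1P[xa xA]; apply: AB => //; apply: contra xa => /eqP rx.
by apply/eqP/(flag_rank_inj fA); rewrite ?rx ?rD //; case/setDP: aD.
Qed.

Lemma i_adjacent_neq i A B : i_adjacent i A B -> A != B.
Proof. by move=> AB; have [fA fB] := i_adjacent_flags AB; case/i_adjacentP: AB. Qed.

Lemma i_adjacent_sym i A B : i_adjacent i A B -> i_adjacent i B A.
Proof.
move=> adjAB; have [fA fB] := i_adjacent_flags adjAB.
have /(i_adjacentP _ fA fB)[neqAB AB] := adjAB.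
apply/i_adjacentP => //; split=> [|x xB rx]; first by rewrite eq_sym.
have [y yA ry] := flag_face_of_rank fA (rank_bounds x).
by rewrite (flag_rank_inj fB xB _ (esym ry)) // AB ?ry.
Qed.

Lemma i_adjacent_mem i A B x : i_adjacent i A B -> rank x != i%:Z -> (x \in A) = (x \in B).
Proof.
move=> adjAB rx; have [fA fB] := i_adjacent_flags adjAB.
have /(i_adjacentP _ fA fB)[_ AB] := adjAB.
by have /(i_adjacentP _ fB fA)[_ BA] := i_adjacent_sym adjAB; apply/idP/idP; auto.
Qed.

Lemma i_adjacent_face_neq i A B a b : i_adjacent i A B -> a \in A -> b \in B ->
  rank a = i%:Z -> rank b = i%:Z -> a != b.
Proof.
move=> adjAB aA bB ra rb; have [fA fB] := i_adjacent_flags adjAB.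
apply: contraNneq (i_adjacent_neq adjAB) => eqab.
rewrite (flag_sub_eq fA (flag_chain fB)) //; apply/subsetP=> x xA.
have [rx|rx] := eqVneq (rank x) i%:Z; last by rewrite -(i_adjacent_mem adjAB).
by rewrite (flag_rank_inj fA xA aA) ?ra // eqab.
Qed.

Lemma diamond_unique x y a b c : rank y = rank x + 2%:Z -> (x < a < y)%O ->
  (x < b < y)%O -> (x < c < y)%O -> a != b -> a != c -> b = c.
Proof.
move=> ry xay xby xcy ab ac; have /andP[xa ay] := xay.
have/eqP := polytope_diamond (polytopeP P) (lt_trans xa ay) ry.
rewrite (cardsD1 a) inE xay add1n eqSS => /cards1P[z xy_z].
have /set1P-> : b \in [set z] by rewrite -xy_z !inE eq_sym ab.
by have /set1P-> : c \in [set z] by rewrite -xy_z !inE eq_sym ac.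
Qed.

Lemma diamond_exists x y a : rank y = rank x + 2%:Z -> (x < a < y)%O ->
  exists2 b, a != b & (x < b < y)%O.
Proof.
move=> ry xay; have /andP[xa ay] := xay.
have/eqP := polytope_diamond (polytopeP P) (lt_trans xa ay) ry.
rewrite (cardsD1 a) inE xay add1n eqSS => /cards1P[b xy_b].
by have := set11 b; rewrite -xy_b !inE eq_sym => /andP[]; exists b.
Qed.

Lemma flag_section i A : (i < n)%N -> flag A -> exists x a y,
  [/\ {subset [:: x; a; y] <= A}, (x < a < y)%O &
      [/\ rank x = i%:Z - 1, rank a = i%:Z & rank y = i%:Z + 1]].
Proof.
move=> lt_in fA.
have [|x xA rx] := flag_face_of_rank (i := i%:Z - 1) fA; first by lia.
have [|a aA ra] := flag_face_of_rank (i := i%:Z) fA; first by lia.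
have [|y yA ry] := flag_face_of_rank (i := i%:Z + 1) fA; first by lia.
exists x, a, y; split=> //; first by move=> z; rewrite !inE => /or3P[] /eqP->.
by rewrite !(flag_lt fA) // rx ra ry; lia.
Qed.

(* By the diamond condition, the new face of an [i]-adjacent flag depends only
   on the faces of ranks [i - 1], [i] and [i + 1]. *)
Lemma i_adjacent_face_eq i A B C D b c : (i < n)%N ->
    i_adjacent i A B -> i_adjacent i C D ->
    (forall x, i%:Z - 1 <= rank x <= i%:Z + 1 -> x \in A -> x \in C) ->
    b \in B -> c \in D -> rank b = i%:Z -> rank c = i%:Z -> b = c.
Proof.
move=> lt_in adjAB adjCD AC bB cD rb rc.
have [[fA fB] [fC fD]] := (i_adjacent_flags adjAB, i_adjacent_flags adjCD).
have [x [a [y [xayA xay [rx ra ry]]]]] := flag_section lt_in fA.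
have xayC : {subset [:: x; a; y] <= C}.
  move=> z z_xay; apply: AC (xayA z z_xay); move: z_xay; rewrite !inE.
  by case/or3P=> /eqP->; rewrite ?rx ?ra ?ry; clear; lia.
have between (E F : {set P}) f : flag F -> i_adjacent i E F -> {subset [:: x; a; y] <= E} ->
    f \in F -> rank f = i%:Z -> (x < f < y)%O.
  move=> fF adjEF xayE fF' rf; rewrite !(flag_lt fF) ?rx ?rf ?ry ?gtrBl ?ltrDl //.
    by rewrite -(i_adjacent_mem adjEF) ?xayE ?inE ?eqxx ?orbT // ry; clear; lia.
  by rewrite -(i_adjacent_mem adjEF) ?xayE ?inE ?eqxx ?orbT // rx; clear; lia.
apply: (@diamond_unique x y a) => //; first by rewrite rx ry; clear; lia.
- exact: between adjAB _ _ _.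
- exact: between adjCD _ _ _.
- by apply: i_adjacent_face_neq adjAB _ _ _ _; rewrite // xayA ?inE ?eqxx ?orbT.
- by apply: i_adjacent_face_neq adjCD _ _ _ _; rewrite // xayC ?inE ?eqxx ?orbT.
Qed.

Lemma i_adjacent_uniq i A B C : (i < n)%N ->
  i_adjacent i A B -> i_adjacent i A C -> B = C.
Proof.
move=> lt_in adjAB adjAC; have [_ fB] := i_adjacent_flags adjAB.
have [_ fC] := i_adjacent_flags adjAC.
apply: (flag_sub_eq fB (flag_chain fC)); apply/subsetP=> x xB.
have [rx|rx] := eqVneq (rank x) i%:Z; last first.
  by rewrite -(i_adjacent_mem adjAC) // (i_adjacent_mem adjAB).
have [|c cC rc] := flag_face_of_rank (i := i%:Z) fC; first by lia.
by rewrite (i_adjacent_face_eq lt_in adjAB adjAC _ xB cC).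
Qed.

Lemma i_adjacent_exists i A : (i < n)%N -> flag A -> exists B, i_adjacent i A B.
Proof.
move=> lt_in fA; have [x [a [y [xayA xay [rx ra ry]]]]] := flag_section lt_in fA.
have [xA aA yA] : [/\ x \in A, a \in A & y \in A].
  by rewrite !xayA // !inE eqxx ?orbT.
have [|b neq_ab /andP[xb by_]] := diamond_exists _ xay; first by rewrite rx ry; lia.
have rb : rank b = i%:Z by have := rank_lt xb; have := rank_lt by_; rewrite rx ry; clear; lia.
have bA : b \notin A.
  by apply: contra neq_ab => bA; apply/eqP/(flag_rank_inj fA); rewrite ?ra.
have b_comparable z : z \in A :\ a -> (b >=< z)%O.
  case/setD1P=> neq_za zA; have rz : rank z != i%:Z.
    by apply: contra neq_za => /eqP rz; apply/eqP/(flag_rank_inj fA); rewrite ?ra.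
  have [zi|iz] := ltP (rank z) i%:Z.
    have zx : (z <= x)%O by rewrite (flag_le fA) // rx; clear -zi; lia.
    by apply: gt_comparable; apply: le_lt_trans xb.
  have yz : (y <= z)%O by rewrite (flag_le fA) // ry; clear -iz rz; lia.
  by apply: lt_comparable; apply: lt_le_trans yz.
have fB : flag (b |: A :\ a).
  apply: chain_flag; first exact/chain_setU1/b_comparable/chainS/flag_chain/fA/subsetDl.
  by rewrite -(flag_size fA) [in RHS](cardsD1 a) aA cardsU1 !inE (negPf bA) andbF.
exists (b |: A :\ a); apply/i_adjacentP => //; split=> [|z zA rz].
  by apply: contraNneq bA => ->; rewrite setU11.
by rewrite !inE zA andbT; apply/orP; right; apply: contraNneq rz => ->; rewrite ra.
Qed.

Lemma i_adjacent_comm i j A B C D E : (i < n)%N -> (j < n)%N ->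
    (i.+1 < j)%N || (j.+1 < i)%N ->
    i_adjacent i A B -> i_adjacent j B C ->
    i_adjacent j A D -> i_adjacent i D E -> C = E.
Proof.
move=> lt_in lt_jn ij adjAB adjBC adjAD adjDE.
apply: (i_adjacent_uniq lt_in) adjDE.
have [[fA fB] [_ fC]] := (i_adjacent_flags adjAB, i_adjacent_flags adjBC).
have [_ fD] := i_adjacent_flags adjAD.
apply/i_adjacentP => //; split=> [|z zD rz]; last first.
  have [rzj|rzj] := eqVneq (rank z) j%:Z; last first.
    by rewrite -(i_adjacent_mem adjBC) // -(i_adjacent_mem adjAB) // (i_adjacent_mem adjAD).
  have [|c cC rc] := flag_face_of_rank (i := j%:Z) fC; first by lia.
  rewrite (i_adjacent_face_eq lt_jn adjAD adjBC _ zD cC) // => x rx.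
  by rewrite (i_adjacent_mem adjAB) //; clear -ij rx; lia.
have [|a aA ra] := flag_face_of_rank (i := i%:Z) fA; first by lia.
have [|b bB rb] := flag_face_of_rank (i := i%:Z) fB; first by lia.
apply: contraNneq (i_adjacent_face_neq adjAB aA bB ra rb) => eqDC.
apply/eqP/(flag_rank_inj fD); last by rewrite ra.
  by rewrite -(i_adjacent_mem adjAD) // ra; clear -ij; lia.
by rewrite eqDC -(i_adjacent_mem adjBC) // rb; clear -ij; lia.
Qed.

Lemma GammaP g : reflect {mono g : x y / (x <= y)%O} (g \in Gamma P).
Proof.
rewrite inE; apply: (iffP forallP) => [gE x y|gE x].
  exact: (eqP (forallP (gE x) y)).
by apply/forallP=> y; apply/eqP.
Qed.

Lemma Gamma_comparable g : g \in Gamma P -> {mono g : x y / (x >=< y)%O}.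
Proof. by move=> /GammaP g_mono x y; rewrite /Order.comparable !g_mono. Qed.

Lemma duality_comparable g : duality g -> {mono g : x y / (x >=< y)%O}.
Proof. by move=> g_anti x y; rewrite /Order.comparable !g_anti orbC. Qed.

Lemma Gamma_flag g A : g \in Gamma P -> flag A -> flag (g @: A).
Proof. by move/Gamma_comparable; apply: flag_imset. Qed.

Lemma duality_flag g A : duality g -> flag A -> flag (g @: A).
Proof. by move/duality_comparable; apply: flag_imset. Qed.

Lemma Gamma_rank g x : g \in Gamma P -> rank (g x) = rank x.
Proof.
move=> /GammaP g_mono; apply: (@rank_unique (@rank n P \o g)) => [y|y z yz] //=.
by rewrite rank_lt // lt_neqAle (inj_eq perm_inj) g_mono -lt_neqAle.
Qed.

Lemma duality_rank g x : duality g -> rank (g x) = n%:Z - 1 - rank x.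
Proof.
move=> g_anti; suff : n%:Z - 1 - rank (g x) = rank x by lia.
apply: (@rank_unique (fun y => n%:Z - 1 - rank (g y))) => [y|y z yz].
  by have := rank_bounds (g y); lia.
have := @rank_lt (g z) (g y); rewrite lt_neqAle (inj_eq perm_inj) g_anti eq_sym.
by rewrite -lt_neqAle => /(_ yz); lia.
Qed.

Lemma i_adjacent_imset g i j A B : {mono g : x y / (x >=< y)%O} ->
    (forall x, rank x = i%:Z -> rank (g x) = j%:Z) ->
  i_adjacent i A B -> i_adjacent j (g @: A) (g @: B).
Proof.
move=> g_mono g_rank adjAB; have [fA fB] := i_adjacent_flags adjAB.
apply/i_adjacentP; rewrite ?flag_imset //; split.
  by rewrite (inj_eq (imset_inj perm_inj)) (i_adjacent_neq adjAB).
move=> _ /imsetP[x xA ->] rx; rewrite imset_f // -(i_adjacent_mem adjAB) //.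
by apply: contra rx => /eqP/g_rank->.
Qed.

Lemma Gamma_i_adjacent g i A B : g \in Gamma P ->
  i_adjacent i A B -> i_adjacent i (g @: A) (g @: B).
Proof.
by move=> gG; apply: i_adjacent_imset => [|x]; rewrite ?Gamma_rank //; apply: Gamma_comparable.
Qed.

Lemma duality_i_adjacent g i j A B : duality g -> (i + j).+1 = n ->
  i_adjacent i A B -> i_adjacent j (g @: A) (g @: B).
Proof.
move=> dg ij; apply: i_adjacent_imset => [|x rx]; first exact: duality_comparable.
by rewrite duality_rank // rx; lia.
Qed.

Lemma adjacent_i_adjacent A B : adjacent A B -> exists2 i, i_adjacent i A B & (i < n)%N.
Proof.
move=> adjAB; have /and4P[fA fB /cards1P[x ABx] _] := adjAB.
have /setDP[xA xB] : x \in A :\: B by rewrite ABx set11.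
have [x0 x0_le] := polytope_least (polytopeP P).
have x0B : x0 \in B by apply: flag_comparable => // y _; rewrite /Order.comparable x0_le.
have x0_lt : (x0 < x)%O by rewrite lt_neqAle x0_le andbT; apply: contraNneq xB => <-.
have lt_x1 : (x < greatest_face)%O.
  rewrite lt_neqAle le_greatest_face andbT; apply: contraNneq xB => ->.
  exact: greatest_face_in_flag.
have := (rank_lt x0_lt, rank_lt lt_x1); rewrite rank_greatest_face => -[r0 r1].
have := rank_bounds x0 => r0_ge; exists `|rank x|%N; last by lia.
rewrite /i_adjacent adjAB ABx; apply/forall_inP=> y /set1P->.
by apply/eqP; lia.
Qed.

Lemma imset_permM g h A : (g * h)%g @: A = h @: (g @: A).
Proof. exact: (actM 'P^*). Qed.

Lemma imset_perm1 A : (1%g : {perm P}) @: A = A.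
Proof. exact: (act1 'P^*). Qed.

Lemma Gamma_fixes_flag g A : g \in Gamma P -> flag A -> g @: A = A -> g = 1%g.
Proof.
move=> gG fA gA.
have fix_adj B C : adjacent B C -> g @: B = B -> g @: C = C.
  move=> /adjacent_i_adjacent[i adjBC lt_in] gB; apply: (i_adjacent_uniq lt_in _ adjBC).
  by rewrite -[B in i_adjacent _ B]gB; apply: Gamma_i_adjacent.
have fix_flag B : flag B -> g @: B = B.
  move=> fB; have /connectP[s sP ->] := polytope_connected (polytopeP P) fA fB.
  have {sP} : path (@adjacent _ P) A s by apply: sub_path sP => C D /and3P[].
  by elim: s A gA {fA} => //= C s IH A0 gA0 /andP[/fix_adj/(_ gA0)/IH].
apply/permP=> x; rewrite perm1; have [B fB xB] := face_in_flag x.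
apply: (flag_rank_inj fB) => //; last exact: Gamma_rank.
by rewrite -(fix_flag B fB); apply: imset_f.
Qed.

Lemma Gamma_flag_inj g h A : g \in Gamma P -> h \in Gamma P -> flag A ->
  g @: A = h @: A -> g = h.
Proof.
move=> gG hG fA gA; apply/eqP; rewrite eq_mulgV1; apply/eqP.
apply: (@Gamma_fixes_flag _ A); rewrite ?groupM ?groupV //.
by rewrite imset_permM gA -imset_permM mulgV imset_perm1.
Qed.

End Polytope.

(** * Regular polytopes *)

Section Regular.
Variables (n : nat) (Q : polytope n) (Phi : {set Q}).
Hypotheses (Phi_flag : flag Phi) (Q_regular : regular Q).
Implicit Types (A B C : {set Q}) (g d : {perm Q}) (i j : nat).
Local Open Scope group_scope.

Lemma regular_transitive A B : flag A -> flag B -> exists2 g, g \in Gamma Q & g @: A = B.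
Proof.
move=> fA fB; have := Q_regular; rewrite /regular => Q_trans.
by have [||g gG ->] := atransP2 Q_trans (x := A) (y := B); rewrite ?inE //; exists g.
Qed.

Lemma rhoP i : (i < n)%N ->
  rho Phi i \in Gamma Q /\ i_adjacent i Phi (rho Phi i @: Phi).
Proof.
move=> lt_in; rewrite /rho; case: pickP => [g /andP[gG adjg]|none] //=.
have [B adjB] := i_adjacent_exists lt_in Phi_flag.
have [_ fB] := i_adjacent_flags adjB.
have [g gG gB] := regular_transitive Phi_flag fB.
by have := none g; rewrite gG gB adjB.
Qed.

Lemma rho_Gamma i : (i < n)%N -> rho Phi i \in Gamma Q.
Proof. by case/rhoP. Qed.

Lemma rho_adjacent i g : (i < n)%N -> g \in Gamma Q ->
  i_adjacent i (g @: Phi) ((rho Phi i * g) @: Phi).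
Proof.
by move=> lt_in gG; rewrite imset_permM; apply: Gamma_i_adjacent => //; case: (rhoP lt_in).
Qed.

Lemma rho_sqr i : (i < n)%N -> rho Phi i * rho Phi i = 1.
Proof.
move=> lt_in; have [rG adj_r] := rhoP lt_in.
apply: (Gamma_flag_inj (A := Phi)); rewrite ?groupM ?group1 // imset_perm1.
exact: i_adjacent_uniq lt_in (rho_adjacent lt_in rG) (i_adjacent_sym adj_r).
Qed.

Lemma rho_inv i : (i < n)%N -> (rho Phi i)^-1 = rho Phi i.
Proof. by move=> lt_in; apply: invg_sqr1; rewrite expg2 rho_sqr. Qed.

Lemma rho_commute i j : (i < n)%N -> (j < n)%N -> (i.+1 < j)%N || (j.+1 < i)%N ->
  commute (rho Phi i) (rho Phi j).
Proof.
move=> lt_in lt_jn ij; have [riG adj_i] := rhoP lt_in; have [rjG adj_j] := rhoP lt_jn.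
apply: (Gamma_flag_inj (A := Phi)); rewrite ?groupM // orbC in ij *.
exact: i_adjacent_comm lt_jn lt_in ij adj_j (rho_adjacent lt_in rjG)
  adj_i (rho_adjacent lt_jn riG).
Qed.

Lemma rho_fixes_face i x : (i < n)%N -> x \in Phi -> rank x != i%:Z -> rho Phi i x = x.
Proof.
move=> lt_in xPhi rx; have [rG adj_r] := rhoP lt_in; have [_ fr] := i_adjacent_flags adj_r.
apply: (flag_rank_inj fr); [exact: imset_f| |exact: Gamma_rank].
by rewrite -(i_adjacent_mem adj_r).
Qed.

(** The rotation [sigma_i] of the paper, for [0 < i < n]. *)
Definition sigma i : {perm Q} := rho Phi i.-1 * rho Phi i.

Lemma sigma_flag i g B C : (0 < i < n)%N -> g \in Gamma Q ->
    i_adjacent i (g @: Phi) B -> i_adjacent i.-1 B C ->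
  (sigma i * g) @: Phi = C.
Proof.
move=> /andP[i_gt0 lt_in] gG adjB adjC; rewrite /sigma -mulgA.
have lt_in' : (i.-1 < n)%N by rewrite (leq_ltn_trans (leq_pred i)).
have riG : rho Phi i * g \in Gamma Q by rewrite groupM ?rho_Gamma.
apply: i_adjacent_uniq lt_in' (rho_adjacent lt_in' riG) _.
by rewrite (i_adjacent_uniq lt_in (rho_adjacent lt_in gG) adjB).
Qed.

Lemma sigma_Gamma i : (0 < i < n)%N -> sigma i \in Gamma Q.
Proof.
by case/andP=> _ lt_in; rewrite groupM ?rho_Gamma // (leq_ltn_trans (leq_pred i)).
Qed.

Lemma duality_fixing_flag : self_dual Q -> exists2 d, duality d & d @: Phi = Phi.
Proof.
case=> d0 dual_d0.
have [g gG gd0] := regular_transitive (duality_flag dual_d0 Phi_flag) Phi_flag.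
exists (d0 * g); last by rewrite imset_permM.
by move=> x y; rewrite !permM (GammaP _ gG) dual_d0.
Qed.

Lemma rho_conj_duality d i j : duality d -> d @: Phi = Phi -> (i + j).+1 = n ->
  rho Phi i ^ d = rho Phi j.
Proof.
move=> dual_d dPhi ij.
have [lt_in lt_jn] : (i < n)%N /\ (j < n)%N by lia.
have [riG adj_i] := rhoP lt_in; have [rjG adj_j] := rhoP lt_jn.
have dVPhi : d^-1 @: Phi = Phi by rewrite -{1}dPhi -imset_permM mulgV imset_perm1.
apply: (Gamma_flag_inj (A := Phi)) => //.
  by apply/GammaP=> x y; rewrite conjgE !permM dual_d (GammaP _ riG) -dual_d !permKV.
apply: i_adjacent_uniq lt_jn _ adj_j; rewrite conjgE !imset_permM dVPhi -{1}dPhi.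
exact: duality_i_adjacent dual_d ij adj_i.
Qed.

Lemma sigma_conj_duality d i j : duality d -> d @: Phi = Phi ->
  (0 < i)%N -> (0 < j)%N -> (i + j)%N = n -> sigma i ^ d = (sigma j)^-1.
Proof.
move=> dual_d dPhi i_gt0 j_gt0 ij.
rewrite /sigma conjMg invMg !rho_inv; try lia.
by rewrite (rho_conj_duality (j := j)) ?(@rho_conj_duality d i j.-1) //; lia.
Qed.

End Regular.

Lemma Gamma_plus_sub (n : nat) (P : polytope n) (A : {set P}) : Gamma_plus A \subset Gamma P.
Proof.
have rG i : rho A i \in Gamma P.
  by rewrite /rho; case: pickP => [g /andP[]|_] //=; apply: group1.
by rewrite gen_subG; apply/subsetP=> _ /imsetP[i _ ->]; apply: groupM.
Qed.

Lemma Gamma_plus_sigma (Q : polytope 4) (Phi : {set Q}) :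
  Gamma_plus Phi = <<[set sigma Phi 1; sigma Phi 2; sigma Phi 3]>>%g.
Proof.
congr <<_>>%g; apply/setP=> g; rewrite !inE; apply/imsetP/idP.
  by case=> -[[|[|[|//]]] lt3] _ -> /=; rewrite eqxx ?orbT.
case/orP=> [/orP[]|] /eqP->.
- by exists (@Ordinal 3 0 isT).
- by exists (@Ordinal 3 1 isT).
- by exists (@Ordinal 3 2 isT).
Qed.

Lemma sigma123_sqr (Q : polytope 4) (Phi : {set Q}) : flag Phi -> regular Q ->
  ((sigma Phi 1 * sigma Phi 2 * sigma Phi 3) ^+ 2 = 1)%g.
Proof.
move=> Phi_flag Q_regular.
have r_sqr i : (i < 4)%N -> (rho Phi i * rho Phi i = 1)%g by apply: rho_sqr.
have -> : (sigma Phi 1 * sigma Phi 2 * sigma Phi 3 = rho Phi 0 * rho Phi 3)%g.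
  rewrite /sigma /= -!mulgA (mulgA (rho Phi 1)) r_sqr // mul1g.
  by rewrite (mulgA (rho Phi 2)) r_sqr // mul1g.
rewrite expg2 {1}(rho_commute Phi_flag Q_regular (i := 0) (j := 3)) //.
by rewrite -mulgA (mulgA (rho Phi 0)) r_sqr // mul1g r_sqr.
Qed.

Definition has_facets (n : nat) (P : polytope n) (S : Type) (leS : S -> S -> Prop) : Prop :=
  forall F : P, rank F = n%:Z - 1 ->
    order_iso (fun x y : {x : P | (x <= F)%O} => (sval x <= sval y)%O) leS.

Lemma dual_has_type (n : nat) (P : polytope n) (d : {perm P}) (S : Type)
    (leS leT : S -> S -> Prop) :
  duality d -> (forall x y, leT x y <-> leS y x) -> has_facets P leS -> has_type P leS leT.
Proof.
move=> dual_d leTE facP; split=> // v rv.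
have rdv : rank (d v) = n%:Z - 1 by rewrite (duality_rank _ dual_d) rv subr0.
have [phi phi_bij phi_le] := facP _ rdv.
have to_le (x : {x : P | (v <= x)%O}) : (d (sval x) <= d v)%O.
  by rewrite dual_d; apply: (svalP x).
have of_le (y : {y : P | (y <= d v)%O}) : (v <= (d^-1)%g (sval y))%O.
  by rewrite -dual_d permKV; apply: (svalP y).
exists (fun x => phi (exist _ (d (sval x)) (to_le x))) => [|x y].
  apply: (bij_comp phi_bij); exists (fun y => exist _ ((d^-1)%g (sval y)) (of_le y)).
    by case=> x vx; apply: eq_exist; rewrite /= permK.
  by case=> y yv; apply: eq_exist; rewrite /= permKV.
by rewrite leTE -phi_le /= dual_d.
Qed.

(** * The triangular tessellation and its toroidal quotients *)

Section Tessellation.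
Implicit Types (u v w t : point) (k l m : nat) (f g : tess_face).

Lemma pointD (a b c d : int) : (a, b) + (c, d) = (a + c, b + d) :> point.
Proof. by []. Qed.

Lemma pointMz (a b c : int) : (a, b) *~ c = (a * c, b * c) :> point.
Proof.
have pointMn (n : nat) : (a, b) *+ n = (a * n%:Z, b * n%:Z) :> point.
  elim: n => [|n IH]; first by rewrite !mulr0.
  by rewrite mulrS IH pointD intS !mulrDr !mulr1.
by case: c => n; rewrite ?NegzE ?mulrNz -pmulrn pointMn ?mulrN.
Qed.

Lemma iter_rot60D k : {morph iter k rot60 : v w / v + w}.
Proof.
move=> v w; elim: k => //= k ->; case: (iter k _ v) (iter k _ w) => a b [c d].
by rewrite /rot60 /= !pointD /= opprD addrACA.
Qed.

Lemma iter_rot60_0 k : iter k rot60 0 = 0.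
Proof. by elim: k => //= k ->. Qed.

Lemma iter_rot60N k : {morph iter k rot60 : v / - v}.
Proof.
by move=> v; apply: (addrI (iter k rot60 v)); rewrite -iter_rot60D !subrr iter_rot60_0.
Qed.

Lemma iter_rot60_unit_vec k l : iter k rot60 (unit_vec l) = unit_vec (k + l).
Proof. by rewrite /unit_vec iterD. Qed.

Lemma unit_vecD3 k : unit_vec (k + 3) = - unit_vec k.
Proof. by rewrite -iter_rot60_unit_vec -iter_rot60N. Qed.

Lemma unit_vec_mod6 k : unit_vec (k %% 6) = unit_vec k.
Proof.
have unit_vecD6 l : unit_vec (l + 6) = unit_vec l.
  by rewrite -[6%N]/(3 + 3)%N addnA !unit_vecD3 opprK.
rewrite [in RHS](divn_eq k 6) addnC; elim: (k %/ 6)%N => [|n IH]; first by rewrite addn0.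
by rewrite mulSnr addnA unit_vecD6.
Qed.

Lemma unit_vec_eqmod6 k l : k = l %[mod 6] -> unit_vec k = unit_vec l.
Proof. by rewrite -unit_vec_mod6 => ->; apply: unit_vec_mod6. Qed.

Lemma unit_vec_eq k l : (unit_vec k == unit_vec l) = (k == l %[mod 6]).
Proof.
rewrite -unit_vec_mod6 -(unit_vec_mod6 l).
have := ltn_pmod l (isT : (0 < 6)%N); have := ltn_pmod k (isT : (0 < 6)%N).
by case: (k %% 6)%N => [|[|[|[|[|[|]]]]]] //; case: (l %% 6)%N => [|[|[|[|[|[|]]]]]].
Qed.

Lemma unit_vec_neq0 k : unit_vec k != 0.
Proof.
rewrite -unit_vec_mod6; have := ltn_pmod k (isT : (0 < 6)%N).
by case: (k %% 6)%N => [|[|[|[|[|[|]]]]]].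
Qed.

(** The rotations of the tessellation act simply transitively on the pairs
    [(v, k)]: the flag of [(v, k)] consists of the vertex [v], the edge [tedge v k]
    from [v] in direction [unit_vec k], and the triangle [ttri v k] between the
    directions [unit_vec k] and [unit_vec k.+1]. *)
Definition tedge v k : tess_face :=
  TEdge (if (k %% 6 < 3)%N then v else v + unit_vec k) (inord (k %% 3)).

Definition ttri_base k : point :=
  nth 0 [:: 0; 0; unit_vec 3; unit_vec 4; unit_vec 4; unit_vec 5] (k %% 6).

Definition ttri v k : tess_face := TTriangle (v + ttri_base k) (inord (k %% 2)).

Definition tess_rank f : nat :=
  match f with
  | TEmpty => 0 | TVertex _ => 1 | TEdge _ _ => 2 | TTriangle _ _ => 3 | TPlane => 4
  end.

Definition tface (i : nat) v k : tess_face :=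
  match i with
  | 0 => TEmpty
  | 1 => TVertex v
  | 2 => tedge v k
  | 3 => ttri v k
  | _ => TPlane
  end.

Lemma tess_rank_tface i v k : (i <= 4)%N -> tess_rank (tface i v k) = i.
Proof. by case: i => [|[|[|[|[|]]]]]. Qed.

Lemma tedge_eqmod6 v k l : k = l %[mod 6] -> tedge v k = tedge v l.
Proof.
move=> eq_kl; rewrite /tedge (unit_vec_eqmod6 eq_kl) eq_kl.
by congr (TEdge _ (inord _)); lia.
Qed.

Lemma ttri_eqmod6 v k l : k = l %[mod 6] -> ttri v k = ttri v l.
Proof.
move=> eq_kl; rewrite /ttri /ttri_base eq_kl.
by congr (TTriangle _ (inord _)); lia.
Qed.

Lemma tface_eqmod6 i v k l : k = l %[mod 6] -> tface i v k = tface i v l.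
Proof.
by case: i => [|[|[|[|i]]]] //=; [apply: tedge_eqmod6|apply: ttri_eqmod6].
Qed.

Lemma tedgeD3 v k : tedge (v + unit_vec k) (k + 3) = tedge v k.
Proof.
rewrite /tedge unit_vecD3 addrK; congr (TEdge _ (inord _)); last by lia.
by case: ifP; case: ifP => //; lia.
Qed.

Lemma ttri_baseD4 k : unit_vec k.+1 + ttri_base (k + 4) = ttri_base k.
Proof.
have -> : unit_vec k.+1 = unit_vec (k %% 6).+1 by apply: unit_vec_eqmod6; lia.
rewrite /ttri_base -(modnDml k); have := ltn_pmod k (isT : (0 < 6)%N).
by case: (k %% 6)%N => [|[|[|[|[|[|]]]]]].
Qed.

Lemma ttriD4 v k : ttri (v + unit_vec k.+1) (k + 4) = ttri v k.
Proof. by rewrite /ttri -addrA ttri_baseD4; congr (TTriangle _ (inord _)); lia. Qed.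

(** The rotation by one step about the face of rank [i - 1] of the flag of [(v, k)]. *)
Definition next_flag (i : nat) (x : point * nat) : point * nat :=
  match i with
  | 1 => (x.1, (x.2 + 5)%N)
  | 2 => (x.1 + unit_vec x.2, (x.2 + 3)%N)
  | _ => (x.1 + unit_vec x.2.+1, (x.2 + 4)%N)
  end.

Lemma tface_iter_next_flag i n x : let y := iter n (next_flag i) x in
  tface i y.1 y.2 = tface i x.1 x.2.
Proof.
elim: n => //= n <-; case: (iter n _ x) => v k.
by case: i => [|[|[|[|]]]] //=; rewrite ?tedgeD3 ?ttriD4.
Qed.

Lemma tedge_ord v (l : 'I_3) : TEdge v l = tedge v l.
Proof.
by rewrite /tedge; case: l => -[|[|[|]]] // ltl; congr TEdge; apply: val_inj; rewrite /= inordK.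
Qed.

Lemma ttri_ord v (l : 'I_2) : TTriangle v l = ttri v l.
Proof.
rewrite /ttri; case: l => -[|[|]] // ltl; rewrite addr0; congr TTriangle;
by apply: val_inj; rewrite /= inordK.
Qed.

Definition tess_flag f : point * nat :=
  match f with
  | TVertex v => (v, 0)
  | TEdge v l => (v, l : nat)
  | TTriangle v l => (v, l : nat)
  | TEmpty | TPlane => (0, 0)
  end.

Lemma tess_flagK f : tface (tess_rank f) (tess_flag f).1 (tess_flag f).2 = f.
Proof. by case: f => //= v l; rewrite ?tedge_ord ?ttri_ord. Qed.

Lemma tess_rank_le4 f : (tess_rank f <= 4)%N.
Proof. by case: f. Qed.

Lemma tfaceP f : exists i v k, (i <= 4)%N /\ f = tface i v k.
Proof.
by exists (tess_rank f), (tess_flag f).1, (tess_flag f).2; rewrite tess_flagK tess_rank_le4.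
Qed.

Lemma corners_tface i v k : (i <= 3)%N ->
  corners (tface i v k) =i take i [:: v; v + unit_vec k; v + unit_vec k.+1].
Proof.
have -> : unit_vec k.+1 = unit_vec (k %% 6).+1 by apply: unit_vec_eqmod6; lia.
rewrite -(tface_eqmod6 i v (modn_mod k 6)) -(unit_vec_mod6 k).
have := ltn_pmod k (isT : (0 < 6)%N).
case: i => [|[|[|[|]]]] //; case: (k %% 6)%N => [|[|[|[|[|[|]]]]]] //= _ _ x;
  rewrite ?inordK // !inE -?addrA; case: v x => a b [c d];
  by rewrite ?xpair_eqE /=; lia.
Qed.

Lemma vertex_in_corners_tface i v k : (i <= 3)%N -> (v \in corners (tface i v k)) = (0 < i)%N.
Proof.
by move=> le_i3; rewrite corners_tface //; case: i le_i3 => // i _; rewrite mem_head.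
Qed.

Lemma unit_vec_in_corners_tface i v k l : (i <= 3)%N ->
  (v + unit_vec l \in corners (tface i v k)) =
  (1 < i)%N && (l == k %[mod 6]) || (2 < i)%N && (l == k.+1 %[mod 6]).
Proof.
have neq_v : (v + unit_vec l == v) = false.
  by rewrite -subr_eq0 addrAC subrr add0r (negPf (unit_vec_neq0 l)).
move=> le_i3; rewrite corners_tface //; case: i le_i3 => [|[|[|[|]]]] // _;
by rewrite !inE ?neq_v ?(inj_eq (addrI v)) ?unit_vec_eq ?orbF.
Qed.

Lemma tface_at_corner i v k w : (i <= 3)%N -> w \in corners (tface i v k) ->
  exists n, (iter n (next_flag i) (v, k)).1 = w.
Proof.
have unit_vec_hexagon : unit_vec k.+1 + unit_vec (k + 4).+1 = unit_vec k.
  by rewrite -addnS -addn1 -!iter_rot60_unit_vec -iter_rot60D.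
move=> le_i3; rewrite corners_tface //.
case: i le_i3 => [|[|[|[|]]]] // _; rewrite !inE ?orbF.
- by move/eqP->; exists 0.
- by case/orP=> /eqP->; [exists 0|exists 1%N].
- case/or3P=> /eqP->; [by exists 0| |by exists 1%N].
  by exists 2; rewrite /= -addrA unit_vec_hexagon.
Qed.

Lemma tface_direction i v k l : (1 < i <= 3)%N -> tface i v k = tface i v l -> k = l %[mod 6].
Proof.
case/andP=> lt1i le_i3 eq_kl.
have := unit_vec_in_corners_tface v l k le_i3; have := unit_vec_in_corners_tface v l k.+1 le_i3.
rewrite -eq_kl !unit_vec_in_corners_tface // lt1i !eqxx /= orbC.
by case: i lt1i le_i3 {eq_kl} => [|[|[|[|]]]] //= _ _; clear; lia.
Qed.

Lemma tface_eq_next_flag i v k w l : (0 < i <= 3)%N -> tface i v k = tface i w l ->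
  exists n m, iter n (next_flag i) (v, k) = (w, m) /\ m = l %[mod 6].
Proof.
case/andP=> i_gt0 le_i3 eq_face; have [i1|neq_i1] := eqVneq i 1%N.
  have iterE n : iter n (next_flag 1) (v, k) = (v, k + n * 5)%N.
    by elim: n => [|n IH]; rewrite ?addn0 //= IH mulSnr addnA.
  rewrite {i i_gt0 le_i3}i1 in eq_face *; case: eq_face => <-.
  by exists (k + 5 * l)%N, (k + (k + 5 * l) * 5)%N; split; [apply: iterE|lia].
have [|n iter_w] := @tface_at_corner i v k w le_i3.
  by rewrite eq_face vertex_in_corners_tface.
exists n, (iter n (next_flag i) (v, k)).2; split; first by rewrite -iter_w -surjective_pairing.
apply: (@tface_direction i w); first by lia.
by rewrite -{1}iter_w tface_iter_next_flag.
Qed.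

Lemma tri_le_corners f g : {subset corners f <= corners g} -> f <> TPlane -> tri_le f g.
Proof. by case: f => [|v|v l|v l|] //; case: g. Qed.

Lemma corners_tri_le i j v k w l : (0 < i)%N -> (i <= 3)%N -> (j <= 3)%N ->
  tri_le (tface i v k) (tface j w l) ->
  {subset corners (tface i v k) <= corners (tface j w l)}.
Proof.
by case: i => [|[|[|[|]]]] // _ _; case: j => [|[|[|[|]]]].
Qed.

Lemma tri_le_refl f : tri_le f f.
Proof. by case: f => //= [v|v l|v l]. Qed.

Lemma tface_le i j v k : (i <= j <= 4)%N -> tri_le (tface i v k) (tface j v k).
Proof.
case/andP; rewrite leq_eqVlt => /predU1P[<- _|]; first exact: tri_le_refl.
rewrite [(j <= 4)%N]leq_eqVlt => lt_ij /predU1P[->|lt_j4].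
  by case: (tface i v k).
apply: tri_le_corners => [x|]; last by case: i lt_ij => [|[|[|]]] //; lia.
rewrite !corners_tface; try lia.
by rewrite -[i](minn_idPl (ltnW lt_ij)) take_min; apply: mem_take.
Qed.

Lemma tri_leP f g : tri_le f g ->
  exists i j v k, [/\ (i <= j <= 4)%N, f = tface i v k & g = tface j v k].
Proof.
have [i [v [k [le_i4 ->]]]] := tfaceP f; have [j [w [l [le_j4 ->]]]] := tfaceP g.
have [->|neq_j4] := eqVneq j 4%N; first by exists i, 4, v, k; rewrite le_i4.
have [->|neq_i0] := eqVneq i 0%N; first by exists 0, j, w, l.
have [->|neq_i4] := eqVneq i 4%N.
  by case: j le_j4 neq_j4 => [|[|[|[|[|]]]]].
have [[lt0i le_i3] le_j3] : ((0 < i)%N /\ (i <= 3)%N) /\ (j <= 3)%N by lia.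
move/(corners_tri_le lt0i le_i3 le_j3) => sub_fg.
have v_g : v \in corners (tface j w l) by apply: sub_fg; rewrite vertex_in_corners_tface.
have [n iter_v] := tface_at_corner le_j3 v_g.
have /= := tface_iter_next_flag j n (w, l); rewrite iter_v.
set m := (iter n _ _).2 => gE; rewrite -{}gE in sub_fg v_g *.
move: v_g; rewrite vertex_in_corners_tface // => lt0j.
have vk_g := sub_fg (v + unit_vec k); have vk1_g := sub_fg (v + unit_vec k.+1).
rewrite !unit_vec_in_corners_tface // !eqxx ?andbT in vk_g vk1_g.
have [eq_km|neq_km] := eqVneq (k %% 6)%N (m %% 6)%N.
  by exists i, j, v, m; rewrite (tface_eqmod6 _ _ eq_km); split=> //; lia.
have [->|neq_i1] := eqVneq i 1%N; first by exists 1, j, v, m; rewrite lt0j.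
have [-> -> eq_km1] : [/\ i = 2, j = 3 & k = m.+1 %[mod 6]].
  by move: vk_g vk1_g; clear -lt0i le_i3 le_j3 neq_km neq_i1; split; lia.
exists 2, 3, (v + unit_vec m.+1), (m + 4)%N; split=> //=; last by rewrite ttriD4.
by rewrite (tedge_eqmod6 v eq_km1) -tedgeD3 addSnnS.
Qed.

Lemma tface_translate i v k t : tface i (v + t) k = translate t (tface i v k).
Proof.
case: i => [|[|[|[|i]]]] //=; last by rewrite /ttri /= addrAC.
by rewrite /tedge; case: ifP => _ //=; rewrite addrAC.
Qed.

Lemma tedge_translate_direction v w t k l :
  tedge w l = translate t (tedge v k) -> l = k %[mod 3].
Proof. by case=> _ /(congr1 (@nat_of_ord 3)); rewrite !inordK ?ltn_mod. Qed.

Lemma ttri_translate_direction v w t k l :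
  ttri w l = translate t (ttri v k) -> l = k %[mod 2].
Proof.
move/(congr1 (fun f => if f is TTriangle _ i then i : nat else 0%N)).
by rewrite /= !inordK ?ltn_mod.
Qed.

Lemma translate0 f : translate 0 f = f.
Proof. by case: f => //= *; rewrite addr0. Qed.

Lemma translateD v w f : translate v (translate w f) = translate (w + v) f.
Proof. by case: f => //= *; rewrite addrA. Qed.

Lemma corners_translate t f : corners (translate t f) = map (+%R^~ t) (corners f).
Proof. by case: f => //= *; rewrite ![_ + t + _]addrAC. Qed.

Lemma tri_le_translate t f g : tri_le f g -> tri_le (translate t f) (translate t g).
Proof.
case/tri_leP=> i [j [v [k [le_ij -> ->]]]].
by rewrite -!tface_translate; apply: tface_le.
Qed.

Lemma in_lattice0 u : in_lattice u 0.
Proof. by exists 0, 0; rewrite !mulr0z addr0. Qed.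

Lemma in_latticeB u v w : in_lattice u v -> in_lattice u w -> in_lattice u (v - w).
Proof.
case=> a [b ->] [c [d ->]]; exists (a - c), (b - d).
by rewrite !mulrzBr opprD addrACA.
Qed.

Lemma in_latticeN u v : in_lattice u v -> in_lattice u (- v).
Proof. by move=> uv; rewrite -sub0r; apply/in_latticeB/uv/in_lattice0. Qed.

Lemma in_latticeD u v w : in_lattice u v -> in_lattice u w -> in_lattice u (v + w).
Proof. by move=> uv uw; rewrite -[w]opprK; apply/in_latticeB/in_latticeN. Qed.

Lemma translation_orbit_refl u f : translation_orbit u f f.
Proof. by exists 0; [apply: in_lattice0|rewrite translate0]. Qed.

Lemma translation_orbit_sym u f g : translation_orbit u f g -> translation_orbit u g f.
Proof.
case=> t ut ->; exists (- t); first exact: in_latticeN.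
by rewrite translateD subrr translate0.
Qed.

Lemma translation_orbit_trans u f g h : translation_orbit u f g ->
  translation_orbit u g h -> translation_orbit u f h.
Proof.
case=> t ut -> [s us ->]; exists (t + s); first exact: in_latticeD.
by rewrite translateD.
Qed.

Lemma translation_orbit_eq u f g : translation_orbit u f g ->
  translation_orbit u f = translation_orbit u g.
Proof.
move=> fg; apply/funext=> h; apply/propext; split; apply: translation_orbit_trans => //.
exact: translation_orbit_sym.
Qed.

Lemma map63_dual u (A B : torus_face u) : map63 A B <-> map36 B A.
Proof. by split=> -[f [g [Af Bg fg]]]; exists g, f. Qed.

Section TorusCover.
Variables (u : point) (S : Type) (leS : S -> S -> Prop).

(** [h] identifies the quotient of the tessellation by the lattice of [u] with
    the ordered set [S]. *)
Record torus_cover (h : tess_face -> S) : Prop := TorusCover {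
  cover_surj : forall x, exists f, h f = x;
  cover_fiber : forall f g, h f = h g <-> translation_orbit u f g;
  cover_le : forall f g, leS (h f) (h g) <->
    exists2 g', translation_orbit u g g' & tri_le f g'
}.

Lemma torus_cover_of_iso : order_iso leS (@map36 u) -> exists h, torus_cover h.
Proof.
case=> phi [psi phiK psiK] phi_le.
pose cls f : torus_face u := exist _ (translation_orbit u f) (ex_intro _ f erefl).
exists (psi \o cls); split=> [x|f g|f g] /=.
- have [f fE] := svalP (phi x); exists f.
  by rewrite -[RHS]phiK; congr psi; case: (phi x) fE => A AP /= fE; apply: eq_exist.
- split=> [/(can_inj psiK)/(congr1 sval) /= fg|fg].
    by rewrite fg; apply: translation_orbit_refl.
  by congr psi; apply/eq_exist/translation_orbit_eq.
rewrite phi_le !psiK; split=> [[f1 [g1 [/= [t ut ->] gg1 le_fg1]]]|[g' gg' le_fg]].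
  exists (translate (- t) g1).
    by apply: translation_orbit_trans gg1 _; exists (- t) => //; apply: in_latticeN.
  by have := tri_le_translate (- t) le_fg1; rewrite translateD subrr translate0.
by exists f, g'; split=> //=; apply: translation_orbit_refl.
Qed.

Lemma iso_of_torus_cover h : torus_cover h -> order_iso leS (@map36 u).
Proof.
case=> h_surj h_fiber h_le.
have fiberE f : (fun g => h g = h f) = translation_orbit u f.
  by apply/funext=> g; apply/propext; split=> [/esym/h_fiber|/h_fiber].
have fiber_orbit x : exists f, (fun g => h g = x) = translation_orbit u f.
  by have [f <-] := h_surj x; exists f.
exists (fun x => exist _ (fun g => h g = x) (fiber_orbit x)).
  exists (fun A : torus_face u => h (sval (cid (svalP A)))) => [x|[A AP]].
    case: cid => f /= fE; have : translation_orbit u f f by apply: translation_orbit_refl.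
    by rewrite -fE.
  by apply: eq_exist; rewrite fiberE; case: cid => f /= ->.
move=> x y; split=> [le_xy|[f [g [/= <- <- le_fg]]]].
  have [f fx] := h_surj x; have [g gy] := h_surj y.
  have /h_le[g' gg' le_fg'] : leS (h f) (h g) by rewrite fx gy.
  by exists f, g'; split=> //=; rewrite -gy; apply/esym/h_fiber.
by apply/h_le; exists g => //; apply: translation_orbit_refl.
Qed.

End TorusCover.
Lemma in_latticeMz u v (m : int) :
  in_lattice (u *~ m) v <-> exists2 x, in_lattice u x & v = x *~ m.
Proof.
have rot60Mz : rot60 (u *~ m) = rot60 u *~ m.
  by case: u => a b; rewrite /rot60 /= !pointMz /= mulNr -mulrDl.
have combMz r s : u *~ m *~ r + rot60 (u *~ m) *~ s = (u *~ r + rot60 u *~ s) *~ m.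
  by rewrite rot60Mz mulrzDl ![_ *~ m *~ _]mulrzAC.
split=> [[r [s ->]]|[_ [r [s ->]] ->]]; last by exists r, s.
by exists (u *~ r + rot60 u *~ s) => //; exists r, s.
Qed.

Lemma in_lattice_unit x : in_lattice (1, 0) x.
Proof.
by case: x => a b; exists a, b; rewrite /rot60 !pointMz pointD /=; congr (_, _); ring.
Qed.

Definition reflection v : point := (- v.1 - v.2, v.2).

Section PrimeNorm.
Variables (p b c : nat).
Hypotheses (p_prime : prime p) (b_gt0 : (0 < b)%N) (c_gt0 : (0 < c)%N)
  (p_eq : p = (b ^ 2 + b * c + c ^ 2)%N).
Implicit Type x : point.

Let p_eqZ : p%:Z = b%:Z ^+ 2 + b%:Z * c%:Z + c%:Z ^+ 2.
Proof. by rewrite p_eq !PoszD !PoszM !expr2 -!PoszM. Qed.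

Let Euclid_dvdzM (a a' : int) : (p%:Z %| a * a')%Z = (p%:Z %| a)%Z || (p%:Z %| a')%Z.
Proof. by rewrite !dvdzE abszM Euclid_dvdM. Qed.

Lemma prime_norm_ndvd : ~~ (p %| c)%N.
Proof.
by rewrite gtnNdvd // p_eq; move: b_gt0 c_gt0; clear; nia.
Qed.

Let p_ndvd_c : ~~ (p%:Z %| c%:Z)%Z.
Proof. by rewrite dvdzE prime_norm_ndvd. Qed.

Lemma in_lattice_prime_norm x :
  in_lattice (b%:Z, c%:Z) x <-> (p%:Z %| c%:Z * x.1 - b%:Z * x.2)%Z.
Proof.
case: x => x1 x2; split=> [[r [s]]|/dvdzP[k kE]].
  rewrite /rot60 !pointMz pointD /= => -[-> ->].
  by apply/dvdzP; exists (- s); rewrite p_eqZ; ring.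
have p_nz : p%:Z != 0 by rewrite eqz_nat -lt0n prime_gt0.
have : (p%:Z %| c%:Z * (x1 * (b%:Z + c%:Z) + x2 * c%:Z))%Z.
  have -> : c%:Z * (x1 * (b%:Z + c%:Z) + x2 * c%:Z) =
      (c%:Z * x1 - b%:Z * x2) * (b%:Z + c%:Z) + x2 * p%:Z by rewrite p_eqZ; ring.
  by rewrite kE mulrAC -mulrDl dvdz_mull.
rewrite Euclid_dvdzM (negPf p_ndvd_c) => /dvdzP[l lE].
exists l, (- k); rewrite /rot60 !pointMz pointD /=.
congr (_, _); apply: (mulIf p_nz).
  transitivity (b%:Z * (l * p%:Z) + c%:Z * (k * p%:Z)); last by ring.
  by rewrite -lE -kE p_eqZ; ring.
transitivity (c%:Z * (l * p%:Z) - (b%:Z + c%:Z) * (k * p%:Z)); last by ring.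
by rewrite -lE -kE p_eqZ; ring.
Qed.

(* [4 p = (2 b + c) ^ 2 + 3 c ^ 2]. *)
Lemma reflection_notin_lattice : ~~ (p %| 3)%N ->
  ~ in_lattice (b%:Z, c%:Z) (reflection (b%:Z, c%:Z)).
Proof.
move=> p_ndvd3; rewrite in_lattice_prime_norm /=.
have -> : c%:Z * (- b%:Z - c%:Z) - b%:Z * c%:Z = - (c%:Z * (2 * b%:Z + c%:Z)) by ring.
rewrite rpredN Euclid_dvdzM (negPf p_ndvd_c) /= => dvd_2bc.
have : (p%:Z %| 3 * (c%:Z * c%:Z))%Z.
  have -> : 3 * (c%:Z * c%:Z) = 4 * p%:Z - (2 * b%:Z + c%:Z) * (2 * b%:Z + c%:Z).
    by rewrite p_eqZ; ring.
  by rewrite rpredB // ?dvdz_mull // dvdz_mulr.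
by rewrite !Euclid_dvdzM !(negPf p_ndvd_c) !orbF; apply/negP.
Qed.

Lemma in_latticeI_dvd (m : int) v : (p%:Z %| m)%Z ->
  in_lattice (b%:Z, c%:Z) v /\ in_lattice (m, 0) v <-> in_lattice (m, 0) v.
Proof.
have -> : (m, 0) = (1, 0) *~ m :> point by rewrite pointMz mul1r mul0r.
move=> pm; split=> [[]//|vm]; split=> //; apply/in_lattice_prime_norm.
have /in_latticeMz[[x1 x2] _ ->] := vm.
by rewrite pointMz /= rpredB // !dvdz_mull.
Qed.

Lemma in_latticeI_ndvd (m : int) v : ~~ (p%:Z %| m)%Z ->
  in_lattice (b%:Z, c%:Z) v /\ in_lattice (m, 0) v <-> in_lattice (m * b%:Z, m * c%:Z) v.
Proof.
have -> : (m, 0) = (1, 0) *~ m :> point by rewrite pointMz mul1r mul0r.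
have -> : (m * b%:Z, m * c%:Z) = (b%:Z, c%:Z) *~ m :> point by rewrite pointMz ![_ * m]mulrC.
have in_latticeMz_prime x : ~~ (p%:Z %| m)%Z ->
    in_lattice (b%:Z, c%:Z) (x *~ m) <-> in_lattice (b%:Z, c%:Z) x.
  case: x => x1 x2 /negPf p_ndvdm; rewrite !in_lattice_prime_norm pointMz /=.
  by rewrite !mulrA -mulrBl Euclid_dvdzM p_ndvdm orbF.
move=> p_ndvdm; rewrite !in_latticeMz; split=> [[+ [x _ vx]]|[x bc_x ->]].
  by rewrite vx in_latticeMz_prime //; exists x.
split; first exact/in_latticeMz_prime.
by exists x => //; apply: in_lattice_unit.
Qed.

End PrimeNorm.

End Tessellation.

(** * Quotients of the rotation group of the tessellation *)

Section TessellationRotations.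
Variable gT : finGroupType.
Local Open Scope group_scope.
Implicit Types (s g : gT) (v w : point) (k l : nat).

(** In the rotation group of the tessellation, [s1] and [s2] are the rotations by
    one step about the triangle and the vertex of a base flag; then [tess_tr s1 s2 v]
    is the translation by [v], and [tess_rot s1 s2 v k] takes the flag of [(0, 0)]
    to the flag of [(v, k)]. *)
Definition tess_unit (s1 s2 : gT) : gT := s2 ^+ 3 * s1 * s2.

Definition tess_tr (s1 s2 : gT) v : gT :=
  expgz (tess_unit s1 s2) v.1 * expgz (tess_unit s1 s2 ^ s2^-1) v.2.

Definition tess_rot (s1 s2 : gT) v k : gT := s2 ^- k * tess_tr s1 s2 v.

Definition face_rotation (s1 s2 : gT) (i : nat) : gT :=
  match i with 1 => s2 | 2 => s1 * s2 | _ => s1 end.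

Definition tess_rotations (s1 s2 : gT) : Prop :=
  [/\ s1 ^+ 3 = 1, s2 ^+ 6 = 1 & (s1 * s2) ^+ 2 = 1].

Section Relations.
Variables s1 s2 : gT.
Hypothesis s12P : tess_rotations s1 s2.
Local Notation x := (tess_unit s1 s2).
Local Notation tr := (tess_tr s1 s2).
Local Notation rot := (tess_rot s1 s2).

Lemma tess_rot_inv1 : s1^-1 = s2 * s1 * s2.
Proof.
by have [_ _ s12] := s12P; apply/eqP; rewrite eq_invg_mul -s12 expg2 !mulgA.
Qed.

Lemma tess_rot_inv2 : s2^-1 = s1 * s2 * s1.
Proof.
have [_ _ s12] := s12P.
by apply/eqP; rewrite eq_invg_mul -(expgM_swap s12) expg2 !mulgA.
Qed.

Lemma tess_rot_sqr1 : s1 * s1 = s1^-1.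
Proof.
by have [s1_3 _ _] := s12P; apply/esym/eqP; rewrite eq_invg_mul -expg2 -expgS s1_3.
Qed.

Lemma tess_rot_exp5 : s2 ^+ 5 = s2^-1.
Proof.
by have [_ s2_6 _] := s12P; apply/esym/eqP; rewrite eq_invg_mul -expgS s2_6.
Qed.

Lemma tess_unit_conj : x ^ s2^-1 = s2 ^+ 4 * s1.
Proof. by rewrite conjgE invgK /tess_unit mulgK mulgA -expgS. Qed.

Lemma tess_unit_commute : commute x (x ^ s2^-1).
Proof.
rewrite /commute tess_unit_conj /tess_unit.
transitivity (s2 ^+ 3 * (s1^-1 * s2 * s1^-1)).
  rewrite -mulgA (mulgA s2) -expgS tess_rot_exp5 -mulgA tess_rot_inv2.
  by rewrite -tess_rot_sqr1 !mulgA.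
by rewrite !tess_rot_inv1 !expgS expg0 mulg1 !mulgA.
Qed.

Lemma tess_unit_conj2 : x ^ (s2^-1 ^+ 2) = x^-1 * x ^ s2^-1.
Proof.
apply: (mulgI x); rewrite mulKVg expg2 conjgM tess_unit_conj conjgE invgK.
rewrite -(mulgA (s2 ^+ 4)) (mulgA s2) -expgS tess_rot_exp5.
rewrite /tess_unit mulgA mulgK -mulgA (mulgA s1) tess_rot_sqr1.
by rewrite tess_rot_inv1 mulgK mulgA -expgSr.
Qed.

Lemma tess_tr0 : tr 0%R = 1. Proof. by rewrite /tess_tr /= !expg0 mulg1. Qed.

Lemma tess_tr_unit : tr (1, 0)%R = x. Proof. by rewrite /tess_tr /= expg0 mulg1. Qed.

Lemma tess_trD v w : tr (v + w)%R = tr v * tr w.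
Proof.
rewrite /tess_tr /= !expgzD -!mulgA; congr (_ * _); rewrite !mulgA; congr (_ * _).
exact/commuteXz2/tess_unit_commute.
Qed.

Lemma tess_trN v : tr (- v)%R = (tr v)^-1.
Proof. by apply: (mulgI (tr v)); rewrite -tess_trD subrr tess_tr0 mulgV. Qed.

Lemma tess_trJ v : (tr v) ^ s2^-1 = tr (rot60 v).
Proof.
have cxy := tess_unit_commute.
rewrite /tess_tr conjMg !conjXgz -conjgM -expg2 tess_unit_conj2 /=.
rewrite (@expgzMg _ x^-1); last exact/commute_sym/commuteV/commute_sym.
rewrite expVgz -expgzN expgzD !mulgA; congr (_ * _).
exact: commuteXz2.
Qed.

Lemma tess_tr_rotX v k : tr v * s2 ^- k = s2 ^- k * tr (iter k rot60 v).
Proof.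
rewrite -expVgn; elim: k v => [|k IH] v; first by rewrite expg0 mulg1 mul1g.
by rewrite expgS mulgA [tr v * _]conjgC tess_trJ -mulgA IH -iterSr mulgA.
Qed.

Lemma tess_rotM v k w l : rot v k * rot w l = rot (iter l rot60 v + w)%R (k + l).
Proof.
rewrite /tess_rot mulgA -(mulgA (s2 ^- k)) tess_tr_rotX tess_trD !mulgA.
by rewrite -invMg -expgD addnC.
Qed.

Lemma tess_rot_eqmod6 v k l : k = l %[mod 6] -> rot v k = rot v l.
Proof.
have [_ s2_6 _] := s12P; rewrite /tess_rot => eq_kl.
by rewrite -(expg_mod k s2_6) eq_kl expg_mod.
Qed.

Lemma tess_rot0 v : rot v 0 = tr v.
Proof. by rewrite /tess_rot expg0 invg1 mul1g. Qed.

Lemma tess_rot_s2 : s2 = rot 0%R 5.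
Proof.
have [_ s2_6 _] := s12P; rewrite /tess_rot tess_tr0 mulg1.
by apply/eqP; rewrite eq_sym eq_invg_mul -expgSr s2_6.
Qed.

Lemma tess_rot_s1 : s1 = rot (unit_vec 1) 4.
Proof.
have [_ s2_6 _] := s12P; rewrite /tess_rot -[unit_vec 1]/(rot60 (1, 0)%R) -tess_trJ.
by rewrite tess_tr_unit tess_unit_conj mulKg.
Qed.

Lemma tess_rot_mem v k : rot v k \in <<[set s1; s2]>>.
Proof.
have [s1G s2G] : s1 \in <<[set s1; s2]>> /\ s2 \in <<[set s1; s2]>>.
  by split; apply: mem_gen; rewrite !inE eqxx ?orbT.
have xG : x \in <<[set s1; s2]>> by rewrite !groupM ?groupX.
by rewrite groupM ?groupV ?groupX // groupM ?groupXz // groupJ ?groupV.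
Qed.

Lemma tess_rot_s1M v k : s1 * rot v k = rot (v + unit_vec k.+1)%R (k + 4).
Proof.
transitivity (rot (unit_vec 1) 4 * rot v k); first by rewrite -tess_rot_s1.
by rewrite tess_rotM iter_rot60_unit_vec addn1 addrC addnC.
Qed.

Lemma tess_rot_s2M v k : s2 * rot v k = rot v (k + 5).
Proof.
transitivity (rot 0%R 5 * rot v k); first by rewrite -tess_rot_s2.
by rewrite tess_rotM iter_rot60_0 add0r addnC.
Qed.

Lemma tess_rot_s12M v k : s1 * s2 * rot v k = rot (v + unit_vec k)%R (k + 3).
Proof.
rewrite -mulgA tess_rot_s2M tess_rot_s1M; transitivity (rot (v + unit_vec k)%R (k + 5 + 4)).
  by congr (rot (_ + _)%R _); apply: unit_vec_eqmod6; lia.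
by apply: tess_rot_eqmod6; lia.
Qed.

Lemma face_rotationX i n x : let y := iter n (next_flag i) x in
  face_rotation s1 s2 i ^+ n * rot x.1 x.2 = rot y.1 y.2.
Proof.
elim: n => [|n IH] /=; first by rewrite mul1g.
rewrite expgS -mulgA IH; case: (iter n _ x) => v k.
case: i {IH} => [|[|[|i]]] /=.
- exact: tess_rot_s1M.
- exact: tess_rot_s2M.
- exact: tess_rot_s12M.
- exact: tess_rot_s1M.
Qed.

Lemma tess_rotP g : g \in <<[set s1; s2]>> -> exists v k, g = rot v k.
Proof.
move: g; apply: gen_ind => [|g s12g h [v [k ->]]].
  by exists 0%R, 0; rewrite tess_rot0 tess_tr0.
case/set2P: s12g => ->; last by exists v, (k + 5); rewrite tess_rot_s2M.
by exists (v + unit_vec k.+1)%R, (k + 4); rewrite tess_rot_s1M.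
Qed.

Lemma tess_rot_eq v k w l : rot v k = rot w l -> rot (v - w)%R (5 * l + k) = 1.
Proof.
have split_rot z m : rot (z - w)%R (5 * l + m) = rot 0%R (5 * l) * (rot z m * rot (- w)%R 0).
  by rewrite !tess_rotM iter_rot60_0 add0r addn0.
rewrite split_rot => ->; rewrite -split_rot subrr (@tess_rot_eqmod6 _ _ 0); last by lia.
by rewrite tess_rot0 tess_tr0.
Qed.

Lemma tess_trMz v (n : int) : tr (v *~ n)%R = expgz (tr v) n.
Proof.
elim/int_rect: n => [|n IH|n IH]; first by rewrite mulr0z tess_tr0.
  by rewrite -addn1 PoszD mulrzDr mulr1z tess_trD expgzS IH.
by rewrite -addn1 PoszD opprD mulrzDr mulrN1z tess_trD tess_trN expgz_pred IH.
Qed.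

End Relations.

Lemma tess_tr_reflection s1 s2 v : tess_rotations s1 s2 ->
  tess_tr s1^-1 (s1 * s1 * s2) v = tess_tr s1 s2 (reflection v).
Proof.
move=> s12P; have rotM := tess_rotM s12P; have eqmod6 := tess_rot_eqmod6 s12P.
have unit_reflection a b : a = tess_rot s1 s2 (unit_vec 1) 4 -> b = tess_rot s1 s2 0%R 5 ->
    (a * a * b) ^+ 3 * (a * a) * (a * a * b) = tess_tr s1 s2 (-1, 0)%R.
  by move=> -> ->; rewrite -tess_rot0 !expgS expg0 mulg1 !rotM; apply: eqmod6.
have unit_conj_reflection a b :
    a = tess_rot s1 s2 (unit_vec 1) 4 -> b = tess_rot s1 s2 0%R 5 ->
    (a * a * b) ^+ 4 * (a * a) = tess_tr s1 s2 (-1, 1)%R.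
  by move=> -> ->; rewrite -tess_rot0 !expgS expg0 mulg1 !rotM; apply: eqmod6.
rewrite {1}/tess_tr tess_unit_conj /tess_unit -(tess_rot_sqr1 s12P).
rewrite (unit_reflection _ _ (tess_rot_s1 s12P) (tess_rot_s2 s12P)).
rewrite (unit_conj_reflection _ _ (tess_rot_s1 s12P) (tess_rot_s2 s12P)).
rewrite -!tess_trMz // -tess_trD // !pointMz pointD /reflection.
by congr (tess_tr _ _ (_, _)); ring.
Qed.

End TessellationRotations.

Lemma morph_tess_tr (aT bT : finGroupType) (D : {group aT}) (f : {morphism D >-> bT}) s1 s2 v :
  s1 \in D -> s2 \in D -> f (tess_tr s1 s2 v) = tess_tr (f s1) (f s2) v.
Proof.
move=> s1D s2D; have xD : tess_unit s1 s2 \in D by rewrite !groupM ?groupX.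
have fx : f (tess_unit s1 s2) = tess_unit (f s1) (f s2).
  by rewrite !morphM ?groupM ?groupX // morphX.
rewrite /tess_tr morphM ?groupXz ?groupJ ?groupV // !morphXz ?groupJ ?groupV //.
by rewrite morphJ ?groupV // morphV // fx.
Qed.

Lemma morph_tess_rot (aT bT : finGroupType) (D : {group aT}) (f : {morphism D >-> bT}) s1 s2 v k :
  s1 \in D -> s2 \in D -> f (tess_rot s1 s2 v k) = tess_rot (f s1) (f s2) v k.
Proof.
move=> s1D s2D; have xD : tess_unit s1 s2 \in D by rewrite !groupM ?groupX.
rewrite /tess_rot -morph_tess_tr // morphM ?groupV ?groupX ?morphV ?morphX ?groupX //.
by rewrite groupM ?groupXz ?groupJ ?groupV.
Qed.

(** The relations satisfied by the distinguished rotations of a self-dual polytope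
    with triangulated toroidal facets; [d] is induced by a duality fixing the base
    flag, and the last condition says that a translation of the base facet fixing
    the base vertex is trivial. *)
Record self_dual_rotations (gT : finGroupType) (s1 s2 s3 d : gT) : Prop :=
  SelfDualRotations {
    sdr_tess : tess_rotations s1 s2;
    sdr_sqr : ((s1 * s2 * s3) ^+ 2 = 1)%g;
    sdr_dual1 : (s1 ^ d = s3^-1)%g;
    sdr_dual2 : (s2 ^ d = s2^-1)%g;
    sdr_dual3 : (s3 ^ d = s1^-1)%g;
    sdr_vertex : forall v,
      tess_tr s1 s2 v \in <<[set s2; s3]>>%g -> tess_tr s1 s2 v = 1%g
  }.

Record nondegenerate_rotations (gT : finGroupType) (s1 s2 : gT) : Prop :=
  NondegenerateRotations {
    ndr_rot : forall v k, tess_rot s1 s2 v k = 1%g -> (6 %| k)%N;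
    ndr_unit : tess_unit s1 s2 <> 1%g
  }.

(** * Rotations of a regular polytope with toroidal facets *)

Section ToroidalFacet.
Variables (Q : polytope 4) (u : point) (F : Q) (cov : tess_face -> {x : Q | (x <= F)%O}).
Hypotheses (rank_F : rank F = 3%:Z)
  (covP : torus_cover u (fun x y => (sval x <= sval y)%O) cov).
Local Notation h f := (sval (cov f)).
Implicit Types (f g : tess_face) (e : bool) (v w t : point) (k l : nat) (x y z : Q).

Let rank_bounds := polytope_rank_bounds (polytopeP Q).
Let rank_lt := polytope_rank_mono (polytopeP Q).

Lemma facet_face_eq f g : h f = h g <-> translation_orbit u f g.
Proof.
rewrite -(cover_fiber covP); split=> [fg|->] //.
by case: (cov f) (cov g) fg => x xF [y yF] /= xy; apply: eq_exist.
Qed.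

Lemma facet_face_surj x : (x <= F)%O -> exists f, h f = x.
Proof. by move=> xF; have [f fx] := cover_surj covP (exist _ x xF); exists f; rewrite fx. Qed.

Lemma facet_face_le f g : tri_le f g -> (h f <= h g)%O.
Proof. by move=> fg; apply/(cover_le covP); exists g; [apply: translation_orbit_refl|]. Qed.

Lemma tess_rank_translation_orbit f g : translation_orbit u f g -> tess_rank f = tess_rank g.
Proof. by case=> t _ ->; case: f. Qed.

Lemma facet_plane : h TPlane = F.
Proof.
have [f fF] := facet_face_surj (lexx F); apply/le_anti/andP; split; first exact: svalP (cov _).
by rewrite -{1}fF; apply: facet_face_le; case: f {fF}.
Qed.

Lemma facet_face_lt f g : tri_le f g -> (tess_rank f < tess_rank g)%N -> (h f < h g)%O.
Proof.
move=> fg rfg; rewrite lt_neqAle facet_face_le // andbT.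
by apply: contraTneq rfg => /facet_face_eq/tess_rank_translation_orbit->; rewrite ltnn.
Qed.

Lemma facet_face_rank f : rank (h f) = (tess_rank f)%:Z - 1.
Proof.
have [i [v [k [le_i4 ->]]]] := tfaceP f; rewrite tess_rank_tface //.
have lt_S j : (j < 4)%N -> rank (h (tface j v k)) < rank (h (tface j.+1 v k)).
  move=> lt_j4; apply/rank_lt/facet_face_lt; rewrite ?tess_rank_tface //; try exact: ltnW.
  by apply: tface_le; rewrite leqnSn.
have := lt_S 0%N isT; have := lt_S 1%N isT; have := lt_S 2%N isT; have := lt_S 3%N isT.
have := rank_bounds (h (tface 0 v k)); rewrite [h (tface 4 v k)]facet_plane rank_F.
case: i le_i4 => [|[|[|[|[|]]]]] // _; rewrite ?[h (tface 4 v k)]facet_plane ?rank_F;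
  by clear; lia.
Qed.

(** The flag of the tessellation at the vertex [v] and the edge [tedge v k] whose
    triangle is [ttri v k] or, if [e] holds, its mirror image. *)
Definition tflag e v k (i : nat) : tess_face :=
  if i == 3 then ttri v (k + 5 * e) else tface i v k.

Lemma tess_rank_tflag e v k i : (i <= 4)%N -> tess_rank (tflag e v k i) = i.
Proof. by rewrite /tflag; case: eqP => [->|_] //; apply: tess_rank_tface. Qed.

Lemma tflag_tface v k i : tflag false v k i = tface i v k.
Proof. by rewrite /tflag muln0 addn0; case: eqP => [->|]. Qed.

Lemma tflag_le e v k i j : (i <= j <= 4)%N -> tri_le (tflag e v k i) (tflag e v k j).
Proof.
case: e; last by rewrite !tflag_tface; apply: tface_le.
rewrite /tflag muln1; case: eqP => [->|i3]; case: eqP => [->|j3] le_ij.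
- exact: tri_le_refl.
- by rewrite (_ : j = 4%N); [apply: (@tface_le 3 4)|move: le_ij j3; clear; lia].
- have [->|i2] := eqVneq i 2%N; last first.
    have -> : tface i v k = tface i v (k + 5) by case: i i3 i2 {le_ij} => [|[|[|[|]]]].
    exact: (@tface_le _ 3).
  have -> : tface 2 v k = tedge v (k + 5).+1 by apply: tedge_eqmod6; clear; lia.
  apply: tri_le_corners => // x; rewrite (@corners_tface 2) // (@corners_tface 3) //.
  by rewrite !inE => /orP[]->; rewrite ?orbT.
- exact: tface_le.
Qed.

Definition facet_flag e v k : {set Q} :=
  greatest_face Q |: [set h (tflag e v k i) | i : 'I_5].

Lemma mem_facet_flag e v k i : (i <= 4)%N -> h (tflag e v k i) \in facet_flag e v k.
Proof. by move=> i4; apply/setU1P; right; apply/imsetP; exists (Ordinal (i4 : (i < 5)%N)). Qed.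

Lemma facet_flag_flag e v k : flag (facet_flag e v k).
Proof.
apply: chain_flag.
  apply: chain_setU1 => [|x _]; last by rewrite comparable_sym /Order.comparable le_greatest_face.
  apply/chainP=> _ _ /imsetP[i _ ->] /imsetP[j _ ->].
  case/orP: (leq_total i j) => ij; apply/orP; [left|right];
    by apply/facet_face_le/tflag_le; rewrite ij -ltnS ltn_ord.
have le_i4 (i : 'I_5) : (i <= 4)%N by rewrite -ltnS.
rewrite cardsU1 card_in_imset ?card_ord; last first.
  move=> i j _ _ /facet_face_eq/tess_rank_translation_orbit.
  by rewrite !tess_rank_tflag // => /val_inj.
case: imsetP => // -[i _ /(congr1 (@rank 4 Q))].
rewrite rank_greatest_face facet_face_rank tess_rank_tflag //.
by have := le_i4 i; clear; lia.
Qed.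

Lemma facet_flag_adjacent e e' v v' k k' i : (i < 3)%N ->
    h (tflag e v k i.+1) != h (tflag e' v' k' i.+1) ->
    (forall j, (j <= 3)%N -> j != i.+1 -> tflag e v k j = tflag e' v' k' j) ->
  i_adjacent i (facet_flag e v k) (facet_flag e' v' k').
Proof.
move=> lt_i3 neq_i eq_j; apply/i_adjacentP; try exact: facet_flag_flag.
have le_j4 (j : 'I_5) : (j <= 4)%N by rewrite -ltnS.
have rank_tflag e1 v1 k1 j : (j <= 4)%N -> rank (h (tflag e1 v1 k1 j)) = j%:Z - 1.
  by move=> le_j; rewrite facet_face_rank tess_rank_tflag.
split=> [|_ /setU1P[->|/imsetP[j _ ->] rj]]; last first.
- apply/setU1P; right; apply/imsetP; exists j => //; congr (h _).
  have [->//|neq_j4] := eqVneq (j : nat) 4%N; rewrite rank_tflag // in rj.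
  by apply: eq_j; move: rj neq_j4 (le_j4 j); clear; lia.
- by rewrite setU11.
have le_i4 : (i.+1 <= 4)%N := leqW lt_i3.
apply: contra neq_i => /eqP eq_flags; apply/eqP.
apply: (flag_rank_inj (facet_flag_flag e v k)); rewrite ?rank_tflag //.
  exact: mem_facet_flag.
by rewrite eq_flags mem_facet_flag.
Qed.

Lemma facet_flag_adjacent2 v k : i_adjacent 2 (facet_flag false v k) (facet_flag true v k).
Proof.
apply: facet_flag_adjacent => // [|j _ /negPf j3]; last by rewrite /tflag j3.
apply/eqP=> /facet_face_eq[t _ /ttri_translate_direction].
by clear; lia.
Qed.

Lemma facet_flag_adjacent1 v k : i_adjacent 1 (facet_flag false v k) (facet_flag true v k.+1).
Proof.
apply: facet_flag_adjacent => // [|j].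
  apply/eqP=> /facet_face_eq[t _ /tedge_translate_direction].
  by clear; lia.
case: j => [|[|[|[|]]]] //= _ _; rewrite /tflag /=.
by apply: ttri_eqmod6; clear; lia.
Qed.

Lemma facet_flag_mod6 e v k l : k = l %[mod 6] -> facet_flag e v k = facet_flag e v l.
Proof.
move=> eq_kl; rewrite /facet_flag; congr (_ |: _); apply: eq_imset => i; congr (h _).
rewrite /tflag (tface_eqmod6 _ _ eq_kl); case: eqP => // _.
by apply: ttri_eqmod6; move: eq_kl; clear; lia.
Qed.

Lemma facet_edge_vertex v k x : (x < h (tedge v k))%O -> rank x = 0 ->
  x = h (TVertex v) \/ x = h (TVertex (v + unit_vec k)).
Proof.
move=> x_lt rx; have xF : (x <= F)%O.
  by apply: le_trans (ltW x_lt) _; apply: svalP (cov _).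
have [f fx] := facet_face_surj xF; rewrite -fx in x_lt rx *.
have /(cover_le covP)[_ [t ut ->] f_le] := ltW x_lt.
have [i [j [w [l [/andP[le_ij le_j4] fE tE]]]]] := tri_leP f_le.
have i1 : i = 1%N.
  by move: rx; rewrite facet_face_rank fE tess_rank_tface ?(leq_trans le_ij) //; clear; lia.
have w_t : w - t \in corners (tedge v k).
  rewrite -(mem_map (addIr t)) -corners_translate subrK tE.
  have /= j2 := congr1 tess_rank tE; rewrite tess_rank_tface // in j2.
  by rewrite -j2 vertex_in_corners_tface.
have -> : h f = h (TVertex (w - t)).
  by rewrite fE i1; apply/facet_face_eq; exists (- t) => //; apply: in_latticeN.
move: w_t; rewrite (@corners_tface 2) // !inE => /orP[] /eqP->; by [left|right].
Qed.

(* The diamond condition in the edge. *)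
Lemma facet_edge_vertices_neq v k : h (TVertex v) != h (TVertex (v + unit_vec k)).
Proof.
have v_lt : (h TEmpty < h (TVertex v) < h (tedge v k))%O.
  rewrite (@facet_face_lt (tface 0 v k) (tface 1 v k)) //.
  by rewrite (@facet_face_lt (tface 1 v k) (tface 2 v k)) //; apply: (@tface_le 1 2).
have [|x neq_x /andP[x_gt x_lt]] := diamond_exists _ v_lt; first by rewrite !facet_face_rank.
have rx : rank x = 0.
  have := rank_lt x_gt; have := rank_lt x_lt; rewrite !facet_face_rank /=.
  by clear; lia.
have [xv|<-//] := facet_edge_vertex x_lt rx.
by rewrite xv eqxx in neq_x.
Qed.

Lemma facet_flag_adjacent0 v k :
  i_adjacent 0 (facet_flag true v k) (facet_flag false (v + unit_vec k) (k + 3)).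
Proof.
apply: facet_flag_adjacent => // [|j]; first exact: facet_edge_vertices_neq.
case: j => [|[|[|[|]]]] //= _ _; rewrite /tflag /= ?tedgeD3 //.
rewrite -(ttriD4 v (k + 5 * true)) (@unit_vec_eqmod6 (k + 5 * true).+1 k); last by clear; lia.
by apply: ttri_eqmod6; clear; lia.
Qed.

Lemma facet_flag_translate v t k : in_lattice u t ->
  facet_flag false (v + t) k = facet_flag false v k.
Proof.
move=> ut; rewrite /facet_flag; congr (_ |: _); apply: eq_imset => i.
by apply/esym/facet_face_eq; exists t; rewrite ?tflag_tface ?tface_translate.
Qed.

Lemma facet_flag_vertex_eq v w k l x : x \in facet_flag false v k ->
  x \in facet_flag false w l -> rank x = 0 -> in_lattice u (v - w).
Proof.
have vertexE v1 k1 : x \in facet_flag false v1 k1 -> rank x = 0 -> x = h (TVertex v1).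
  move=> xf rx; apply: (flag_rank_inj (facet_flag_flag false v1 k1)) => //.
    by apply: (@mem_facet_flag false v1 k1 1).
  by rewrite facet_face_rank rx.
move=> xv xw rx; have := vertexE _ _ xw rx; rewrite (vertexE _ _ xv rx).
by case/esym/facet_face_eq=> t ut [->]; rewrite addrC addKr.
Qed.

End ToroidalFacet.

Section ToroidalRotations.
Variables (Q : polytope 4) (Phi : {set Q}) (u : point).
Hypotheses (Phi_flag : flag Phi) (Q_regular : regular Q).
Variables (F : Q) (cov : tess_face -> {x : Q | (x <= F)%O}).
Hypotheses (rank_F : rank F = 3%:Z)
  (covP : torus_cover u (fun x y => (sval x <= sval y)%O) cov).
Local Notation fflag := (facet_flag cov).
Local Notation s := (sigma Phi).
Local Open Scope group_scope.
Implicit Types (g h : {perm Q}) (v w : point) (k l : nat).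

(** [g] moves the flags of the facet like the rotation of the tessellation taking
    the flag of [(0, 0)] to the flag of [(v, k)]. *)
Definition rotates g v k : Prop := g \in Gamma Q /\
  forall g0 v0 k0, g0 \in Gamma Q -> g0 @: Phi = fflag false v0 k0 ->
    (g * g0) @: Phi = fflag false (v0 + iter k0 rot60 v)%R (k0 + k).

Lemma rotates1 : rotates 1 0%R 0.
Proof. by split=> // g0 v0 k0 _ g0E; rewrite mul1g g0E iter_rot60_0 addr0 addn0. Qed.

Lemma rotatesM g v k h w l : rotates g v k -> rotates h w l ->
  rotates (g * h) (w + iter l rot60 v)%R (k + l).
Proof.
move=> [gG gP] [hG hP]; split=> [|g0 v0 k0 g0G g0E]; first exact: groupM.
rewrite -mulgA (gP _ _ _ _ (hP _ _ _ g0G g0E)) ?groupM //.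
by rewrite iter_rot60D addrA -iterD addnA addnAC.
Qed.

Lemma rotates_eqmod6 g v k l : k = l %[mod 6] -> rotates g v k -> rotates g v l.
Proof.
move=> eq_kl [gG gP]; split=> // g0 v0 k0 g0G g0E; rewrite (gP _ _ _ g0G g0E).
by apply: facet_flag_mod6; rewrite -modnDmr eq_kl modnDmr.
Qed.

Lemma rotates_base : exists2 g0, g0 \in Gamma Q & g0 @: Phi = fflag false 0%R 0.
Proof. exact/(regular_transitive Q_regular Phi_flag)/(facet_flag_flag rank_F covP). Qed.

Lemma rotates_uniq g h v w k l : rotates g v k -> rotates h w l ->
  in_lattice u (v - w)%R -> k = l %[mod 6] -> g = h.
Proof.
move=> [gG gP] [hG hP] uvw eq_kl; have [g0 g0G g0E] := rotates_base.
apply: (mulIg g0); apply: (Gamma_flag_inj (A := Phi)); rewrite ?groupM //.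
rewrite (gP _ _ _ g0G g0E) (hP _ _ _ g0G g0E) !add0r !add0n.
by rewrite -[v](subrK w) addrC (facet_flag_translate covP) //; apply: facet_flag_mod6.
Qed.

Lemma rotates_eq g h v w k l : rotates g v k -> rotates h w l -> v = w ->
  k = l %[mod 6] -> g = h.
Proof.
move=> gP hP eq_vw; apply: rotates_uniq gP hP _.
by rewrite eq_vw subrr; apply: in_lattice0.
Qed.

Lemma rotatesV g v : rotates g v 0 -> rotates g^-1 (- v)%R 0.
Proof.
move=> [gG gP]; split=> [|g0 v0 k0 g0G g0E]; first by rewrite groupV.
have [g1 g1G g1E] := regular_transitive Q_regular Phi_flag
  (facet_flag_flag rank_F covP false (v0 - iter k0 rot60 v)%R k0).
have := gP _ _ _ g1G g1E; rewrite addn0 subrK -g0E => g1Phi.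
have <- : g * g1 = g0 by apply: Gamma_flag_inj Phi_flag g1Phi; rewrite ?groupM.
by rewrite mulKg g1E iter_rot60N ?addn0.
Qed.

Lemma rotatesXz g v (a : int) : rotates g v 0 -> rotates (expgz g a) (v *~ a)%R 0.
Proof.
have rotatesX h w n : rotates h w 0 -> rotates (h ^+ n) (w *+ n)%R 0.
  move=> hP; elim: n => [|n IH]; first by rewrite expg0 mulr0n; apply: rotates1.
  by rewrite expgSr mulrS; apply: (rotatesM IH hP).
move=> gP; case: a => n /=; first by rewrite -pmulrn; apply: rotatesX.
by rewrite -expVgn NegzE mulrNz -mulNrz -pmulrn; apply/rotatesX/rotatesV.
Qed.

Lemma rotates_sigma1 : rotates (s 1) (unit_vec 1) 4.
Proof.
split=> [|g0 v0 k0 g0G g0E]; first exact: sigma_Gamma.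
rewrite iter_rot60_unit_vec addn1 -addSnnS.
apply: (@sigma_flag _ _ _ Phi_flag Q_regular 1 _ (fflag true v0 k0.+1)) => //.
  by rewrite g0E; apply: facet_flag_adjacent1 rank_F covP _ _.
exact: facet_flag_adjacent0 rank_F covP _ _.
Qed.

Lemma rotates_sigma2 : rotates (s 2) 0%R 5.
Proof.
split=> [|g0 v0 k0 g0G g0E]; first exact: sigma_Gamma.
rewrite iter_rot60_0 addr0.
apply: (@sigma_flag _ _ _ Phi_flag Q_regular 2 _ (fflag true v0 k0)) => //.
  by rewrite g0E; apply: facet_flag_adjacent2 rank_F covP _ _.
rewrite (@facet_flag_mod6 _ _ _ _ _ k0 (k0 + 5).+1); last by lia.
exact/i_adjacent_sym/(facet_flag_adjacent1 rank_F covP).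
Qed.

Lemma rotates_sigma2X n : rotates (s 2 ^+ n) 0%R (n * 5).
Proof.
elim: n => [|n IH]; first exact: rotates1.
rewrite expgSr mulSnr -[0%R](addr0 0%R) -[X in (_ + X)%R](iter_rot60_0 5).
exact: rotatesM IH rotates_sigma2.
Qed.

Lemma sigma_tess_rotations : tess_rotations (s 1) (s 2).
Proof.
split.
- exact: rotates_eq (rotatesM rotates_sigma1 (rotatesM rotates_sigma1 rotates_sigma1)) rotates1 _ _.
- exact: rotates_eq (rotates_sigma2X 6) rotates1 _ _.
have s12P := rotatesM rotates_sigma1 rotates_sigma2.
exact: rotates_eq (rotatesM s12P s12P) rotates1 _ _.
Qed.

Lemma rotates_tess_tr v : rotates (tess_tr (s 1) (s 2) v) v 0.
Proof.
have unitP : rotates (tess_unit (s 1) (s 2)) (1, 0)%R 0.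
  have := rotatesM (rotatesM (rotates_sigma2X 3) rotates_sigma1) rotates_sigma2.
  exact: rotates_eqmod6.
have unitJP : rotates (tess_unit (s 1) (s 2) ^ (s 2)^-1) (0, 1)%R 0.
  rewrite tess_unit_conj.
  exact: rotates_eqmod6 (rotatesM (rotates_sigma2X 4) rotates_sigma1).
have := rotatesM (rotatesXz v.1 unitP) (rotatesXz v.2 unitJP).
case: v => a b; rewrite /= !pointMz pointD !mul1r !mul0r addr0 add0r.
exact.
Qed.

Lemma tess_tr_sigma_eq1 v : tess_tr (s 1) (s 2) v = 1 <-> in_lattice u v.
Proof.
split=> [tr1|uv]; last first.
  by apply: rotates_uniq (rotates_tess_tr v) rotates1 _ _; rewrite ?subr0.
have [g0 g0G g0E] := rotates_base; have [_ /(_ _ _ _ g0G g0E)] := rotates_tess_tr v.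
rewrite tr1 mul1g g0E add0r => eq_flags.
have [|x xf rx] := flag_face_of_rank (i := 0%R) (facet_flag_flag rank_F covP false 0%R 0) => //.
have xv := xf; rewrite eq_flags in xv; rewrite -[v]subr0.
exact: (facet_flag_vertex_eq rank_F covP xv xf rx).
Qed.

Lemma tess_tr_vertex_stab v : tess_tr (s 1) (s 2) v \in <<[set s 2; s 3]>> ->
  tess_tr (s 1) (s 2) v = 1.
Proof.
set t := tess_tr _ _ v => t_stab; apply/tess_tr_sigma_eq1.
have [|x xPhi rx] := flag_face_of_rank (i := 0%R) Phi_flag => //.
have rho_x i : (0 < i < 4)%N -> rho Phi i x = x.
  by case/andP=> i_gt0 lt_i4; apply: rho_fixes_face => //; rewrite rx; lia.
have /astab1P tx : t \in 'C[x | 'P].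
  move: t_stab; apply/subsetP; rewrite gen_subG; apply/subsetP=> g.
  by case/set2P=> ->; apply/astab1P; rewrite /= /aperm permM !rho_x.
have [g0 g0G g0E] := rotates_base; have [_ /(_ _ _ _ g0G g0E)] := rotates_tess_tr v.
rewrite add0r => tg0E; rewrite -[v]subr0.
apply: (@facet_flag_vertex_eq _ _ _ _ rank_F covP _ _ 0 0 (g0 x)).
- have -> : g0 x = (t * g0) x by rewrite permM -[in LHS]tx.
  by rewrite -tg0E imset_f.
- by rewrite -g0E imset_f.
- by rewrite Gamma_rank.
Qed.

End ToroidalRotations.

Lemma regular_self_dual_rotations (Q : polytope 4) (Phi : {set Q}) (u : point) :
    flag Phi -> regular Q -> self_dual Q -> has_facets Q (@map36 u) ->
  (exists d, self_dual_rotations (sigma Phi 1) (sigma Phi 2) (sigma Phi 3) d) /\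
  forall v, tess_tr (sigma Phi 1) (sigma Phi 2) v = 1%g <-> in_lattice u v.
Proof.
move=> Phi_flag Q_regular Q_self_dual Q_facets.
have [|F _ rank_F] := flag_face_of_rank (i := 3%:Z) Phi_flag => //.
have [cov covP] := torus_cover_of_iso (Q_facets F rank_F).
split; last exact: tess_tr_sigma_eq1 rank_F covP.
have [d dual_d dPhi] := duality_fixing_flag Phi_flag Q_regular Q_self_dual.
have sJ := sigma_conj_duality Phi_flag Q_regular dual_d dPhi.
exists d; split; try exact: sJ.
- exact: sigma_tess_rotations rank_F covP.
- exact: sigma123_sqr.
- exact: tess_tr_vertex_stab rank_F covP.
Qed.

(** * Projective special linear groups *)

Section PSL2.
Variable F : finFieldType.
Implicit Types (a b c d t x y : F) (g : {'GL_2[F]}).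

Definition mx2 a b c d : 'M[F]_2 :=
  \matrix_(i < 2, j < 2) if i == 0 then (if j == 0 then a else b)
                         else (if j == 0 then c else d).

Lemma mulmx2 a b c d a' b' c' d' : mx2 a b c d *m mx2 a' b' c' d' =
  mx2 (a * a' + b * c') (a * b' + b * d') (c * a' + d * c') (c * b' + d * d').
Proof.
apply/matrixP=> i j; rewrite !mxE big_ord_recl big_ord1 !mxE /=.
by case: (i == 0); case: (j == 0).
Qed.

Lemma det_mx2 a b c d : \det (mx2 a b c d) = a * d - b * c.
Proof.
rewrite (expand_det_row _ 0) big_ord_recl big_ord1 /cofactor !det_mx11 !mxE /=.
by ring.
Qed.

Lemma mx2_surj (A : 'M[F]_2) : A = mx2 (A 0 0) (A 0 1) (A 1 0) (A 1 1).
Proof.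
apply/matrixP=> i j; rewrite !mxE.
by case: i => -[|[|//]] ii; case: j => -[|[|//]] jj; congr (A _ _); apply: val_inj.
Qed.

Lemma mx2_inj a b c d a' b' c' d' : mx2 a b c d = mx2 a' b' c' d' ->
  [/\ a = a', b = b', c = c' & d = d'].
Proof.
move/matrixP=> eq_mx; split.
- by have := eq_mx 0 0; rewrite !mxE.
- by have := eq_mx 0 1; rewrite !mxE.
- by have := eq_mx 1 0; rewrite !mxE.
- by have := eq_mx 1 1; rewrite !mxE.
Qed.

Definition gl2 a b c d : {'GL_2[F]} := insubd (1%g : {'GL_2[F]}) (mx2 a b c d).

Lemma gl2E a b c d : a * d - b * c != 0 -> GLval (gl2 a b c d) = mx2 a b c d.
Proof. by move=> nz; apply: insubdK; rewrite -topredE /= unitmxE det_mx2 unitfE. Qed.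

Lemma gl2_surj g : exists a b c d, a * d - b * c != 0 /\ g = gl2 a b c d.
Proof.
exists (GLval g 0 0), (GLval g 0 1), (GLval g 1 0), (GLval g 1 1).
have nz : \det (GLval g) != 0 by apply: GL_det.
rewrite [GLval g]mx2_surj det_mx2 in nz; split=> //.
by apply: val_inj; rewrite -[RHS]/(GLval _) gl2E // -mx2_surj.
Qed.

Lemma gl2M a b c d a' b' c' d' : a * d - b * c != 0 -> a' * d' - b' * c' != 0 ->
  (gl2 a b c d * gl2 a' b' c' d')%g =
  gl2 (a * a' + b * c') (a * b' + b * d') (c * a' + d * c') (c * b' + d * d').
Proof.
move=> nz nz'; apply: val_inj; rewrite -[LHS]/(GLval _) -[RHS]/(GLval _) GL_MxE !gl2E //.
  exact: mulmx2.
by rewrite -det_mx2 -mulmx2 det_mulmx !det_mx2 mulf_neq0.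
Qed.

Lemma gl2_1 : gl2 1 0 0 1 = 1%g.
Proof.
apply: val_inj; rewrite -[LHS]/(GLval _) -[RHS]/(GLval _) gl2E.
  by rewrite -[RHS]/(1 : 'M_2) [RHS]mx2_surj !mxE.
by rewrite mulr1 mulr0 subr0 oner_eq0.
Qed.

Lemma gl2_inj a b c d a' b' c' d' : a * d - b * c != 0 -> a' * d' - b' * c' != 0 ->
  gl2 a b c d = gl2 a' b' c' d' -> [/\ a = a', b = b', c = c' & d = d'].
Proof. by move=> nz nz' /(congr1 (@GLval _ _)); rewrite !gl2E //; apply: mx2_inj. Qed.

Definition SL2F : {set {'GL_2[F]}} := [set g : {'GL_2[F]} | \det (GLval g) == 1].

Lemma SL2F_group_set : group_set SL2F.
Proof.
apply/group_setP; split=> [|g h]; first by rewrite inE /= det1.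
by rewrite !inE GL_MxE det_mulmx => /eqP-> /eqP->; rewrite mulr1.
Qed.

Canonical SL2F_group := Group SL2F_group_set.

(* Determinants equal to 1 are written [a * d = 1 + b * c], which [ring] can use
   as a rewriting rule for the monomial on the left. *)
Lemma det1_neq0 a b c d : a * d = 1 + b * c -> a * d - b * c != 0.
Proof. by move->; rewrite addrK oner_eq0. Qed.

Lemma det1M a b c d a' b' c' d' : a * d = 1 + b * c -> a' * d' = 1 + b' * c' ->
  (a * a' + b * c') * (c * b' + d * d') = 1 + (a * b' + b * d') * (c * a' + d * c').
Proof. by move=> detE detE'; ring: detE detE'. Qed.

Lemma det1_up x : 1 * 1 = 1 + x * 0 :> F. Proof. by ring. Qed.
Lemma det1_low x : 1 * 1 = 1 + 0 * x :> F. Proof. by ring. Qed.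
Lemma det1_opp1 : -1 * -1 = 1 + 0 * 0 :> F. Proof. by ring. Qed.

Lemma gl2_SL2F a b c d : a * d = 1 + b * c -> gl2 a b c d \in SL2F.
Proof. by move=> detE; rewrite inE gl2E ?det1_neq0 // det_mx2 detE addrK. Qed.

Lemma SL2FP g : g \in SL2F -> exists a b c d, a * d = 1 + b * c /\ g = gl2 a b c d.
Proof.
have [a [b [c [d [nz ->]]]]] := gl2_surj g.
by rewrite inE gl2E // det_mx2 subr_eq => /eqP detE; exists a, b, c, d.
Qed.

Lemma card_SL2F : #|SL2F| = (#|F| * (#|F| ^ 2 - 1))%N.
Proof.
pose det_unit g : {unit F} := insubd (1%g : {unit F}) (\det (GLval g)).
have det_unitE g : val (det_unit g) = \det (GLval g).
  have nz : \det (GLval g) != 0 by apply: GL_det.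
  by apply: insubdK; rewrite -topredE /= unitfE.
have det_unitM : {in [set: {'GL_2[F]}] &, {morph det_unit : g h / (g * h)%g}}.
  by move=> g h _ _; apply: val_inj; rewrite /= !det_unitE GL_MxE det_mulmx.
pose f := Morphism det_unitM.
have kerE : ('ker f = SL2F)%g.
  apply/setP=> g; rewrite !inE /= -(inj_eq val_inj) det_unitE.
  by [].
have imE : (f @* setT = setT)%g.
  apply/setP=> u; rewrite inE; apply/morphimP.
  have u_nz : val u * 1 - 0 * 0 != 0 by rewrite mulr1 mulr0 subr0 -unitfE; apply: valP.
  exists (gl2 (val u) 0 0 1); rewrite ?in_setT //; apply: val_inj.
  by rewrite /= det_unitE gl2E // det_mx2 mulr1 mulr0 subr0.
have := card_morphim f setT; rewrite imE setIT kerE card_finField_unit => index_SL.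
have := Lagrange (subsetT ('ker f)%G); rewrite /= kerE -index_SL card_GL_2.
have := finNzRing_gt1 F; case: #|F| => [|[|q]] // _ /= SL_eq.
apply/eqP; rewrite -(eqn_pmul2r (ltn0Sn q)) SL_eq; apply/eqP.
have -> : (q.+2 ^ 2 - 1 = q.+1 * q.+3)%N by lia.
by rewrite -mulnn; ring.
Qed.

Local Notation Z := 'Z(SL2F)%g.

Lemma gl2_scalar a b c d : b = 0 -> c = 0 -> a = d -> a * d = 1 + b * c ->
  gl2 a b c d = 1%g \/ gl2 a b c d = gl2 (-1) 0 0 (-1).
Proof.
move=> -> -> <- detE; have : (a - 1) * (a + 1) == 0 by apply/eqP; ring: detE.
rewrite mulf_eq0 subr_eq0 addr_eq0 => /orP[] /eqP->; last by right.
by left; rewrite gl2_1.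
Qed.

Lemma center_SL2F g : g \in Z -> g = 1%g \/ g = gl2 (-1) 0 0 (-1).
Proof.
case/centerP=> /SL2FP[a [b [c [d [detE ->]]]]] cent_g; have nz := det1_neq0 detE.
have nz_up := det1_neq0 (det1_up 1); have nz_low := det1_neq0 (det1_low 1).
have := cent_g _ (gl2_SL2F (det1_up 1)); have := cent_g _ (gl2_SL2F (det1_low 1)).
rewrite /commute !(gl2M nz) // !(gl2M _ nz) // => comm_low comm_up.
have [a_ab _ ac_cd _] := gl2_inj (det1_neq0 (det1M detE (det1_low 1)))
  (det1_neq0 (det1M (det1_low 1) detE)) comm_low.
have [a_ac _ _ _] := gl2_inj (det1_neq0 (det1M detE (det1_up 1)))
  (det1_neq0 (det1M (det1_up 1) detE)) comm_up.
move: a_ab ac_cd a_ac; rewrite !(mulr1, mulr0, mul1r, mul0r, addr0, add0r).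
move=> a_ab cd_ac a_ac.
have b0 : b = 0 by apply: (addrI a); rewrite addr0.
have c0 : c = 0 by apply: (addrI a); rewrite addr0.
by apply: gl2_scalar; rewrite // -[d]add0r -{1}c0 cd_ac c0 addr0.
Qed.

Lemma commute_gl2_opp1 g : commute g (gl2 (-1) 0 0 (-1)).
Proof.
have [a [b [c [d [nz ->]]]]] := gl2_surj g.
rewrite /commute (gl2M nz (det1_neq0 det1_opp1)) (gl2M (det1_neq0 det1_opp1) nz).
by congr gl2; ring.
Qed.

Lemma gl2_opp1_center : gl2 (-1) 0 0 (-1) \in Z.
Proof.
apply/centerP; split=> [|g _]; first exact/gl2_SL2F/det1_opp1.
exact/commute_sym/commute_gl2_opp1.
Qed.

Lemma norm_center_SL2F g : g \in 'N(Z)%g.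
Proof.
apply: (subsetP (cent_sub Z)); apply/centP=> z /center_SL2F[->|->].
  exact: commute1.
exact: commute_gl2_opp1.
Qed.

Definition PSL2F : {set coset_of Z} := (SL2F / Z)%g.

Canonical PSL2F_group := Eval hnf in [group of PSL2F].

Lemma card_PSL2F : (#|F| * (#|F| ^ 2 - 1) %| 2 * #|PSL2F|)%N.
Proof.
have nZ : SL2F \subset 'N(Z)%g by apply/subsetP=> g _; apply: norm_center_SL2F.
rewrite -card_SL2F -(Lagrange (center_sub SL2F_group)) /PSL2F (card_quotient nZ).
apply: dvdn_mul => //; have : (#|Z| <= 2)%N.
  apply: (@leq_trans #|[set (1%g : {'GL_2[F]}); gl2 (-1) 0 0 (-1)]|).
    by apply/subset_leq_card/subsetP=> z /center_SL2F[]->; rewrite !inE eqxx ?orbT.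
  by rewrite cards2 ltnS leq_b1.
by have := cardG_gt0 Z; case: #|Z| => [|[|[|]]].
Qed.

Definition psl2 a b c d : coset_of Z := coset Z (gl2 a b c d).
Arguments psl2 (a b c d)%_ring_scope.

Lemma psl2_mem a b c d : a * d = 1 + b * c -> psl2 a b c d \in PSL2F.
Proof. by move=> detE; apply: mem_quotient; apply: gl2_SL2F. Qed.

Lemma PSL2FP (s : coset_of Z) : s \in PSL2F ->
  exists a b c d, a * d = 1 + b * c /\ s = psl2 a b c d.
Proof. by case/morphimP=> g _ /SL2FP[a [b [c [d [detE ->]]]]] ->; exists a, b, c, d. Qed.

Lemma coset_SL2FM g g' : coset Z (g * g')%g = (coset Z g * coset Z g')%g.
Proof. by rewrite morphM ?norm_center_SL2F. Qed.

Lemma psl2M a b c d a' b' c' d' a2 b2 c2 d2 :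
    a * d = 1 + b * c -> a' * d' = 1 + b' * c' ->
    a * a' + b * c' = a2 -> a * b' + b * d' = b2 ->
    c * a' + d * c' = c2 -> c * b' + d * d' = d2 ->
  (psl2 a b c d * psl2 a' b' c' d')%g = psl2 a2 b2 c2 d2.
Proof.
move=> /det1_neq0 detE /det1_neq0 detE' <- <- <- <-.
by rewrite /psl2 -coset_SL2FM (gl2M detE detE').
Qed.

Lemma psl2_1 : psl2 1 0 0 1 = 1%g.
Proof. by rewrite /psl2 gl2_1; apply: coset_id (group1 _). Qed.

Lemma psl2_opp1 : psl2 (-1) 0 0 (-1) = 1%g.
Proof. exact: coset_id gl2_opp1_center. Qed.

Lemma psl2_scalar a b c d : b = 0 -> c = 0 -> a = d -> a * d = 1 + b * c ->
  psl2 a b c d = 1%g.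
Proof.
move=> b0 c0 ad detE; rewrite /psl2; have [->|->] := gl2_scalar b0 c0 ad detE.
  exact: coset_id (group1 _).
exact: psl2_opp1.
Qed.

Lemma psl2_eq a b c d a' b' c' d' : a * d = 1 + b * c -> a' * d' = 1 + b' * c' ->
  psl2 a b c d = psl2 a' b' c' d' ->
  [/\ a = a', b = b', c = c' & d = d'] \/
  [/\ a = - a', b = - b', c = - c' & d = - d'].
Proof.
move=> detE detE' eq_psl; have : gl2 a b c d \in (coset Z (gl2 a' b' c' d') : {set _}).
  by rewrite -[coset _ _]eq_psl /psl2 val_coset ?norm_center_SL2F // rcoset_refl.
rewrite val_coset ?norm_center_SL2F // => /rcosetP[z /center_SL2F[]->].
  by rewrite mul1g => eq_gl; left; apply: gl2_inj eq_gl; apply: det1_neq0.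
rewrite (gl2M (det1_neq0 det1_opp1) (det1_neq0 detE')) => eq_gl; right.
have [-> -> -> ->] := gl2_inj (det1_neq0 detE) (det1_neq0 (det1M det1_opp1 detE')) eq_gl.
by split; ring.
Qed.

Local Opaque psl2.

Lemma psl2V a b c d : a * d = 1 + b * c -> (psl2 a b c d)^-1%g = psl2 d (- b) (- c) a.
Proof.
move=> detE; apply: (mulgI (psl2 a b c d)); rewrite mulgV -psl2_1.
by apply/esym/psl2M; ring: detE.
Qed.

Definition upper x := psl2 1 x 0 1.
Definition lower x := psl2 1 0 x 1.
Arguments upper x%_ring_scope.
Arguments lower x%_ring_scope.

Lemma upperD x y : (upper x * upper y)%g = upper (x + y).
Proof. by apply: psl2M; ring. Qed.

Lemma lowerD x y : (lower x * lower y)%g = lower (x + y).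
Proof. by apply: psl2M; ring. Qed.

Lemma upper0 : upper 0 = 1%g. Proof. exact: psl2_1. Qed.
Lemma lower0 : lower 0 = 1%g. Proof. exact: psl2_1. Qed.

Lemma upperN x : (upper x)^-1%g = upper (- x).
Proof. by apply: (mulgI (upper x)); rewrite mulgV upperD subrr upper0. Qed.

Lemma lowerN x : (lower x)^-1%g = lower (- x).
Proof. by apply: (mulgI (lower x)); rewrite mulgV lowerD subrr lower0. Qed.

Lemma upperX x n : (upper x ^+ n)%g = upper (x *+ n).
Proof. by elim: n => [|n IH]; rewrite ?expg0 ?upper0 // expgS IH upperD mulrS. Qed.

Lemma lowerX x n : (lower x ^+ n)%g = lower (x *+ n).
Proof. by elim: n => [|n IH]; rewrite ?expg0 ?lower0 // expgS IH lowerD mulrS. Qed.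

Lemma upperXz x (k : int) : expgz (upper x) k = upper (x *~ k).
Proof.
case: k => n /=; first by rewrite upperX pmulrn.
by rewrite upperX upperN NegzE mulrNz -pmulrn.
Qed.

Lemma upper_eq1 x : upper x = 1%g -> x = 0.
Proof.
rewrite -upper0 => /(psl2_eq (det1_up x) (det1_up 0)) [[]|[_ + _ _]] //.
by rewrite oppr0.
Qed.

Lemma PSL2F_sub_unipotent (N : {group coset_of Z}) :
  (forall x, upper x \in N) -> (forall x, lower x \in N) -> PSL2F \subset N.
Proof.
move=> upN lowN; apply/subsetP=> s /PSL2FP[a [b [c [d [detE ->]]]]].
have psl2N a' b' c' d' : a' * d' = 1 + b' * c' -> c' != 0 -> psl2 a' b' c' d' \in N.
  move=> detE' nz; have bE : b' = (a' * d' - 1) / c' by rewrite detE' addrC addKr mulfK.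
  have <- : (upper ((a' - 1) / c')%R * lower c' * upper ((d' - 1) / c')%R)%g
    = psl2 a' b' c' d'; last by rewrite !groupM.
  have -> : (upper ((a' - 1) / c')%R * lower c')%g = psl2 a' ((a' - 1) / c')%R c' 1.
    by apply: psl2M; field.
  by apply: psl2M; rewrite ?bE; field.
have [c0|] := eqVneq c 0; last exact: psl2N.
have a0 : a != 0.
  apply: contra_eq_neq detE => ->; rewrite c0 mul0r mulr0 addr0 eq_sym.
  exact: oner_neq0.
have <- : (lower (-1) * (lower 1 * psl2 a b c d))%g = psl2 a b c d.
  by rewrite mulgA lowerD addNr lower0 mul1g.
rewrite groupM // (_ : (_ * _)%g = psl2 a b (a + c) (b + d)); last by apply: psl2M; ring: detE.
by apply: psl2N; [ring: detE|rewrite c0 addr0].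
Qed.

Lemma conj_weyl a b c d : a * d = 1 + b * c ->
  (psl2 a b c d ^ psl2 0 1 (-1) 0)%g = psl2 d (- c) (- b) a.
Proof.
move=> detE; have det_weyl : 0 * 0 = 1 + 1 * -1 :> F by ring.
rewrite conjgE psl2V //.
have -> : (psl2 a b c d * psl2 0 1 (-1) 0)%g = psl2 (- b) a (- d) c by apply: psl2M; ring: detE.
by apply: psl2M; ring: detE.
Qed.

Section NormalSubgroup.
Variable N : {group coset_of Z}.
Hypothesis nN : (N <| PSL2F)%g.

Lemma normalJ s s' : s \in N -> s' \in PSL2F -> (s ^ s')%g \in N.
Proof. by have /andP[_ sN] := nN => Ns sP'; rewrite memJ_norm // (subsetP sN). Qed.

Lemma normal_commutator s s' : s \in N -> s' \in PSL2F -> (s * (s' * s^-1 * s'^-1))%g \in N.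
Proof.
by move=> Ns sP'; rewrite groupM // -mulgA -{1}[s']invgK -conjgE normalJ ?groupV.
Qed.

Lemma normal_lower_entry : N :!=: 1%g ->
  exists a b c d, [/\ a * d = 1 + b * c, c != 0 & psl2 a b c d \in N].
Proof.
case/trivgPn=> s Ns nt_s; have /andP[/subsetP sNP _] := nN.
have [a [b [c [d [detE sE]]]]] := PSL2FP (sNP s Ns); rewrite {}sE in Ns nt_s.
have [c0|c0] := eqVneq c 0; last by exists a, b, c, d.
have [b0|b0] := eqVneq b 0; last first.
  exists d, (- c), (- b), a; rewrite oppr_eq0 b0 -conj_weyl //; split=> //.
    by ring: detE.
  by apply: normalJ => //; apply: psl2_mem; ring.
have neq_ad : d - a != 0.
  rewrite subr_eq0 eq_sym; apply: contra nt_s => /eqP ad.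
  by rewrite psl2_scalar.
exists a, 0, (d - a), d; split=> //; first by rewrite detE b0; ring.
have <- : (psl2 a b c d ^ lower 1)%g = psl2 a 0 (d - a) d.
  rewrite conjgE (psl2V (det1_low 1)) b0 c0; rewrite b0 c0 in detE.
  have -> : (psl2 a 0 0 d * lower 1)%g = psl2 a 0 d d by apply: psl2M; ring: detE.
  by apply: psl2M; ring: detE.
by apply: normalJ => //; apply/psl2_mem/det1_low.
Qed.

Lemma normal_antidiagonal a b c d : a * d = 1 + b * c -> c != 0 ->
  psl2 a b c d \in N -> psl2 0 (- c^-1) c (a + d) \in N.
Proof.
move=> detE nz Ns; have <- : (psl2 a b c d ^ upper (a / c))%g = psl2 0 (- c^-1) c (a + d).
  rewrite conjgE upperN.
  have -> : (psl2 a b c d * upper (a / c))%g = psl2 a (a / c * a + b) c (a + d).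
    by apply: psl2M; [exact: detE|ring|ring|ring|ring|field].
  have bE : b = (a * d - 1) / c by rewrite detE addrC addKr mulfK.
  by apply: psl2M; rewrite ?bE; field.
by apply: normalJ => //; apply/psl2_mem/det1_up.
Qed.

Lemma normal_lower_triangular c e t : c != 0 -> t != 0 ->
  psl2 0 (- c^-1) c e \in N -> exists f, psl2 (t^-1 * t^-1) 0 f (t * t) \in N.
Proof.
move=> c0 t0 Ns; exists (c * e * (1 - t^-1 * t^-1)).
have det_t : t * t^-1 = 1 + 0 * 0 by field.
have := normal_commutator Ns (psl2_mem det_t); rewrite !psl2V //; last by field.
rewrite opprK oppr0.
have -> : (psl2 t 0 0 t^-1 * psl2 e c^-1 (- c) 0)%g =
    psl2 (t * e) (t * c^-1) (- c * t^-1) 0.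
  by apply: psl2M; field; rewrite ?t0 ?c0.
have -> : (psl2 (t * e) (t * c^-1) (- c * t^-1) 0 * psl2 t^-1 0 0 t)%g =
    psl2 e (t * t * c^-1) (- c * (t^-1 * t^-1)) 0.
  by apply: psl2M; field; rewrite ?t0 ?c0.
rewrite (_ : (_ * _)%g = psl2 (t^-1 * t^-1) 0 (c * e * (1 - t^-1 * t^-1)) (t * t)) //.
by apply: psl2M; field; rewrite ?t0 ?c0.
Qed.

Lemma normal_lower f t y : t != 0 -> psl2 (t^-1 * t^-1) 0 f (t * t) \in N ->
  lower (y * (t ^+ 4 - 1)) \in N.
Proof.
move=> t0 Ns; have := normal_commutator Ns (psl2_mem (det1_low y)).
rewrite -[psl2 1 0 y 1]/(lower y) lowerN psl2V ?oppr0; last by field.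
have -> : (lower y * psl2 (t * t) 0 (- f) (t^-1 * t^-1))%g =
    psl2 (t * t) 0 (y * (t * t) - f) (t^-1 * t^-1).
  by apply: psl2M; field.
have -> : (psl2 (t * t) 0 (y * (t * t) - f) (t^-1 * t^-1) * lower (- y))%g =
    psl2 (t * t) 0 (y * (t * t) - f - y * (t^-1 * t^-1)) (t^-1 * t^-1).
  by apply: psl2M; field.
rewrite (_ : (_ * _)%g = lower (y * (t ^+ 4 - 1))) //.
by apply: psl2M; field.
Qed.

End NormalSubgroup.

Lemma simple_PSL2F t : t != 0 -> t ^+ 4 != 1 -> simple PSL2F.
Proof.
move=> t0 t4; apply/simpleP; split=> [|N nN].
  apply/trivgPn; exists (upper 1); first exact/psl2_mem/det1_up.
  by apply: contra_neq (oner_neq0 F) => /upper_eq1.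
have [->|ntN] := eqVneq (N : {set _}) 1%g; [by left|right].
have [a [b [c [d [detE c0 Ns]]]]] := normal_lower_entry nN ntN.
have [f Nf] := normal_lower_triangular nN c0 t0 (normal_antidiagonal nN detE c0 Ns).
have lowN x : lower x \in N.
  by rewrite -(divfK (_ : t ^+ 4 - 1 != 0) x) ?subr_eq0 // (normal_lower nN _ t0 Nf).
apply/eqP; rewrite eqEsubset (normal_sub nN) PSL2F_sub_unipotent // => x.
have det_weyl : 0 * 0 = 1 + 1 * -1 :> F by ring.
have := normalJ nN (lowN (- x)) (psl2_mem det_weyl).
by rewrite (conj_weyl (det1_low (- x))) oppr0 opprK.
Qed.

End PSL2.

Arguments psl2 {F} (a b c d)%_ring_scope.
Arguments upper {F} x%_ring_scope.
Arguments lower {F} x%_ring_scope.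

Section PSL2Rotations.
Variables (F : finFieldType) (w i : F).
Hypotheses (w_sqr : w * w = w - 1) (i_sqr : i * i = -1).
Hypotheses (nz2 : 2%:R != 0 :> F) (nz3 : 3%:R != 0 :> F).
Implicit Types (a b c d x y : F).
Local Opaque psl2.

(* The translations are upper unipotent, and the entries of the diagonal matrix
   [psl_rot2] have ratio [w], so that its inverse acts on them as multiplication by
   the primitive sixth root of unity [w]. *)
Definition psl_rot1 := psl2 (- w) (1 - w) 0 (w - 1).
Definition psl_rot2 := psl2 (i * (w - 1)) 0 0 (i * w).
Definition psl_rot3 := psl2 (- w) 0 (2%:R * w - 1) (w - 1).
Definition psl_dual := coset 'Z(SL2F F)%g (gl2 0 1 (2%:R - w) 0).

Lemma det_psl_rot1 : - w * (w - 1) = 1 + (1 - w) * 0. Proof. by ring: w_sqr. Qed.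
Lemma det_psl_rot2 : i * (w - 1) * (i * w) = 1 + 0 * 0. Proof. by ring: w_sqr i_sqr. Qed.
Lemma det_psl_rot3 : - w * (w - 1) = 1 + 0 * (2%:R * w - 1). Proof. by ring: w_sqr. Qed.

Lemma sixth_root_primitive : 6.-primitive_root w.
Proof.
have w3 : w ^+ 3 = -1 by ring: w_sqr.
have w6 : w ^+ 6 = 1 by rewrite -[6%N]/(3 * 2)%N exprM w3 sqrrN expr1n.
have [//|m w_prim m_dvd6] := prim_order_exists _ w6.
have m3 : ~~ (m %| 3)%N.
  rewrite (prim_order_dvd w_prim) w3; apply: contra nz2 => /eqP opp1.
  by rewrite -[2%:R]/(1 + 1) -{1}opp1 addNr.
have m2 : ~~ (m %| 2)%N.
  rewrite (prim_order_dvd w_prim) expr2 w_sqr subr_eq -[1 + 1]/2%:R.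
  apply: contra nz3 => /eqP w_2; have := w_sqr; rewrite w_2 => four_eq1.
  have -> : 3%:R = 2%:R * 2%:R - (2%:R - 1) :> F by ring.
  by rewrite four_eq1 subrr.
by case: m m3 m2 m_dvd6 w_prim => [|[|[|[|[|[|[|m]]]]]]] // _ _ /dvdn_leq -/(_ isT).
Qed.

Lemma two_sub_w_neq0 : 2%:R - w != 0.
Proof.
apply: contra nz3 => /eqP w_2; apply/eqP.
have -> : 3%:R = (2%:R - w) * (1 + w) by ring: w_sqr.
by rewrite w_2 mul0r.
Qed.

Lemma psl_dualJ a b c d : a * d = 1 + b * c ->
  (psl2 a b c d ^ psl_dual)%g = psl2 d (c / (2%:R - w)) (b * (2%:R - w)) a.
Proof.
move=> detE; have nz := two_sub_w_neq0; apply: (mulgI psl_dual); rewrite -conjgC.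
have det_dual : 0 * 0 - 1 * (2%:R - w) != 0 by rewrite mul0r add0r mul1r oppr_eq0.
have det_conj : d * a = 1 + c / (2%:R - w) * (b * (2%:R - w)) by rewrite mulrC detE; field.
rewrite -!coset_SL2FM (gl2M (det1_neq0 detE) det_dual) (gl2M det_dual (det1_neq0 det_conj)).
rewrite !(mul0r, mulr0, mul1r, mulr1, add0r, addr0) [_ * d]mulrC.
by rewrite [_ * (c / _)]mulrC divfK.
Qed.

Lemma psl_rot12 : (psl_rot1 * psl_rot2)%g = psl2 i i 0 (- i).
Proof. by apply: psl2M; ring: w_sqr i_sqr. Qed.

Lemma psl_rot2_cube : (psl_rot2 ^+ 3)%g = psl2 (- i) 0 0 i.
Proof.
have rot2_sqr : (psl_rot2 * psl_rot2)%g = psl2 w 0 0 (1 - w).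
  by apply: psl2M; ring: w_sqr i_sqr.
by rewrite expgSr expg2 rot2_sqr; apply: psl2M; ring: w_sqr i_sqr.
Qed.

Lemma psl_tess_rotations : tess_rotations psl_rot1 psl_rot2.
Proof.
split.
- rewrite expgSr expg2.
  have -> : (psl_rot1 * psl_rot1)%g = psl2 (w - 1) (w - 1) 0 (- w).
    by apply: psl2M; ring: w_sqr.
  by rewrite -psl2_1; apply: psl2M; ring: w_sqr.
- rewrite -[6%N]/(3 * 2)%N expgM psl_rot2_cube expg2 -psl2_opp1.
  by apply: psl2M; ring: w_sqr i_sqr.
- by rewrite psl_rot12 expg2 -psl2_opp1; apply: psl2M; ring: w_sqr i_sqr.
Qed.

Lemma psl_tess_unit : tess_unit psl_rot1 psl_rot2 = upper 1.
Proof.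
by rewrite /tess_unit psl_rot2_cube -mulgA psl_rot12; apply: psl2M; ring: w_sqr i_sqr.
Qed.

Lemma upperJ_psl_rot2V x : (upper x ^ psl_rot2^-1)%g = upper (w * x).
Proof.
have -> : psl_rot2^-1%g = psl2 (i * w) 0 0 (i * (w - 1)).
  by rewrite psl2V ?det_psl_rot2 // oppr0.
rewrite conjgE psl2V ?oppr0; last by ring: w_sqr i_sqr.
have -> : (upper x * psl2 (i * w) 0 0 (i * (w - 1)))%g =
    psl2 (i * w) (i * (w - 1) * x) 0 (i * (w - 1)).
  by apply: psl2M; ring: w_sqr i_sqr.
by apply: psl2M; ring: w_sqr i_sqr.
Qed.

Lemma psl_tess_tr v : tess_tr psl_rot1 psl_rot2 v = upper (v.1%:~R + w * v.2%:~R).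
Proof. by rewrite /tess_tr psl_tess_unit upperJ_psl_rot2V !upperXz upperD mulr1 mulrzr. Qed.

Lemma psl_tess_tr_eq1 v :
  tess_tr psl_rot1 psl_rot2 v = 1%g <-> v.1%:~R + w * v.2%:~R = 0.
Proof. by rewrite psl_tess_tr; split=> [/upper_eq1|->] //; apply: upper0. Qed.

Lemma psl_rot23_lower s : s \in <<[set psl_rot2; psl_rot3]>>%g ->
  exists a c d, a * d = 1 + 0 * c /\ s = psl2 a 0 c d.
Proof.
move: s; apply: gen_ind => [|s' + s [a [c [d [detE ->]]]]].
  by exists 1, 0, 1; rewrite psl2_1; split=> //; ring.
case/set2P=> ->.
  exists (i * (w - 1) * a), (i * w * c), (i * w * d); split; first by ring: w_sqr i_sqr detE.
  by apply: psl2M => //; [exact: det_psl_rot2|..]; ring.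
exists (- w * a), ((2%:R * w - 1) * a + (w - 1) * c), ((w - 1) * d); split.
  by ring: w_sqr detE.
by apply: psl2M => //; [exact: det_psl_rot3|..]; ring.
Qed.

Lemma psl_self_dual_rotations : self_dual_rotations psl_rot1 psl_rot2 psl_rot3 psl_dual.
Proof.
have nz := two_sub_w_neq0; split.
- exact: psl_tess_rotations.
- rewrite psl_rot12 expg2.
  have -> : (psl2 i i 0 (- i) * psl_rot3)%g =
      psl2 (i * (w - 1)) (i * (w - 1)) (i * (1 - 2%:R * w)) (i * (1 - w)).
    by apply: psl2M; ring: w_sqr i_sqr.
  by rewrite -psl2_opp1; apply: psl2M; ring: w_sqr i_sqr.
- rewrite (psl_dualJ det_psl_rot1) (psl2V det_psl_rot3) oppr0 mul0r.
  by have -> : (1 - w) * (2%:R - w) = - (2%:R * w - 1) by ring: w_sqr.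
- by rewrite (psl_dualJ det_psl_rot2) (psl2V det_psl_rot2) !mul0r oppr0.
- rewrite (psl_dualJ det_psl_rot3) (psl2V det_psl_rot1) oppr0 mul0r.
  have -> : 2%:R * w - 1 = - (1 - w) * (2%:R - w) by ring: w_sqr.
  by rewrite mulfK.
- move=> v; rewrite psl_tess_tr => /psl_rot23_lower[a [c [d [detE up_low]]]].
  have [[_ -> _ _]|[_ -> _ _]] := psl2_eq (det1_up _) detE up_low.
    exact: upper0.
  by rewrite oppr0 upper0.
Qed.

Lemma psl_nondegenerate_rotations : nondegenerate_rotations psl_rot1 psl_rot2.
Proof.
split=> [v k|]; last by rewrite psl_tess_unit => /upper_eq1/eqP; rewrite oner_eq0.
have iw_inv : i * (w - 1) * (i * w) = 1 by ring: w_sqr i_sqr.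
have detX : (i * (w - 1)) ^+ k * (i * w) ^+ k = 1 + 0 * 0.
  by rewrite -exprMn iw_inv expr1n mulr0 addr0.
have rot2X : (psl_rot2 ^+ k)%g = psl2 ((i * (w - 1)) ^+ k) 0 0 ((i * w) ^+ k).
  elim: k {detX} => [|k IH]; first by rewrite expg0 !expr0 psl2_1.
  rewrite expgS IH !exprS; apply: psl2M; rewrite ?det_psl_rot2 //; try ring.
  by rewrite -exprMn iw_inv expr1n; ring.
rewrite /tess_rot psl_tess_tr => /(canRL (mulKVg _)); rewrite mulg1 rot2X.
move/(psl2_eq (det1_up _) detX)=> diag_eq; rewrite (prim_order_dvd sixth_root_primitive).
have -> : w ^+ k = ((i * (w - 1)) ^+ k) ^+ 2.
  by rewrite -exprM mulnC exprM; congr (_ ^+ k); ring: w_sqr i_sqr.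
have : (i * (w - 1)) ^+ k = 1 \/ (i * (w - 1)) ^+ k = -1.
  case: diag_eq => [[<- _ _ _]|[one_eq _ _ _]]; first by left.
  by right; apply: oppr_inj; rewrite opprK -one_eq.
by case=> ->; rewrite ?sqrrN expr1n.
Qed.

Hypothesis F_prime : forall x, exists n : nat, x = n%:R.

Lemma upper_generates (N : {group coset_of 'Z(SL2F F)%g}) x y :
  x != 0 -> upper x \in N -> upper y \in N.
Proof.
move=> nz xN; have [n yx] := F_prime (y / x).
have -> : y = x *+ n by rewrite -mulr_natr -yx mulrC divfK.
by rewrite -upperX groupX.
Qed.

Lemma lower_generates (N : {group coset_of 'Z(SL2F F)%g}) x y :
  x != 0 -> lower x \in N -> lower y \in N.
Proof.
move=> nz xN; have [n yx] := F_prime (y / x).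
have -> : y = x *+ n by rewrite -mulr_natr -yx mulrC divfK.
by rewrite -lowerX groupX.
Qed.

Lemma gen_psl_rot : <<[set psl_rot1; psl_rot2; psl_rot3]>>%g = PSL2F F.
Proof.
apply/eqP; rewrite eqEsubset; apply/andP; split.
  rewrite gen_subG; apply/subsetP=> s /setUP[/set2P[]->|/set1P->]; apply: psl2_mem.
  - exact: det_psl_rot1.
  - exact: det_psl_rot2.
  - exact: det_psl_rot3.
pose N := <<[set psl_rot1; psl_rot2; psl_rot3]>>%G.
have [r1N r2N r3N] : [/\ psl_rot1 \in N, psl_rot2 \in N & psl_rot3 \in N].
  by split; apply: mem_gen; rewrite !inE eqxx ?orbT.
have upN : upper 1 \in N by rewrite -psl_tess_unit !groupM ?groupX.
have lowN : lower (2%:R - w) \in N.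
  have [_ _ d1 d2 d3 _] := psl_self_dual_rotations.
  have -> : lower (2%:R - w) = (upper 1 ^ psl_dual)%g.
    by rewrite (psl_dualJ (det1_up 1)) mul0r mul1r.
  rewrite -psl_tess_unit 2!conjMg conjXg d1 d2.
  by rewrite !groupM ?groupV // groupX // groupV.
apply: (@PSL2F_sub_unipotent _ N) => x.
  by apply: upper_generates upN; apply: oner_neq0.
exact: lower_generates two_sub_w_neq0 lowN.
Qed.

End PSL2Rotations.

Lemma finField_sqrt_opp1 (F : finFieldType) : (4 %| #|F|.-1)%N -> exists i : F, i * i = -1.
Proof.
case/dvdnP=> k card_F; have F_gt1 := finNzRing_gt1 F.
have F_gt0 : (0 < #|F|.-1)%N by rewrite -ltnS prednK // ltnW.
have nonzero_roots : all #|F|.-1.-unity_root (enum (predC1 (0 : F))).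
  apply/allP=> x; rewrite mem_enum unity_rootE => x_nz; apply/eqP/(mulfI x_nz).
  by rewrite -exprS mulr1 prednK ?expf_card // ltnW.
have := has_prim_root F_gt0 nonzero_roots (enum_uniq _).
rewrite -cardE cardC1 leqnn => /(_ isT)/hasP[z _ z_prim].
have k_gt0 : (0 < k)%N by move: F_gt0; rewrite card_F; case: (k).
have zk_prim : 4.-primitive_root (z ^+ k).
  by have := exp_prim_root z_prim k; rewrite card_F gcdnMr mulKn.
exists (z ^+ k); move: (z ^+ k) zk_prim => i i_prim.
have : (i ^+ 2 - 1) * (i ^+ 2 + 1) == 0.
  by rewrite -subr_sqr expr1n -exprM (prim_expr_order i_prim) subrr.
rewrite mulf_eq0 subr_eq0 addr_eq0 -(prim_order_dvd i_prim) /=.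
by rewrite expr2 => /eqP.
Qed.

Section PSL2p.
Variable p : nat.
Hypothesis p_prime : prime p.

Lemma natr_Fp_eq0 n : (n%:R == 0 :> 'F_p) = (p %| n)%N.
Proof. by rewrite (dvdn_pcharf (pchar_Fp p_prime)). Qed.

Lemma simple_PSL2 : (5 < p)%N -> simple (PSL2 p).
Proof.
move=> p_gt5; apply: (@simple_PSL2F 'F_p 2%:R).
  by rewrite natr_Fp_eq0; apply/negP=> /dvdn_leq; lia.
rewrite -subr_eq0 (_ : 2%:R ^+ 4 - 1 = (3 * 5)%:R) ?natr_Fp_eq0 ?Euclid_dvdM //.
  by apply/norP; split; apply/negP=> /dvdn_leq; lia.
by ring.
Qed.

Lemma card_PSL2 : (p * (p ^ 2 - 1) %| 2 * #|PSL2 p|)%N.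
Proof. by have := card_PSL2F 'F_p; rewrite card_Fp. Qed.

Lemma prime_mod12_gt12 : p = 1 %[mod 12] -> (12 < p)%N.
Proof. by move: (prime_gt1 p_prime); clear; lia. Qed.

Lemma PSL2_rotations (b c : nat) : p = 1 %[mod 12] -> (0 < b)%N -> (0 < c)%N ->
    p = (b ^ 2 + b * c + c ^ 2)%N ->
  exists s1 s2 s3 d : coset_of 'Z(SL2 p)%g,
    [/\ self_dual_rotations s1 s2 s3 d, nondegenerate_rotations s1 s2,
        <<[set s1; s2; s3]>>%g = PSL2 p &
        forall v, tess_tr s1 s2 v = 1%g <-> in_lattice (b%:Z, c%:Z) v].
Proof.
move=> p_mod12 b_gt0 c_gt0 pE.
have p_gt12 := prime_mod12_gt12 p_mod12.
have c_nz : c%:R != 0 :> 'F_p by rewrite natr_Fp_eq0; apply: prime_norm_ndvd b_gt0 c_gt0 pE.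
pose w : 'F_p := - (b%:R / c%:R).
have w_sqr : w * w = w - 1.
  apply: (mulIf (mulf_neq0 c_nz c_nz)); apply/eqP; rewrite -subr_eq0; apply/eqP.
  transitivity ((b ^ 2 + b * c + c ^ 2)%:R : 'F_p); last by rewrite -pE pchar_Fp_0.
  by rewrite !natrD !natrX natrM /w; field.
have [i i_sqr] : exists i : 'F_p, i * i = -1.
  by apply: finField_sqrt_opp1; rewrite card_Fp //; lia.
have nz2 : 2%:R != 0 :> 'F_p by rewrite natr_Fp_eq0; apply/negP=> /dvdn_leq; lia.
have nz3 : 3%:R != 0 :> 'F_p by rewrite natr_Fp_eq0; apply/negP=> /dvdn_leq; lia.
have Fp_natr (x : 'F_p) : exists n : nat, x = n%:R by exists (x : nat); rewrite natr_Zp.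
exists (psl_rot1 w), (psl_rot2 w i), (psl_rot3 w), (psl_dual w); split.
- exact: psl_self_dual_rotations.
- exact: psl_nondegenerate_rotations.
- exact: gen_psl_rot.
move=> v; rewrite (in_lattice_prime_norm p_prime b_gt0 c_gt0 pE) (psl_tess_tr_eq1 w_sqr i_sqr).
rewrite (dvdz_pcharf (pchar_Fp p_prime)).
have -> : (c%:Z * v.1 - b%:Z * v.2)%:~R = c%:R * (v.1%:~R + w * v.2%:~R) :> 'F_p.
  by rewrite rmorphB !rmorphM /= -!pmulrn /w; field.
by rewrite mulf_eq0 (negPf c_nz); split=> [->|/eqP].
Qed.

End PSL2p.

(** * Coset geometries *)

Definition proper_type (i : nat) : bool := (0 < i < 5)%N.

Definition other_types (l : nat) : pred nat := [pred i | proper_type i & i != l].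

Section FlipGroups.
Variables (gT : finGroupType) (a : nat -> gT).
Local Open Scope group_scope.
Implicit Types (M N : pred nat) (i j l : nat).

Definition flip_products M : {set gT} :=
  [set (a i)^-1 * a j | i : 'I_6 in [pred i : 'I_6 | M i], j : 'I_6 in [pred j : 'I_6 | M j]].

Definition flip_group M : {group gT} := <<flip_products M>>%G.

Lemma mem_flip_group M i j : proper_type i -> proper_type j -> M i -> M j ->
  (a i)^-1 * a j \in flip_group M.
Proof.
move=> /andP[_ /ltnW i6] /andP[_ /ltnW j6] Mi Mj; apply/mem_gen/imset2P.
by exists (Ordinal (i6 : (i < 6)%N)) (Ordinal (j6 : (j < 6)%N)).
Qed.

Lemma flip_group_sub M (H : {group gT}) g : (forall i, M i -> g * a i \in H) ->
  flip_group M \subset H.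
Proof.
move=> MH; rewrite gen_subG; apply/subsetP=> _ /imset2P[i j Mi Mj ->].
by rewrite -(mulKg g (a j)) mulgA -invMg groupM ?groupV ?MH.
Qed.

Lemma flip_group_pred1 i : flip_group (pred1 i) \subset [1].
Proof.
by apply: (@flip_group_sub _ 1%G (a i)^-1) => j /eqP->; rewrite mulVg group1.
Qed.

Lemma flip_groupS M N : {subset M <= N} -> flip_group M \subset flip_group N.
Proof. by move=> sMN; apply/genS/imset2S; apply/subsetP=> i; apply: sMN. Qed.

Definition flip_stab (l : nat) : {group gT} := flip_group (other_types l).

Lemma flip_stab_sub l : flip_stab l \subset flip_group proper_type.
Proof. by apply: flip_groupS => i /andP[]. Qed.

Lemma flip_stab_improper l : ~~ proper_type l -> flip_stab l = flip_group proper_type.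
Proof.
move=> l_improper; apply/val_inj/eqP; rewrite eqEsubset flip_stab_sub flip_groupS // => i pi.
by rewrite inE /= -[proper_type i]/(i \in proper_type) pi; apply: contraNneq l_improper => <-.
Qed.

Lemma mem_flip_stab l i j : proper_type i -> proper_type j -> l != i -> l != j ->
  (a i)^-1 * a j \in flip_stab l.
Proof.
by move=> pi pj li lj; apply: mem_flip_group => //; apply/andP; split; rewrite // eq_sym.
Qed.

End FlipGroups.

(** The faces of type [i], that is of rank [i - 1], are the right cosets of
    [cg_stab i], so that the groups of index 0 and 5 belong to the improper faces.
    The geometry has two orbits of flags, that of the flag of all the cosets
    containing 1, and that of its neighbour at type 1; its neighbour at type [i] is
    the image of the latter under [cg_flip i]. The last condition is the
    intersection property. *)
Record coset_geometry := CosetGeometry {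
  cg_type : finGroupType;
  cg_flip : nat -> cg_type;
  cg_flip1 : (cg_flip 1 = 1)%g;
  cg_flip2 : cg_flip 2 \notin flip_stab cg_flip 1;
  cg_factor : forall i j k, (i < j < k)%N -> (k <= 5)%N ->
    flip_stab cg_flip j \subset
      ((flip_stab cg_flip j :&: flip_stab cg_flip i) *
       (flip_stab cg_flip j :&: flip_stab cg_flip k))%g;
  cg_diamond : forall i, (i < 4)%N -> exists x,
    [/\ x \in flip_stab cg_flip i :&: flip_stab cg_flip i.+2,
        x \notin flip_stab cg_flip i.+1 &
        flip_stab cg_flip i :&: flip_stab cg_flip i.+2 \subset
          flip_stab cg_flip i.+1 :|: (flip_stab cg_flip i.+1 :* x)%g];
  cg_intersection : forall (M : pred nat) g, {subset M <= proper_type} ->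
    g \in flip_group cg_flip proper_type ->
    (forall l, proper_type l -> ~~ M l -> g \in flip_stab cg_flip l) ->
    g \in flip_group cg_flip M
}.

Definition cg_stab (X : coset_geometry) (l : nat) : {group cg_type X} := flip_stab (@cg_flip X) l.

Definition cg_group (X : coset_geometry) : {group cg_type X} := flip_group (@cg_flip X) proper_type.

Section Faces.
Variable X : coset_geometry.
Local Open Scope group_scope.
Local Notation gT := (cg_type X).
Local Notation G := (cg_group X).
Local Notation K := (@cg_stab X).
Local Notation a := (@cg_flip X).

Lemma cg_stab_sub i : K i \subset G.
Proof. exact: flip_stab_sub. Qed.

Lemma cg_flip_group i : proper_type i -> a i \in G.
Proof.
by move=> pi; rewrite -[a i]mul1g -invg1 -(cg_flip1 X); apply: mem_flip_group.
Qed.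

Lemma cg_flip_stab1 i l : proper_type i -> l != 1%N -> l != i -> a i \in K l.
Proof.
by move=> pi l1 li; rewrite -[a i]mul1g -invg1 -(cg_flip1 X); apply: mem_flip_stab.
Qed.

Definition cface_pred : pred ('I_6 * {set gT}) := fun x => x.2 \in rcosets (K x.1) G.
Definition cface : Type := {x | cface_pred x}.
HB.instance Definition _ := Finite.copy cface {x | cface_pred x}.

Implicit Types (x y z : cface) (g h : gT) (i j : 'I_6).

Definition ctype x : 'I_6 := (val x).1.
Definition cset x : {set gT} := (val x).2.

Lemma cface_inj x y : ctype x = ctype y -> cset x = cset y -> x = y.
Proof.
rewrite /ctype /cset => eq_type eq_set; apply: val_inj.
by rewrite [val x]surjective_pairing eq_type eq_set -surjective_pairing.
Qed.

Lemma cset_rcoset x g : g \in cset x -> cset x = K (ctype x) :* g.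
Proof.
have /rcosetsP[h hG] := valP x; rewrite -/(ctype x) -/(cset x) => -> gx.
exact/esym/rcoset_eqP.
Qed.

Lemma cset_sub x : cset x \subset G.
Proof.
have /rcosetsP[h hG] := valP x; rewrite -/(ctype x) -/(cset x) => ->.
by apply/subsetP=> _ /rcosetP[k kK ->]; rewrite groupM // (subsetP (cg_stab_sub _) _ kK).
Qed.

Lemma cset_nonempty x : exists g, g \in cset x.
Proof.
have /rcosetsP[h hG] := valP x; rewrite -/(ctype x) -/(cset x) => ->.
by exists h; apply: rcoset_refl.
Qed.

Lemma mem_cset x g h : g \in cset x -> (h \in cset x) = (h * g^-1 \in K (ctype x)).
Proof. by move=> gx; rewrite (cset_rcoset gx) mem_rcoset. Qed.

Lemma cface_eq x y g : ctype x = ctype y -> g \in cset x -> g \in cset y -> x = y.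
Proof.
move=> eq_type gx gy; apply: cface_inj => //.
by rewrite (cset_rcoset gx) (cset_rcoset gy) eq_type.
Qed.

Lemma cset_improper x : ~~ proper_type (ctype x) -> cset x = G.
Proof.
have [g gx] := cset_nonempty x; rewrite (cset_rcoset gx) => x_improper.
have gG := subsetP (cset_sub x) g gx; suff -> : K (ctype x) = G by rewrite rcoset_id.
exact: flip_stab_improper.
Qed.

Definition cface_le x y : bool := (ctype x <= ctype y)%N && (cset x :&: cset y != set0).

Lemma cface_leP x y :
  reflect ((ctype x <= ctype y)%N /\ exists2 g, g \in cset x & g \in cset y) (cface_le x y).
Proof.
apply: (iffP andP) => [[le_xy /set0Pn[g /setIP[gx gy]]]|[le_xy [g gx gy]]].
  by split=> //; exists g.
by split=> //; apply/set0Pn; exists g; rewrite inE gx.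
Qed.

Lemma cface_le_eq x y : cface_le x y -> ctype x = ctype y -> x = y.
Proof. by case/cface_leP=> _ [g gx gy] eq_type; apply: (cface_eq eq_type gx). Qed.

(* By the factorisation of the middle stabiliser. *)
Lemma cface_le_common x y z : cface_le x y -> cface_le y z ->
  exists g, [/\ g \in cset x, g \in cset y & g \in cset z].
Proof.
move=> xy yz; have /cface_leP[le_xy [g gx gy]] := xy.
have /cface_leP[le_yz [h hy hz]] := yz.
have [eq_xy|neq_xy] := eqVneq (ctype x) (ctype y).
  by exists h; rewrite (cface_le_eq xy eq_xy).
have [eq_yz|neq_yz] := eqVneq (ctype y) (ctype z).
  by exists g; rewrite -(cface_le_eq yz eq_yz).
have lt_xyz : (ctype x < ctype y < ctype z)%N.
  by rewrite !ltn_neqAle le_xy le_yz neq_xy neq_yz.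
have gh : g * h^-1 \in K (ctype y) by rewrite -(mem_cset _ hy).
have := subsetP (cg_factor X lt_xyz (ltn_ord (ctype z))) _ gh.
case/mulsgP=> k l /setIP[ky kx] /setIP[ly lz] gh_kl.
have kg_lh : k^-1 * g = l * h by rewrite -[g](mulgKV h) gh_kl !mulgA mulVg mul1g.
exists (k^-1 * g); rewrite (mem_cset _ gx) (mem_cset _ gy) mulgK !groupV kx ky.
by split=> //; rewrite kg_lh (mem_cset _ hz) mulgK.
Qed.

Lemma cface_le_refl : reflexive cface_le.
Proof. by move=> x; apply/cface_leP; split=> //; have [g gx] := cset_nonempty x; exists g. Qed.

Lemma cface_le_anti : antisymmetric cface_le.
Proof.
move=> x y /andP[xy yx]; apply/(cface_le_eq xy)/val_inj/anti_leq.
by case/andP: xy yx => -> _ /andP[].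
Qed.

Lemma cface_le_trans : transitive cface_le.
Proof.
move=> y x z xy yz; have [g [gx _ gz]] := cface_le_common xy yz.
apply/cface_leP; split; last by exists g.
by case/andP: xy yz => xy _ /andP[/(leq_trans xy)].
Qed.

HB.instance Definition _ := Order.Le_isPOrder.Build
  (Order.Disp tt tt) cface cface_le_refl cface_le_anti cface_le_trans.

Lemma leE_cface x y : (x <= y)%O = cface_le x y. Proof. by []. Qed.

Lemma ctype_le x y : (x <= y)%O -> (ctype x <= ctype y)%N. Proof. by case/andP. Qed.

Lemma ctype_lt : {homo ctype : x y / (x < y)%O >-> (x < y)%N}.
Proof.
move=> x y; rewrite lt_neqAle => /andP[neq_xy xy]; rewrite ltn_neqAle ctype_le // andbT.
by apply: contra neq_xy => /eqP/val_inj/(cface_le_eq xy)->.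
Qed.

Lemma comparable_ctype_le x y : (x >=< y)%O -> (ctype x <= ctype y)%N -> (x <= y)%O.
Proof.
case/orP=> // yx le_xy; rewrite (cface_le_eq yx) //.
by apply/val_inj/anti_leq; rewrite le_xy ctype_le.
Qed.

Lemma chain_ctype_inj (A : {set cface}) : chain A -> {in A &, injective ctype}.
Proof.
move=> /chainP cA x y xA yA eq_type.
by apply: cface_le_eq (eq_type); apply: comparable_ctype_le; [apply: cA|rewrite eq_type].
Qed.

Lemma le_improper x y : ~~ proper_type (ctype x) || ~~ proper_type (ctype y) ->
  (ctype x <= ctype y)%N -> (x <= y)%O.
Proof.
move=> improper le_xy; apply/cface_leP; split=> //.
case/orP: improper => /cset_improper ->.
  by have [g gy] := cset_nonempty y; exists g => //; apply: (subsetP (cset_sub y)).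
by have [g gx] := cset_nonempty x; exists g => //; apply: (subsetP (cset_sub x)).
Qed.

Definition group_part g := if g \in G then g else 1.

Lemma group_partG g : group_part g \in G.
Proof. by rewrite /group_part; case: ifP. Qed.

Lemma coset_face_subproof i g : cface_pred (i, K i :* group_part g).
Proof. by apply/rcosetsP; exists (group_part g); rewrite ?group_partG. Qed.

(** [K i :* g] for [g \in G]; the junk value for other [g] is [K i]. *)
Definition coset_face i g : cface :=
  exist (fun w : 'I_6 * {set gT} => is_true (cface_pred w)) _ (coset_face_subproof i g).

Lemma cset_coset_face i g : g \in G -> cset (coset_face i g) = K i :* g.
Proof. by move=> gG; rewrite /cset /= /group_part gG. Qed.

Lemma mem_coset_face i g : g \in G -> g \in cset (coset_face i g).
Proof. by move=> gG; rewrite cset_coset_face // rcoset_refl. Qed.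

Lemma coset_faceE x g : g \in cset x -> x = coset_face (ctype x) g.
Proof.
by move=> gx; apply: (cface_eq _ gx) => //; apply/mem_coset_face/(subsetP (cset_sub x)).
Qed.

Lemma coset_face_eqP i g h : g \in G -> h \in G ->
  reflect (coset_face i g = coset_face i h) (g * h^-1 \in K i).
Proof.
move=> gG hG; apply: (iffP idP) => [gh|eq_gh].
  by apply: (@cface_eq _ _ g); rewrite ?mem_coset_face // cset_coset_face // mem_rcoset.
by rewrite -mem_rcoset -cset_coset_face // -eq_gh mem_coset_face.
Qed.

Lemma coset_face_mull i g k : g \in G -> k \in K i -> coset_face i (k * g) = coset_face i g.
Proof.
move=> gG kK; apply/coset_face_eqP; rewrite ?mulgK // groupM //.
exact: subsetP (cg_stab_sub _) _ kK.
Qed.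

Lemma coset_face_le i j g : g \in G -> (i <= j)%N -> (coset_face i g <= coset_face j g)%O.
Proof. by move=> gG ij; apply/cface_leP; split=> //; exists g; rewrite mem_coset_face. Qed.

Lemma flag_improper (A : {set cface}) x : flag A -> ~~ proper_type (ctype x) -> x \in A.
Proof.
move=> fA x_improper; apply: flag_comparable => // y _.
by case/orP: (leq_total (ctype x) (ctype y)) => le_type; apply/orP; [left|right];
  apply: le_improper => //; rewrite x_improper ?orbT.
Qed.

(* A missing type is filled in by the coset of a common element of the two
   neighbouring faces. *)
Lemma flag_has_ctype (A : {set cface}) i : flag A -> exists2 x, x \in A & ctype x = i.
Proof.
move=> fA; have /chainP cA := flag_chain fA.
have [/andP[i_gt0 i_lt5]|i_improper] := boolP (proper_type i); last first.
  by exists (coset_face i 1) => //; apply: flag_improper.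
have [/exists_inP[x xA /eqP]|] := boolP [exists x in A, ctype x == i]; first by exists x.
rewrite negb_exists_in => /forall_inP noA.
have [botA topA] : coset_face ord0 1 \in A /\ coset_face ord_max 1 \in A.
  by split; apply: flag_improper.
case: (@arg_maxnP _ (coset_face ord0 1) (fun x => (x \in A) && (ctype x < i)%N)
  (fun x => ctype x : nat)) => [|x /andP[xA xi] x_max]; first by rewrite botA.
case: (@arg_minnP _ (coset_face ord_max 1) (fun x => (x \in A) && (i < ctype x)%N)
  (fun x => ctype x : nat)) => [|y /andP[yA iy] y_min]; first by rewrite topA.
have /cface_leP[_ [g gx gy]] : (x <= y)%O.
  by apply: comparable_ctype_le; rewrite ?cA // ltnW // (ltn_trans xi).
have gG := subsetP (cset_sub x) g gx.
have xz : (x <= coset_face i g)%O by rewrite (coset_faceE gx) coset_face_le // ltnW.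
have zy : (coset_face i g <= y)%O by rewrite (coset_faceE gy) coset_face_le // ltnW.
exists (coset_face i g) => //; apply: flag_comparable => // w wA.
have := noA w wA; rewrite -val_eqE neq_ltn => /orP[wi|iw].
  apply/ge_comparable/(le_trans _ xz)/comparable_ctype_le; first exact: cA.
  by apply: x_max; rewrite wA.
apply/le_comparable/(le_trans zy)/comparable_ctype_le; first exact: cA.
by apply: y_min; rewrite wA.
Qed.

Lemma cflag_size (A : {set cface}) : flag A -> #|A| = 6%N.
Proof.
move=> fA; rewrite -(card_in_imset (chain_ctype_inj (flag_chain fA))).
rewrite -[RHS](card_ord 6) -cardsT; congr #|pred_of_set _|.
by apply/setP=> i; rewrite !inE; have [x xA <-] := flag_has_ctype i fA; rewrite imset_f.
Qed.

Lemma flag_of_faces (f : 'I_6 -> cface) : (forall i, ctype (f i) = i) ->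
  (forall i j, (i < j)%N -> (f i <= f j)%O) -> flag [set f i | i : 'I_6].
Proof.
move=> f_type f_le; apply/maxsetP; split=> [|B cB sAB].
  apply/chainP=> _ _ /imsetP[i _ ->] /imsetP[j _ ->].
  case: (ltngtP i j) => [ij|ji|/val_inj->]; last exact: comparablexx.
    exact/le_comparable/f_le.
  exact/ge_comparable/f_le.
apply/eqP; rewrite eqEsubset sAB andbT; apply/subsetP=> y yB.
have fA : f (ctype y) \in [set f i | i : 'I_6] by apply: imset_f.
by rewrite -(chain_ctype_inj cB (subsetP sAB _ fA) yB) ?f_type.
Qed.

Definition coset_flag g : {set cface} := [set coset_face i g | i : 'I_6].

Definition mirror_face i g : cface :=
  if i == 1%N :> nat then coset_face i ((a 2)^-1 * g) else coset_face i g.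

Definition mirror_flag g : {set cface} := [set mirror_face i g | i : 'I_6].

Lemma coset_flag_flag g : g \in G -> flag (coset_flag g).
Proof. by move=> gG; apply: flag_of_faces => // i j /ltnW/coset_face_le->. Qed.

Lemma mem_coset_flag g x : g \in G -> (x \in coset_flag g) = (g \in cset x).
Proof.
move=> gG; apply/imsetP/idP=> [[i _ ->]|gx]; first exact: mem_coset_face.
by exists (ctype x) => //; apply: coset_faceE.
Qed.

Lemma ctype_mirror_face i g : ctype (mirror_face i g) = i.
Proof. by rewrite /mirror_face; case: ifP. Qed.

Lemma mirror_face_le i j g : g \in G -> (i < j)%N -> (mirror_face i g <= mirror_face j g)%O.
Proof.
move=> gG lt_ij; have agG : (a 2)^-1 * g \in G by rewrite groupM // groupV cg_flip_group.
rewrite /mirror_face; case: eqP => [i1|i1]; case: eqP => [j1|_].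
- by rewrite i1 j1 in lt_ij.
- have [pj|npj] := boolP (proper_type j); last first.
    by apply: le_improper; rewrite ?npj ?orbT // ltnW.
  have [j2|j2] := eqVneq (j : nat) 2%N.
    apply/cface_leP; split; first exact: ltnW.
    exists ((a 3)^-1 * g); rewrite cset_coset_face // mem_rcoset.
      by rewrite invMg mulgA mulgK invgK i1; apply: mem_flip_stab.
    by rewrite mulgK j2 groupV; apply: cg_flip_stab1.
  have -> : coset_face j g = coset_face j ((a 2)^-1 * g); last exact/coset_face_le/ltnW.
  rewrite coset_face_mull // groupV; apply: cg_flip_stab1 => //.
  by apply: contraTneq lt_ij => ->; rewrite i1.
- apply: le_improper; last exact: ltnW.
  by case: (i : nat) j1 lt_ij => //= i' ->.
- exact/coset_face_le/ltnW.
Qed.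

Lemma mirror_flag_flag g : g \in G -> flag (mirror_flag g).
Proof.
by move=> gG; apply: flag_of_faces => [i|i j]; [apply: ctype_mirror_face|apply: mirror_face_le].
Qed.

Lemma mirror_face_flip i j g : g \in G -> proper_type i -> j != i ->
  mirror_face j (a i * g) = coset_face j g.
Proof.
move=> gG pi neq_ji; have aG := cg_flip_group.
have [pj|npj] := boolP (proper_type j); last first.
  apply: (@cface_eq _ _ g); rewrite ?ctype_mirror_face // ?mem_coset_face //.
  by rewrite cset_improper ?ctype_mirror_face.
rewrite /mirror_face; case: eqP => [j1|/eqP j1].
  rewrite mulgA coset_face_mull //.
  have [->|i2] := eqVneq (i : nat) 2%N; first by rewrite mulVg group1.
  by apply: mem_flip_stab => //; rewrite j1.
by rewrite coset_face_mull // cg_flip_stab1.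
Qed.

Lemma stab_trivial g i : g \in G -> proper_type i ->
  (forall l, proper_type l -> l != i -> g \in K l) -> g = 1.
Proof.
move=> gG pi gK; apply/set1gP/(subsetP (flip_group_pred1 a i)).
by apply: cg_intersection => // l /eqP->.
Qed.

Lemma coset_face_eq_trivial g h i : g \in G -> h \in G -> proper_type i ->
  (forall j, j != i -> coset_face j g = coset_face j h) -> g = h.
Proof.
move=> gG hG pi eq_faces; apply/eqP; rewrite eq_mulgV1; apply/eqP.
apply: (stab_trivial _ pi) => [|l pl neq_li]; first by rewrite groupM ?groupV.
have l_lt6 : (l < 6)%N by case/andP: pl => _; apply: ltnW.
exact/(coset_face_eqP (Ordinal l_lt6) gG hG)/eq_faces.
Qed.

Lemma coset_flag_neq_mirror g h : g \in G -> h \in G -> coset_flag g <> mirror_flag h.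
Proof.
move=> gG hG eq_flags; have fg := flag_chain (coset_flag_flag gG).
have faceE i : coset_face i g = mirror_face i h.
  apply: (chain_ctype_inj fg); rewrite ?ctype_mirror_face //; first exact: imset_f.
  by rewrite eq_flags; apply: imset_f.
have type1 : proper_type (inord 1 : 'I_6) by rewrite inordK.
have eq_gh : g = h.
  apply: (coset_face_eq_trivial _ _ type1) => // j.
  by rewrite -val_eqE /= inordK // faceE /mirror_face => /negPf->.
have := faceE (inord 1); rewrite /mirror_face inordK //= -eq_gh.
have agG : (a 2)^-1 * g \in G by rewrite groupM // groupV cg_flip_group.
move/esym/(coset_face_eqP _ agG gG); rewrite inordK // mulgK groupV.
by rewrite (negPf (cg_flip2 X)).
Qed.

Lemma flag_common_element (A : {set cface}) i : flag A -> proper_type i ->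
  exists2 g, g \in G & {in A, forall x, ctype x != i -> g \in cset x}.
Proof.
move=> fA pi; have /chainP cA := flag_chain fA; have A_inj := chain_ctype_inj (flag_chain fA).
have common_of3 (j k l : nat) : (j < k < l)%N -> (l < 6)%N ->
    (forall m : nat, proper_type m -> m != i -> m \in [:: j; k; l]) ->
    exists2 g, g \in G & {in A, forall x, ctype x != i -> g \in cset x}.
  move=> /andP[jk kl] l6 jklP; have k6 := ltn_trans kl l6; have j6 := ltn_trans jk k6.
  have [x xA tx] := flag_has_ctype (Ordinal j6) fA.
  have [y yA ty] := flag_has_ctype (Ordinal k6) fA.
  have [z zA tz] := flag_has_ctype (Ordinal l6) fA.
  have xy : cface_le x y by apply: comparable_ctype_le; rewrite ?cA // tx ty ltnW.
  have yz : cface_le y z by apply: comparable_ctype_le; rewrite ?cA // tz ty ltnW.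
  have [g [gx gy gz]] := cface_le_common xy yz; exists g => [|w wA neq_wi].
    exact: (subsetP (cset_sub x)).
  have [pw|npw] := boolP (proper_type (ctype w)).
    have := jklP _ pw neq_wi; rewrite !inE => /or3P[] /eqP tw.
    - by rewrite (A_inj w x) // tx; apply: val_inj.
    - by rewrite (A_inj w y) // ty; apply: val_inj.
    - by rewrite (A_inj w z) // tz; apply: val_inj.
  by rewrite cset_improper // (subsetP (cset_sub x)).
case: i pi common_of3 => -[|[|[|[|[|[|//]]]]]] // lt_i6 _ common_of3.
- by apply: (common_of3 2 3 4) => // -[|[|[|[|[|]]]]].
- by apply: (common_of3 1%N 3 4) => // -[|[|[|[|[|]]]]].
- by apply: (common_of3 1%N 2 4) => // -[|[|[|[|[|]]]]].
- by apply: (common_of3 1%N 2 3) => // -[|[|[|[|[|]]]]].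
Qed.

Lemma cflag_adjacent (A B : {set cface}) i : flag A -> flag B -> A != B ->
  {in A, forall x, ctype x != i -> x \in B} -> adjacent A B.
Proof.
move=> fA fB neqAB AB; have [x xA tx] := flag_has_ctype i fA.
apply: (@adjacent_setD1 _ _ _ _ x); rewrite ?cflag_size //.
apply/subsetP=> y /setD1P[neq_yx yA]; apply: AB => //; apply: contra neq_yx => /eqP ty.
by apply/eqP/(chain_ctype_inj (flag_chain fA)); rewrite ?tx.
Qed.

End Faces.

Section Connectedness.
Variable X : coset_geometry.
Local Open Scope group_scope.
Local Notation gT := (cg_type X).
Local Notation G := (cg_group X).
Local Notation K := (@cg_stab X).
Local Notation a := (@cg_flip X).
Variable S : {set cface X}.
Implicit Types (A B C D : {set cface X}) (x y : cface X) (g h : gT) (i j k l : 'I_6).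

Let adj_over : rel {set cface X} :=
  [rel C D | [&& adjacent C D, S \subset C & S \subset D]].

Lemma connect_flags_agree C D j : flag C -> flag D -> S \subset C -> S \subset D ->
  {in C, forall x, ctype x != j -> x \in D} -> connect adj_over C D.
Proof.
move=> fC fD sSC sSD CD; have [->|neqCD] := eqVneq C D; first exact: connect0.
by apply: connect1; rewrite /adj_over /= sSC sSD (cflag_adjacent fC fD neqCD CD).
Qed.

Lemma connect_coset_flag C i : flag C -> S \subset C -> proper_type i ->
    {in S, forall x, ctype x != i} ->
  exists2 g, g \in G & S \subset coset_flag g /\ connect adj_over C (coset_flag g).
Proof.
move=> fC /subsetP sSC pi Si; have [g gG gC] := flag_common_element fC pi; exists g => //.
have sSg : S \subset coset_flag g.
  by apply/subsetP=> x xS; rewrite mem_coset_flag // gC ?sSC ?Si.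
split=> //; apply: (connect_flags_agree (j := i)) => //.
- exact: coset_flag_flag.
- exact/subsetP.
- by move=> x xC xi; rewrite mem_coset_flag // gC.
Qed.

Lemma connect_flip k l g : g \in G -> proper_type k -> proper_type l ->
    {in S, forall x, ctype x != k /\ ctype x != l} -> S \subset coset_flag g ->
  let g' := (a k)^-1 * a l * g in
  S \subset coset_flag g' /\ connect adj_over (coset_flag g) (coset_flag g').
Proof.
move=> gG pk pl Skl /subsetP sSg g'; have aG := cg_flip_group X.
have [alG g'G] : a l * g \in G /\ g' \in G by rewrite !groupM ?groupV ?aG.
have g'E : a l * g = a k * g' by rewrite /g' -mulgA mulKVg.
have to_mirror i : i != l -> coset_face i g \in mirror_flag (a l * g).
  by move=> il; rewrite -(mirror_face_flip gG pl il); apply: imset_f.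
have of_mirror i : i != k -> mirror_face i (a l * g) \in coset_flag g'.
  by move=> ik; rewrite g'E (mirror_face_flip g'G pk ik); apply: imset_f.
have sSm : S \subset mirror_flag (a l * g).
  apply/subsetP=> x xS; have /imsetP[i _ xE] := sSg x xS; rewrite xE to_mirror //.
  by have [_] := Skl x xS; rewrite xE.
have sSg' : S \subset coset_flag g'.
  apply/subsetP=> x xS; have /imsetP[i _ xE] := subsetP sSm x xS; rewrite xE of_mirror //.
  by have [+ _] := Skl x xS; rewrite xE ctype_mirror_face.
split=> //; apply: (@connect_trans _ _ (mirror_flag (a l * g))).
  apply: (connect_flags_agree (j := l)); rewrite ?coset_flag_flag ?mirror_flag_flag //.
    exact/subsetP.
  by move=> _ /imsetP[i _ ->]; apply: to_mirror.
apply: (connect_flags_agree (j := k)); rewrite ?coset_flag_flag ?mirror_flag_flag //.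
by move=> _ /imsetP[i _ ->]; rewrite ctype_mirror_face; apply: of_mirror.
Qed.

Lemma connect_coset_flags g h : g \in G -> h \in G ->
  S \subset coset_flag g -> S \subset coset_flag h ->
  connect adj_over (coset_flag g) (coset_flag h).
Proof.
move=> gG hG sSg sSh.
pose M : pred nat := [pred m | proper_type m & [forall x in S, ctype x != m :> nat]].
have hg_gen : h * g^-1 \in flip_group a M.
  apply: cg_intersection => [m /andP[]//||m pm]; first by rewrite groupM ?groupV.
  rewrite /M /= pm negb_forall_in => /exists_inP[x xS /negPn/eqP <-].
  have gx : g \in cset x by rewrite -mem_coset_flag // (subsetP sSg).
  by rewrite -(mem_cset _ gx) -mem_coset_flag // (subsetP sSh).
suff : h * g^-1 * g \in G /\ S \subset coset_flag (h * g^-1 * g) /\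
    connect adj_over (coset_flag g) (coset_flag (h * g^-1 * g)).
  by rewrite mulgKV => -[_ []].
move: {h hG sSh} (h * g^-1) hg_gen; apply: gen_ind => [|y]; first by rewrite mul1g connect0.
case/imset2P=> k l kM lM -> h [hgG [sSh conn_h]].
have /andP[pk /forall_inP Sk] := kM; have /andP[pl /forall_inP Sl] := lM.
have [x xS|sS' conn'] := connect_flip hgG pk pl _ sSh; first by rewrite Sk ?Sl.
rewrite -mulgA; split; last by split; rewrite // (connect_trans conn_h).
by rewrite groupM // groupM ?groupV ?cg_flip_group.
Qed.

End Connectedness.

Section CosetPolytope.
Variable X : coset_geometry.
Local Open Scope group_scope.
Local Notation gT := (cg_type X).
Local Notation G := (cg_group X).
Local Notation K := (@cg_stab X).
Implicit Types (A B C D : {set cface X}) (x y z : cface X) (g h : gT) (i j k : 'I_6).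

Lemma cface_connected : strongly_flag_connected (cface X).
Proof.
move=> A B fA fB; set e := rel_of_simpl _; have [->|neqAB] := eqVneq A B; first exact: connect0.
have [x xA xB] : exists2 x, x \in A & x \notin B.
  apply/subsetPn; apply: contra neqAB => sAB.
  by rewrite (flag_sub_eq fA (flag_chain fB) sAB).
have px : proper_type (ctype x) by apply: contraNT xB; apply: flag_improper.
have ABx : {in A :&: B, forall y, ctype y != ctype x}.
  move=> y /setIP[yA yB]; apply: contraNneq xB => eq_type.
  by rewrite -(chain_ctype_inj (flag_chain fA) yA xA eq_type).
have e_sym : connect_sym e.
  apply: sym_connect_sym => C D; rewrite /e /=; congr andb; last exact: andbC.
  by rewrite /adjacent andbCA; congr (_ && (_ && _)); apply: andbC.
have [g gG [sg Ag]] := connect_coset_flag fA (subsetIl _ _) px ABx.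
have [h hG [sh Bh]] := connect_coset_flag fB (subsetIr _ _) px ABx.
apply: (connect_trans Ag); rewrite e_sym; apply: (connect_trans Bh).
exact: connect_coset_flags.
Qed.

Definition crank x : int := (ctype x : nat)%:Z - 1%R.

Lemma cface_betweenP g x y z : g \in cset x -> g \in cset y ->
    ctype y = (ctype x).+2 :> nat ->
  reflect (exists2 k, k \in K (ctype x) :&: K (ctype x).+2 &
             z = coset_face (inord (ctype x).+1) (k * g))
          (x < z < y)%O.
Proof.
move=> gx gy tyx; have gG := subsetP (cset_sub x) g gx.
have ltx : ((ctype x).+1 < 6)%N by have := ltn_ord (ctype y); rewrite tyx; apply: ltnW.
apply: (iffP andP) => [[xz zy]|[k /setIP[kx ky] ->]].
  have tz : ctype z = inord (ctype x).+1.
    apply: val_inj; rewrite /= inordK //.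
    by have := ctype_lt xz; have := ctype_lt zy; rewrite tyx; clear; lia.
  have [h [hx hz hy]] := cface_le_common (ltW xz) (ltW zy).
  exists (h * g^-1); first by rewrite inE -(mem_cset _ gx) hx -tyx -(mem_cset _ gy).
  by rewrite mulgKV -tz; apply: coset_faceE.
have kgG : k * g \in G by rewrite groupM // (subsetP (cg_stab_sub X _) _ kx).
have kgx : k * g \in cset x by rewrite (mem_cset _ gx) mulgK.
have kgy : k * g \in cset y by rewrite (mem_cset _ gy) mulgK tyx.
set w := coset_face _ _; have tw : ctype w = (ctype x).+1 :> nat by rewrite /= inordK.
have xw : (x <= w)%O by rewrite (coset_faceE kgx) coset_face_le // inordK.
have wy : (w <= y)%O by rewrite (coset_faceE kgy) coset_face_le // inordK // tyx.
rewrite !lt_neqAle xw wy !andbT.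
split; apply: contra_eq_neq tw => eq_w; first by rewrite -eq_w; clear; lia.
by rewrite eq_w tyx; clear; lia.
Qed.

Lemma cface_diamond x y : (x < y)%O -> crank y = (crank x + 2%:Z)%R ->
  #|[set z | (x < z < y)%O]| = 2%N.
Proof.
move=> xy; rewrite /crank => rank_xy; have tyx : ctype y = (ctype x).+2 :> nat.
  by move: rank_xy; clear; lia.
have /cface_leP[_ [g gx gy]] := ltW xy; have gG := subsetP (cset_sub x) g gx.
have ltx : (ctype x < 4)%N by move: (ltn_ord (ctype y)); rewrite tyx.
have lt1 : ((ctype x).+1 < 6)%N by rewrite ltnS ltnS leqW // ltnS ltnW.
have [u [uK uK1 sub_u]] := cg_diamond X ltx.
have uG : u \in G by have /setIP[ux _] := uK; apply: subsetP (cg_stab_sub X _) _ ux.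
set i : 'I_6 := inord (ctype x).+1; have iE : i = (ctype x).+1 :> nat by rewrite inordK.
have -> : [set z | (x < z < y)%O] = [set coset_face i g; coset_face i (u * g)].
  apply/setP=> z; rewrite !inE; apply/(cface_betweenP z gx gy tyx)/orP.
    case=> k kK ->; have := subsetP sub_u _ kK.
    rewrite inE mem_rcoset => /orP[] kK1; [left|right]; apply/eqP.
      by rewrite coset_face_mull // iE.
    have -> : k * g = k * u^-1 * (u * g) by rewrite mulgA mulgKV.
    by apply: coset_face_mull; [apply: groupM|rewrite iE].
  by case=> /eqP->; [exists 1; rewrite ?mul1g ?group1|exists u].
rewrite cards2; case: eqP => // /esym/(coset_face_eqP i (groupM uG gG) gG).
by rewrite mulgK iE (negPf uK1).
Qed.

Lemma cface_polytope : is_polytope 4 crank.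
Proof.
split.
- by move=> x; rewrite /crank; have := ltn_ord (ctype x); clear; lia.
- by move=> x y /ctype_lt; rewrite /crank; clear; lia.
- by exists (coset_face ord0 1) => x; apply: le_improper.
- exists (coset_face ord_max 1) => x; apply: le_improper; rewrite ?orbT //.
  exact: leq_ord.
- exact: cflag_size.
- exact: cface_connected.
- exact: cface_diamond.
Qed.

End CosetPolytope.

Definition coset_polytope (X : coset_geometry) : polytope 4 := Polytope (cface_polytope X).

(** * Symmetries and facets of coset polytopes *)

Section Automorphisms.
Variable X : coset_geometry.
Local Open Scope group_scope.
Local Notation gT := (cg_type X).
Local Notation G := (cg_group X).
Local Notation K := (@cg_stab X).
Local Notation a := (@cg_flip X).
Local Notation P := (coset_polytope X).
Implicit Types (A B : {set P}) (x y : P) (g h : gT) (i j : 'I_6) (k : nat).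

Lemma cface_mulr_subproof x g : cface_pred (ctype x, cset x :* group_part g).
Proof.
have [h hx] := cset_nonempty x; rewrite (cset_rcoset hx); apply/rcosetsP.
by exists (h * group_part g); rewrite ?rcosetM // groupM ?group_partG ?(subsetP (cset_sub x)).
Qed.

Definition cface_mulr g x : P :=
  exist (fun w : 'I_6 * {set gT} => is_true (cface_pred w)) _ (cface_mulr_subproof x g).

Lemma cface_mulr_inj g : injective (cface_mulr g).
Proof.
move=> x y /(congr1 val)[eq_type eq_set]; apply: cface_inj; first exact: eq_type.
exact: (can_inj (rcosetK (group_part g))).
Qed.

Definition cface_perm g : {perm P} := perm (@cface_mulr_inj g).

Lemma ctype_cface_perm g x : ctype (cface_perm g x) = ctype x.
Proof. by rewrite permE. Qed.

Lemma cset_cface_perm g x : g \in G -> cset (cface_perm g x) = cset x :* g.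
Proof. by move=> gG; rewrite permE /cset /= /group_part gG. Qed.

Lemma cface_perm_coset_face g h i : g \in G -> h \in G ->
  cface_perm g (coset_face i h) = coset_face i (h * g).
Proof.
move=> gG hG; apply: (@cface_eq _ _ _ (h * g)); first by rewrite ctype_cface_perm.
  by rewrite cset_cface_perm // mem_rcoset mulgK mem_coset_face.
by rewrite mem_coset_face // groupM.
Qed.

Lemma cface_perm_Gamma g : g \in G -> cface_perm g \in Gamma P.
Proof.
move=> gG; apply/GammaP=> x y; rewrite !leE_cface /cface_le !ctype_cface_perm.
rewrite !cset_cface_perm //; congr (_ && _); apply/set0Pn/set0Pn=> -[h]; rewrite !inE.
  by rewrite !mem_rcoset => hxy; exists (h * g^-1); rewrite inE.
by exists (h * g); rewrite !inE !mem_rcoset mulgK.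
Qed.

Lemma cface_permM : {in G &, {morph cface_perm : g h / g * h}}.
Proof.
move=> g h gG hG; apply/permP=> x; rewrite permM.
have [k kx] := cset_nonempty x; have kG := subsetP (cset_sub x) k kx.
by rewrite (coset_faceE kx) !cface_perm_coset_face ?groupM // mulgA.
Qed.

Canonical cface_perm_morphism := Morphism cface_permM.

Lemma cface_perm_coset_flag g h : g \in G -> h \in G ->
  cface_perm g @: coset_flag h = coset_flag (h * g).
Proof.
move=> gG hG; rewrite /coset_flag -imset_comp; apply: eq_imset => i /=.
exact: cface_perm_coset_face.
Qed.

Lemma cface_perm_mirror_flag g h : g \in G -> h \in G ->
  cface_perm g @: mirror_flag h = mirror_flag (h * g).
Proof.
move=> gG hG; rewrite /mirror_flag -imset_comp; apply: eq_imset => i /=.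
have aG := cg_flip_group X (isT : proper_type 2).
by rewrite /mirror_face; case: ifP => _; rewrite cface_perm_coset_face ?mulgA ?groupM ?groupV.
Qed.

Lemma injm_cface_perm : 'injm cface_perm.
Proof.
apply/injmP=> g h gG hG eq_perm.
apply: (coset_face_eq_trivial (i := inord 1)); rewrite ?inordK // => j _.
by rewrite -[g]mul1g -[h]mul1g -!cface_perm_coset_face // eq_perm.
Qed.

Lemma i_adjacent_ctype k i A B : i = k.+1 :> nat -> flag A -> flag B -> A <> B ->
  {in A, forall x, ctype x != i -> x \in B} -> i_adjacent k A B.
Proof.
move=> ik fA fB neqAB AB; apply/i_adjacentP => //; split=> [|x xA rx]; first exact/eqP.
apply: AB => //; apply: contraNneq rx => eq_type; rewrite /rank /= /crank eq_type ik.
by clear; lia.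
Qed.

Lemma coset_mirror_adjacent k g : (k < 4)%N -> g \in G ->
  i_adjacent k (coset_flag g : {set P}) (mirror_flag (a k.+1 * g)).
Proof.
move=> k4 gG; have k6 : (k.+1 < 6)%N by rewrite ltnS ltnW // ltnS.
have aG : a k.+1 * g \in G by rewrite groupM ?cg_flip_group //.
apply: (@i_adjacent_ctype k (Ordinal k6)); rewrite ?coset_flag_flag ?mirror_flag_flag //.
  exact: coset_flag_neq_mirror.
move=> _ /imsetP[l _ ->] lk.
by rewrite -(mirror_face_flip gG (i := Ordinal k6)) //; apply: imset_f.
Qed.

Lemma mirror_coset_adjacent k g : (k < 4)%N -> g \in G ->
  i_adjacent k (mirror_flag g : {set P}) (coset_flag ((a k.+1)^-1 * g)).
Proof.
move=> k4 gG; apply: i_adjacent_sym; rewrite -[g in mirror_flag g](mulKVg (a k.+1)).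
by apply: coset_mirror_adjacent; rewrite ?groupM ?groupV ?cg_flip_group //.
Qed.

Lemma coset_coset_adjacentN k g h : (k < 4)%N -> g \in G -> h \in G ->
  ~~ i_adjacent k (coset_flag g : {set P}) (coset_flag h).
Proof.
move=> k4 gG hG; apply/negP=> adj; have aG := groupM (cg_flip_group X (k4 : proper_type k.+1)) gG.
have := i_adjacent_uniq k4 adj (coset_mirror_adjacent k4 gG).
exact: coset_flag_neq_mirror.
Qed.

Lemma mirror_mirror_adjacentN k g h : (k < 4)%N -> g \in G -> h \in G ->
  ~~ i_adjacent k (mirror_flag g : {set P}) (mirror_flag h).
Proof.
move=> k4 gG hG; apply/negP=> adj.
have aG : (a k.+1)^-1 * g \in G by rewrite groupM ?groupV ?cg_flip_group //.
have := i_adjacent_uniq k4 adj (mirror_coset_adjacent k4 gG).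
by move/esym; apply: coset_flag_neq_mirror.
Qed.

Definition coset_flags : {set {set P}} := [set coset_flag g | g in G].
Definition mirror_flags : {set {set P}} := [set mirror_flag g | g in G].

Lemma flags_coset_polytope : flags P = coset_flags :|: mirror_flags.
Proof.
apply/setP=> A; rewrite inE in_setU; apply/idP/orP=> [fA|[]/imsetP[g gG ->]]; last 2 first.
- exact: coset_flag_flag.
- exact: mirror_flag_flag.
have type1 : (inord 1 : 'I_6) = 1%N :> nat by rewrite inordK.
have [|g gG gA] := flag_common_element fA (i := inord 1); first by rewrite type1.
have [->|/eqP neqA] := eqVneq A (coset_flag g); [left|right]; first exact: imset_f.
suff -> : A = mirror_flag g by apply: imset_f.
have adj_g : i_adjacent 0 (coset_flag g : {set P}) (mirror_flag g).
  by have := @coset_mirror_adjacent 0 g isT gG; rewrite cg_flip1 mul1g.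
apply: (@i_adjacent_uniq 4 P 0) => //; last exact: adj_g.
apply: i_adjacent_sym; apply: (i_adjacent_ctype type1); rewrite ?coset_flag_flag // => x xA tx.
by rewrite mem_coset_flag // gA.
Qed.

Lemma coset_mirror_flags_disjoint : [disjoint coset_flags & mirror_flags].
Proof.
apply/pred0P=> A; apply/andP=> -[/imsetP[g gG ->] /imsetP[h hG]].
exact: coset_flag_neq_mirror.
Qed.

(** An automorphism of the group exchanging the two flag orbits of the geometry
    would act on the flips like this. *)
Definition mirrored : Prop := exists f : {morphism G >-> gT},
  [/\ 'injm f, f @* G = G &
      forall i j : nat, proper_type i -> proper_type j ->
        f ((a i)^-1 * a j) = a i * (a j)^-1].

Lemma proper_type_pred (i : nat) : proper_type i -> exists2 k, (k < 4)%N & i = k.+1.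
Proof. by case: i => // k; exists k. Qed.

Section Reflection.
Variable r : {perm P}.
Hypotheses (rG : r \in Gamma P) (r_flag : r @: (coset_flag 1 : {set P}) = mirror_flag 1).

(* Automorphisms commute with taking adjacent flags. *)
Lemma conj_cface_perm_flip k l : (k < 4)%N -> (l < 4)%N ->
  cface_perm ((a k.+1)^-1 * a l.+1) ^ r = cface_perm (a k.+1 * (a l.+1)^-1).
Proof.
move=> k4 l4; have aG := cg_flip_group X; apply: (mulgI r); rewrite -conjgC.
set u := (a k.+1)^-1 * _; have uG : u \in G by rewrite groupM ?groupV ?aG.
have aVG : (a l.+1)^-1 \in G by rewrite groupV aG.
have vG : a k.+1 * (a l.+1)^-1 \in G by rewrite groupM ?aG.
apply: (@Gamma_flag_inj 4 P _ _ (coset_flag 1));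
  rewrite ?groupM ?cface_perm_Gamma ?coset_flag_flag //.
rewrite !imset_permM r_flag cface_perm_coset_flag // cface_perm_mirror_flag // !mul1g.
have adj_l := Gamma_i_adjacent rG (coset_mirror_adjacent l4 (group1 G)).
have adj_k := Gamma_i_adjacent rG (i_adjacent_sym (coset_mirror_adjacent k4 uG)).
rewrite r_flag mulg1 in adj_l; rewrite /u mulKVg -/u in adj_k.
have := mirror_coset_adjacent l4 (group1 G); rewrite mulg1 => adj_l'.
rewrite (i_adjacent_uniq l4 adj_l adj_l') in adj_k.
exact: i_adjacent_uniq k4 adj_k (coset_mirror_adjacent k4 aVG).
Qed.

Lemma conj_cface_perm : (cface_perm @* G) :^ r = cface_perm @* G.
Proof.
apply/eqP; rewrite eqEcard cardJg leqnn andbT sub_conjg.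
rewrite [in X in X \subset _]morphim_gen ?subset_gen // gen_subG.
apply/subsetP=> _ /morphimP[_ _ /imset2P[i j + + ->] ->]; rewrite !inE.
move=> /proper_type_pred[k k4 ->] /proper_type_pred[l l4 ->].
by rewrite mem_conjgV conj_cface_perm_flip // mem_morphim // groupM ?groupV ?cg_flip_group //.
Qed.

Lemma reflection_mirrored : mirrored.
Proof.
pose f g := invm injm_cface_perm (cface_perm g ^ r).
have conj_mem g : g \in G -> cface_perm g ^ r \in cface_perm @* G.
  by move=> gG; rewrite -conj_cface_perm memJ_conjg mem_morphim.
have fM : {in G &, {morph f : g h / g * h}}.
  by move=> g h gG hG; rewrite /f cface_permM // conjMg morphM ?conj_mem.
have inj_f : 'injm (Morphism fM).
  apply/injmP=> g h gG hG /= eq_f; apply: (injmP injm_cface_perm) => //.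
  by apply/(conjg_inj r)/(injmP (injm_invm injm_cface_perm)); rewrite ?conj_mem.
exists (Morphism fM); split=> // [|i j /proper_type_pred[k k4 ->] /proper_type_pred[l l4 ->]].
  apply/eqP; rewrite eqEcard card_injm // leqnn andbT.
  apply/subsetP=> _ /morphimP[g _ gG ->] /=.
  have := mem_morphim (invm injm_cface_perm) (conj_mem g gG) (conj_mem g gG).
  by rewrite im_invm.
by rewrite /= /f conj_cface_perm_flip // invmE // groupM ?groupV ?cg_flip_group //.
Qed.

End Reflection.

Hypothesis not_mirrored : ~ mirrored.

Lemma Gamma_coset_polytope : Gamma P = cface_perm @* G.
Proof.
apply/eqP; rewrite eqEsubset andbC; apply/andP; split.
  by apply/subsetP=> _ /morphimP[g _ gG ->]; apply: cface_perm_Gamma.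
apply/subsetP=> r rG; have f1 := coset_flag_flag (group1 G).
have : r @: (coset_flag 1 : {set P}) \in flags P by rewrite inE Gamma_flag.
rewrite flags_coset_polytope in_setU => /orP[]/imsetP[g gG r1]; last first.
  case: not_mirrored; apply: (@reflection_mirrored (r * cface_perm g^-1)).
    by rewrite groupM // cface_perm_Gamma ?groupV.
  by rewrite imset_permM r1 cface_perm_mirror_flag ?groupV // mulgV.
suff -> : r = cface_perm g by apply: mem_morphim.
apply: (@Gamma_flag_inj 4 P _ _ (coset_flag 1)); rewrite ?cface_perm_Gamma //.
by rewrite r1 cface_perm_coset_flag // mul1g.
Qed.

Lemma Gamma_coset_polytope_isog : Gamma P \isog G.
Proof. by rewrite Gamma_coset_polytope isog_sym sub_isog // injm_cface_perm. Qed.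

Lemma orbit_Gamma (F : gT -> {set P}) h :
    {in G &, forall g g', cface_perm g @: F g' = F (g' * g)} -> h \in G ->
  orbit 'P^* (Gamma P) (F h) = [set F g | g in G].
Proof.
move=> FM hG; rewrite Gamma_coset_polytope; apply/setP=> A; apply/orbitP/imsetP.
  by case=> _ /morphimP[g _ gG ->] <-; exists (h * g); rewrite ?groupM // -FM.
case=> g gG ->; exists (cface_perm (h^-1 * g)); first by rewrite mem_morphim ?groupM ?groupV.
by rewrite /= [LHS]FM ?mulKVg // groupM ?groupV.
Qed.

Lemma flag_orbits_coset_polytope : flag_orbits P = [set coset_flags; mirror_flags].
Proof.
have orbit_const (F : gT -> {set P}) :
    {in G &, forall g g', cface_perm g @: F g' = F (g' * g)} ->
    orbit 'P^* (Gamma P) @: [set F g | g in G] = [set [set F g | g in G]].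
  move=> FM; apply/setP=> O; rewrite inE -imset_comp; apply/imsetP/eqP=> [[g gG ->]|->].
    exact: orbit_Gamma.
  by exists 1; rewrite //= orbit_Gamma.
rewrite /flag_orbits flags_coset_polytope imsetU !orbit_const //.
  exact: cface_perm_mirror_flag.
exact: cface_perm_coset_flag.
Qed.

Lemma chiral_coset_polytope : chiral P.
Proof.
split=> [|A B adjAB].
  rewrite flag_orbits_coset_polytope cards2; case: eqP => // eq_flags.
  have := coset_mirror_flags_disjoint; rewrite eq_flags -setI_eq0 setIid.
  by move/set0Pn=> []; exists (mirror_flag 1); apply: imset_f.
have [k adj_k k4] := adjacent_i_adjacent adjAB; have [fA _] := i_adjacent_flags adj_k.
apply/negP=> BA; have : A \in flags P by rewrite inE.
rewrite flags_coset_polytope in_setU => /orP[]/imsetP[g gG eqA]; rewrite {}eqA in BA adj_k.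
  rewrite (orbit_Gamma (F := @coset_flag X)) // in BA; last exact: cface_perm_coset_flag.
  by have [h hG eqB] := imsetP BA; apply/negP: adj_k; rewrite eqB; apply: coset_coset_adjacentN.
rewrite (orbit_Gamma (F := @mirror_flag X)) // in BA; last exact: cface_perm_mirror_flag.
by have [h hG eqB] := imsetP BA; apply/negP: adj_k; rewrite eqB; apply: mirror_mirror_adjacentN.
Qed.

Section Duality.
Variable d : gT.
Hypothesis stab_conj : forall k, (k <= 5)%N -> K k :^ d = K (5 - k).

Lemma group_conj_mem g : (g ^ d \in G) = (g \in G).
Proof.
have Gd : G :^ d = G.
  by have := @stab_conj 0 isT; rewrite /cg_stab !flip_stab_improper.
by rewrite -{1}Gd memJ_conjg.
Qed.

Lemma cface_conj_subproof x : cface_pred (rev_ord (ctype x), cset x :^ d).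
Proof.
have [h hx] := cset_nonempty x; rewrite (cset_rcoset hx); apply/rcosetsP.
exists (h ^ d); first by rewrite group_conj_mem (subsetP (cset_sub x)).
by rewrite /= conjsMg conjg_set1 stab_conj ?subSS // -ltnS ltn_ord.
Qed.

Definition cface_conj x : P :=
  exist (fun w : 'I_6 * {set gT} => is_true (cface_pred w)) _ (cface_conj_subproof x).

Lemma cface_conj_inj : injective cface_conj.
Proof.
move=> x y /(congr1 val)[eq_type eq_set]; apply: cface_inj.
  by apply: (can_inj (@rev_ordK 6)); apply: val_inj.
exact: (can_inj (conjsgK d)) eq_set.
Qed.

Definition cface_duality : {perm P} := perm cface_conj_inj.

Lemma cface_dualityP : duality cface_duality.
Proof.
move=> x y; rewrite !permE !leE_cface /cface_le /ctype /cset /=.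
rewrite -/(ctype x) -/(ctype y) !subSS -conjIg setIC -!card_gt0 cardJg; congr (_ && _).
by have := ltn_ord (ctype x); have := ltn_ord (ctype y); clear; lia.
Qed.

Lemma cface_duality_coset_flag g : g \in G ->
  cface_duality @: coset_flag g = coset_flag (g ^ d).
Proof.
move=> gG; have gdG : g ^ d \in G by rewrite group_conj_mem.
have fg : flag (cface_duality @: (coset_flag g : {set P})).
  by apply: (duality_flag cface_dualityP); apply: coset_flag_flag.
apply: (flag_sub_eq fg); first exact/flag_chain/coset_flag_flag.
apply/subsetP=> _ /imsetP[x xg ->]; rewrite mem_coset_flag //.
by rewrite permE memJ_conjg -mem_coset_flag.
Qed.

Lemma properly_self_dual_coset_polytope : properly_self_dual P.
Proof.
exists cface_duality; first exact: cface_dualityP.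
have imset_inj_dual := imset_inj (@perm_inj _ cface_duality).
have dual_coset : [set cface_duality @: A | A : {set P} in coset_flags] = coset_flags.
  apply/eqP; rewrite eqEcard (card_imset _ imset_inj_dual) leqnn andbT.
  apply/subsetP=> _ /imsetP[_ /imsetP[g gG ->] ->].
  by rewrite cface_duality_coset_flag // imset_f // group_conj_mem.
move=> O; rewrite flag_orbits_coset_polytope // !inE => /orP[] /eqP-> //.
apply/eqP; rewrite eqEcard (card_imset _ imset_inj_dual) leqnn andbT.
apply/subsetP=> _ /imsetP[_ /imsetP[g gG ->] ->].
have : cface_duality @: (mirror_flag g : {set P}) \in flags P.
  by rewrite inE; apply: (duality_flag cface_dualityP); apply: mirror_flag_flag.
rewrite flags_coset_polytope in_setU -{1}dual_coset (mem_imset _ _ imset_inj_dual) => /orP[|//].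
case/imsetP=> h hG /esym eq_flags.
by case: (coset_flag_neq_mirror hG gG eq_flags).
Qed.

End Duality.
End Automorphisms.

Section Facets.
Variable X : coset_geometry.
Local Open Scope group_scope.
Local Notation gT := (cg_type X).
Local Notation G := (cg_group X).
Local Notation K := (@cg_stab X).
Local Notation P := (coset_polytope X).
Variables (s1 s2 : gT) (u : point).
Hypothesis s12P : tess_rotations s1 s2.
Local Notation rot := (tess_rot s1 s2).
Hypothesis facet_group : K 4 = <<[set s1; s2]>> :> {set gT}.
Hypothesis facet_stab : forall i, (0 < i <= 3)%N -> K i :&: K 4 = <[face_rotation s1 s2 i]>.
Hypothesis rot_eq1 : forall v k, rot v k = 1 -> (6 %| k)%N.
Hypothesis tr_eq1 : forall v, tess_tr s1 s2 v = 1 <-> in_lattice u v.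
Implicit Types (f : tess_face) (v w t : point) (k l : nat).

Lemma rot_facet_group v k : rot v k \in K 4.
Proof. by rewrite facet_group tess_rot_mem. Qed.

Lemma rot_eq v k w l : rot v k = rot w l -> in_lattice u (v - w)%R /\ k = l %[mod 6].
Proof.
move=> eq_rot; have rot1 := tess_rot_eq s12P eq_rot; have k6 := rot_eq1 rot1.
split; last by move: k6; clear; lia.
by apply/tr_eq1; rewrite -rot1 -tess_rot0; apply: (tess_rot_eqmod6 s12P); move: k6; clear; lia.
Qed.

Section FacetMap.
Variable g : gT.
Hypothesis gG : g \in G.

Lemma rot_mulG v k : rot v k * g \in G.
Proof. exact: groupM (subsetP (cg_stab_sub X 4) _ (rot_facet_group v k)) gG. Qed.

Lemma coset_face_rot i v k w l : (i <= 4)%N -> tface i v k = tface i w l ->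
  coset_face (inord i) (rot v k * g) = coset_face (inord i) (rot w l * g).
Proof.
move=> le_i4 eq_face; have [i_proper|] := boolP (0 < i <= 3)%N; last first.
  case: i le_i4 {eq_face} => [|[|[|[|[|]]]]] // _ _; last first.
    rewrite -(mulgKV (rot w l) (rot v k)) -[_ * _ * g]mulgA coset_face_mull ?rot_mulG //.
    by rewrite inordK // groupM ?groupV ?rot_facet_group.
  by apply: (@cface_eq _ _ _ g) => //; rewrite cset_improper //= inordK.
have [n [m [iterE eq_ml]]] := tface_eq_next_flag i_proper eq_face.
rewrite -(tess_rot_eqmod6 s12P w eq_ml).
have /= := face_rotationX s12P i n (v, k); rewrite iterE /= => <-.
rewrite -(mulgA (_ ^+ n)) [RHS]coset_face_mull ?rot_mulG // groupX //.
have := cycle_id (face_rotation s1 s2 i); rewrite -facet_stab // => /setIP[+ _].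
by rewrite inordK // ltnS leqW.
Qed.

Definition facet_map f : P :=
  coset_face (inord (tess_rank f)) (rot (tess_flag f).1 (tess_flag f).2 * g).

Lemma facet_map_tface i v k : (i <= 4)%N ->
  facet_map (tface i v k) = coset_face (inord i) (rot v k * g).
Proof.
move=> le_i4; rewrite /facet_map; set f := tface i v k.
have rank_f : tess_rank f = i by apply: tess_rank_tface.
by rewrite rank_f; apply: coset_face_rot; rewrite // -{1}rank_f tess_flagK.
Qed.

Lemma ctype_facet_map f : ctype (facet_map f) = tess_rank f :> nat.
Proof. by rewrite inordK // ltnS ltnW // ltnS tess_rank_le4. Qed.

Lemma facet_map_le f : (facet_map f <= coset_face (inord 4) g)%O.
Proof.
rewrite -(@coset_face_mull _ _ _ (rot (tess_flag f).1 (tess_flag f).2)) //; last first.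
  by rewrite inordK // rot_facet_group.
apply: coset_face_le; rewrite ?rot_mulG // !inordK ?ltnS ?tess_rank_le4 //.
by rewrite ltnW // ltnS tess_rank_le4.
Qed.

Lemma facet_map_translate t f : in_lattice u t -> facet_map (translate t f) = facet_map f.
Proof.
move=> /tr_eq1 tr_t; have [i [v [k [le_i4 ->]]]] := tfaceP f.
rewrite -tface_translate !facet_map_tface //; congr (coset_face _ (_ * _)).
by rewrite /tess_rot tess_trD // tr_t mulg1.
Qed.

Lemma facet_map_fiber f f' : facet_map f = facet_map f' <-> translation_orbit u f f'.
Proof.
split=> [eq_ff'|[t ut ->]]; last by rewrite facet_map_translate.
have eq_rank : tess_rank f = tess_rank f' by rewrite -!ctype_facet_map eq_ff'.
rewrite -(tess_flagK f) -(tess_flagK f') -eq_rank; move: eq_ff'.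
rewrite /facet_map -eq_rank; have := tess_rank_le4 f; set i := tess_rank f => le_i4.
case: (tess_flag f) (tess_flag f') => v k [w l] /= eq_faces.
have [i_proper|] := boolP (0 < i <= 3)%N; last first.
  by case: i le_i4 {eq_rank eq_faces} => [|[|[|[|[|]]]]] // _ _; apply: translation_orbit_refl.
move/(coset_face_eqP _ (rot_mulG _ _) (rot_mulG _ _)): eq_faces.
rewrite inordK ?ltnS ?(leqW le_i4) // invMg mulgA mulgK => rot_K.
have : rot v k * (rot w l)^-1 \in <[face_rotation s1 s2 i]>.
  by rewrite -facet_stab // inE rot_K groupM ?groupV ?rot_facet_group.
case/cycleP=> n rotE; have : rot v k = face_rotation s1 s2 i ^+ n * rot w l by rewrite -rotE mulgKV.
have /= -> := face_rotationX s12P i n (w, l); case/rot_eq.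
have /= <- := tface_iter_next_flag i n (w, l).
case: (iter n _ _) => w' l' /= u_vw eq_kl; rewrite (tface_eqmod6 i v eq_kl).
exists (w' - v)%R; first by rewrite -opprB; apply: in_latticeN.
by rewrite -tface_translate addrC subrK.
Qed.

Lemma facet_map_common f f' : (facet_map f <= facet_map f')%O -> exists v k,
  facet_map f = facet_map (tface (tess_rank f) v k) /\
  facet_map f' = facet_map (tface (tess_rank f') v k).
Proof.
move=> le_ff'; have [h [hf hf']] := cface_le_common le_ff' (facet_map_le f').
rewrite cset_coset_face // mem_rcoset inordK // facet_group.
case/(tess_rotP s12P)=> v [k hE]; exists v, k; rewrite !facet_map_tface ?tess_rank_le4 //.
by rewrite -hE mulgKV [LHS](coset_faceE hf) [X in _ /\ X = _](coset_faceE hf').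
Qed.

Lemma facet_map_cover : torus_cover u
  (fun y z : {y : P | (y <= coset_face (inord 4) g)%O} => (sval y <= sval z)%O)
  (fun f => exist _ (facet_map f) (facet_map_le f)).
Proof.
split=> [[y yF]|f f'|f f'].
- have le_y4 : (ctype y <= 4)%N by have := ctype_le yF; rewrite /= inordK.
  have /cface_leP[_ [h hy]] := yF; rewrite cset_coset_face // mem_rcoset inordK // facet_group.
  case/(tess_rotP s12P)=> v [k hE]; exists (tface (ctype y) v k); apply: eq_exist.
  by rewrite facet_map_tface // inord_val -hE mulgKV -coset_faceE.
- by rewrite -facet_map_fiber; split=> [/(congr1 sval)//|eq_ff']; apply: eq_exist.
split=> /= [le_ff'|[_ [t ut ->]]]; last first.
  rewrite -(facet_map_translate f' ut) => /tri_leP[i [j [v [k [/andP[le_ij le_j4] -> ->]]]]].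
  rewrite !facet_map_tface ?(leq_trans le_ij) // coset_face_le ?rot_mulG //.
  by rewrite !inordK // ltnS ltnW // ltnS // (leq_trans le_ij).
have le_rank : (tess_rank f <= tess_rank f')%N by rewrite -!ctype_facet_map ctype_le.
have [v [k [/facet_map_fiber/translation_orbit_sym[t ut ->] /facet_map_fiber orb_f']]] :=
  facet_map_common le_ff'.
exists (tface (tess_rank f') (v + t)%R k).
  by apply: translation_orbit_trans orb_f' _; exists t; rewrite ?tface_translate.
by rewrite -tface_translate; apply: tface_le; rewrite le_rank tess_rank_le4.
Qed.

End FacetMap.

Lemma facets_coset_polytope : has_facets P (@map36 u).
Proof.
move=> F rank_F; have type_F : ctype F = inord 4.
  by apply: val_inj; rewrite /= inordK //; move: rank_F; rewrite /rank /= /crank; clear; lia.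
have [g gF] := cset_nonempty F; have gG := subsetP (cset_sub F) g gF.
by rewrite (coset_faceE gF) type_F; apply: iso_of_torus_cover (facet_map_cover gG).
Qed.

End Facets.

(** * Coset geometries of rotation groups *)

Section FlipStabilisers.
Variables (gT : finGroupType) (a : nat -> gT).
Local Open Scope group_scope.
Local Notation K := (flip_stab a).
Local Notation cyc i j := <[(a i)^-1 * a j]>.
Implicit Types (i j k l m : nat).

Lemma proper_typeE s i : perm_eq s [:: 1%N; 2; 3; 4] -> proper_type i = (i \in s).
Proof. by move/perm_mem->; case: i => [|[|[|[|[|i]]]]]. Qed.

Lemma flip_stab_cycle l i j : proper_type i -> proper_type j -> l != i -> l != j ->
  cyc i j \subset K l.
Proof. by move=> pi pj li lj; rewrite cycle_subG mem_flip_stab. Qed.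

Lemma flip_stab_gen l i j k : perm_eq [:: l; i; j; k] [:: 1%N; 2; 3; 4] ->
  K l = <<[set (a i)^-1 * a j; (a j)^-1 * a k]>> :> {set gT}.
Proof.
move=> lijk; have mem_gen2 (x y : gT) : x \in <<[set x; y]>> /\ y \in <<[set x; y]>>.
  by split; apply: mem_gen; rewrite !inE eqxx ?orbT.
apply/eqP; rewrite eqEsubset; apply/andP; split.
  have [ij_gen jk_gen] := mem_gen2 ((a i)^-1 * a j) ((a j)^-1 * a k).
  apply: (@flip_group_sub _ _ _ <<_>>%G (a j)^-1) => m /andP[pm neq_ml].
  move: pm; rewrite (proper_typeE _ lijk) !inE (negPf neq_ml) /=.
  case/or3P=> /eqP->; rewrite ?jk_gen //.
    by rewrite -groupV invMg invgK.
  by rewrite mulVg group1.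
have [pi pj pk] : [/\ proper_type i, proper_type j & proper_type k].
  by split; rewrite (proper_typeE _ lijk) !inE eqxx ?orbT.
have : uniq [:: l; i; j; k] by rewrite (perm_uniq lijk).
rewrite /= !inE !negb_or => /andP[/and3P[li lj lk] _].
by rewrite gen_subG; apply/subsetP=> _ /set2P[] ->; apply: mem_flip_stab.
Qed.

Lemma flip_stab_dihedral l i j k : perm_eq [:: l; i; j; k] [:: 1%N; 2; 3; 4] ->
    ((a j)^-1 * a k) ^+ 2 = 1 -> ((a i)^-1 * a k) ^+ 2 = 1 ->
  K l = cyc i j * cyc j k :> {set gT}.
Proof.
move=> lijk jk ik; rewrite (flip_stab_gen lijk); apply: gen_dihedral => //.
by rewrite mulgA mulgK.
Qed.

Lemma flip_stab_conj (c d : gT) : (forall i, proper_type i -> a i ^ d = c * a (5 - i)) ->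
  forall l, (l <= 5)%N -> K l :^ d = K (5 - l).
Proof.
move=> aJ; have conj_sub l : (l <= 5)%N -> K l :^ d \subset K (5 - l).
  move=> le_l5; rewrite -genJ gen_subG; apply/subsetP=> _ /imsetP[_ /imset2P[i j + + ->] ->].
  rewrite !inE => /andP[pi li] /andP[pj lj]; rewrite conjMg conjVg !aJ // invMg -mulgA mulKg.
  by apply: mem_flip_stab; move: pi li pj lj le_l5; rewrite /proper_type; clear; lia.
move=> l le_l5; apply/eqP; rewrite eqEcard conj_sub // cardJg.
by have := subset_leq_card (conj_sub _ (leq_subr l 5)); rewrite cardJg subKn.
Qed.

End FlipStabilisers.

Section RotationGeometry.
Variables (gT : finGroupType) (s1 s2 s3 d : gT).
Local Open Scope group_scope.
Hypotheses (rotP : self_dual_rotations s1 s2 s3 d) (nondegP : nondegenerate_rotations s1 s2).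
Implicit Types (i j k l m : nat) (g : gT).

Definition rot_flip (i : nat) : gT :=
  match i with 2 => s1 | 3 => s1 * s2 | 4 => s1 * s2 * s3 | _ => 1 end.

Local Notation a := rot_flip.
Local Notation K := (flip_stab rot_flip).
Local Notation cyc i j := <[(a i)^-1 * a j]>.

Lemma flip_cycle_sym i j : cyc i j = cyc j i.
Proof. by rewrite -cycleV invMg invgK. Qed.

Lemma rot_flip12 : (a 1)^-1 * a 2 = s1. Proof. by rewrite /= invg1 mul1g. Qed.
Lemma rot_flip23 : (a 2)^-1 * a 3 = s2. Proof. by rewrite /= mulKg. Qed.
Lemma rot_flip34 : (a 3)^-1 * a 4 = s3. Proof. by rewrite /= mulKg. Qed.
Lemma rot_flip13 : (a 1)^-1 * a 3 = s1 * s2. Proof. by rewrite /= invg1 mul1g. Qed.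
Lemma rot_flip24 : (a 2)^-1 * a 4 = s2 * s3. Proof. by rewrite /= -mulgA mulKg. Qed.
Lemma rot_flip14 : (a 1)^-1 * a 4 = s1 * s2 * s3. Proof. by rewrite /= invg1 mul1g. Qed.

Lemma rot_flipJ i : proper_type i -> a i ^ d = (s1 * s2 * s3)^-1 * a (5 - i).
Proof.
have [_ s123 d1 d2 d3 _] := rotP.
case: i => [|[|[|[|[|]]]]] //= _; rewrite ?conj1g ?mulVg //.
- by rewrite d1 invMg mulgKV.
- by rewrite conjMg d1 d2 !invMg mulgA mulgKV.
- by rewrite !conjMg d1 d2 d3 mulg1 !invMg mulgA.
Qed.

Lemma rot_stabJ l : (l <= 5)%N -> K l :^ d = K (5 - l).
Proof. exact/flip_stab_conj/rot_flipJ. Qed.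

Lemma rot_flip_quotientJ i j : proper_type i -> proper_type j ->
  ((a i)^-1 * a j) ^ d = (a (5 - i))^-1 * a (5 - j).
Proof. by move=> pi pj; rewrite conjMg conjVg !rot_flipJ // [in LHS]invMg -mulgA mulKg. Qed.

Lemma rot_flip_sqr i j : proper_type i -> proper_type j -> (i.+1 < j)%N || (j.+1 < i)%N ->
  ((a i)^-1 * a j) ^+ 2 = 1.
Proof.
have [[_ _ s12] s123 _ d2 d3 _] := rotP.
have s23 : (s2 * s3) ^+ 2 = 1.
  apply/eqP; rewrite -(inj_eq (conjg_inj d)) conjXg conjMg d2 d3 -invMg expVgn s12.
  by rewrite invg1 conj1g.
wlog lt_ij : i j / (i.+1 < j)%N => [sqr_lt|] pi pj ij.
  case/orP: (ij) => lt_ij; first exact: sqr_lt.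
  by rewrite -[_ * _]invgK invMg invgK expVgn sqr_lt ?invg1 // lt_ij.
case: i j pi pj lt_ij {ij} => [|[|[|[|[|]]]]] // [|[|[|[|[|]]]]] // _ _ _.
- by rewrite rot_flip13.
- by rewrite rot_flip14.
- by rewrite rot_flip24.
Qed.

Lemma s1_cube : s1 ^+ 3 = 1. Proof. by have [[]] := rotP. Qed.

Lemma s3_cube : s3 ^+ 3 = 1.
Proof.
by have [_ _ d1 _ _ _] := rotP; apply: invg_inj; rewrite -expVgn -d1 -conjXg s1_cube conj1g invg1.
Qed.

Lemma s1_notin_s2 : s1 \notin <[s2]>.
Proof.
have [_ unit_neq1] := nondegP; have [[s1_3 s2_6 s12] _ _ _ _ _] := rotP.
apply/negP=> /cycleP[n s1E]; have s12C : commute s1 s2 by rewrite s1E; apply/commute_sym/commuteX.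
have s2_2 : s2 ^+ 2 = s1.
  by apply: (mulgI (s1 ^+ 2)); rewrite -expgMn // s12 -expgSr s1_3.
by apply: unit_neq1; rewrite /tess_unit -s2_2 -!expgD -expgSr.
Qed.

Lemma s3_notin_s2 : s3 \notin <[s2]>.
Proof.
have [_ _ _ d2 d3 _] := rotP; rewrite -(memJ_conjg _ d) -cycleJ d2 d3 cycleV groupV.
exact: s1_notin_s2.
Qed.

Lemma s2_notin_cycle3 (t : gT) : t ^+ 3 = 1 -> s2 \notin <[t]>.
Proof.
move=> t3; apply/negP=> /cycleP[n s2E]; have [rot6 _] := nondegP.
have : tess_rot s1 s2 0%R 3 = 1.
  by rewrite /tess_rot tess_tr0 mulg1 s2E -expgM mulnC expgM t3 expg1n invg1.
by move/rot6.
Qed.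

Lemma rot_stab1 : K 1 = <<[set s2; s3]>> :> {set gT}.
Proof. by rewrite (@flip_stab_gen _ _ 1 2 3 4) // rot_flip23 rot_flip34. Qed.

Lemma rot_stab4 : K 4 = <<[set s1; s2]>> :> {set gT}.
Proof. by rewrite (@flip_stab_gen _ _ 4 1 2 3) // rot_flip12 rot_flip23. Qed.

Lemma rot_stabI14 : K 1 :&: K 4 = cyc 2 3.
Proof.
apply/eqP; rewrite eqEsubset subsetI !flip_stab_cycle // !andbT.
apply/subsetP=> g /setIP[g1]; rewrite rot_stab4.
have [s12P _ _ _ _ vertexP] := rotP; case/(tess_rotP s12P)=> v [k gE].
have s2K1 : s2 \in K 1 by rewrite rot_stab1 mem_gen // !inE eqxx.
have : tess_tr s1 s2 v \in K 1.
  by rewrite -(groupMl _ (groupVr (groupX k s2K1))) -[_ * _]/(tess_rot s1 s2 v k) -gE.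
rewrite rot_stab1 gE /tess_rot rot_flip23 => /vertexP->.
by rewrite mulg1 groupV mem_cycle.
Qed.

Lemma s12_notin_stab1 : (a 1)^-1 * a 3 \notin K 1.
Proof.
apply: contra s1_notin_s2 => s12K1; have : (a 1)^-1 * a 3 \in cyc 2 3.
  by rewrite -rot_stabI14 inE s12K1 mem_flip_stab.
by rewrite rot_flip13 rot_flip23 groupMr ?cycle_id.
Qed.

Lemma s23_notin_stab4 : (a 2)^-1 * a 4 \notin K 4.
Proof.
have := s12_notin_stab1; rewrite -(memJ_conjg _ d) rot_stabJ // rot_flip_quotientJ //.
by rewrite -groupV invMg invgK.
Qed.

Lemma s23_notin_s3 : (a 2)^-1 * a 4 \notin cyc 3 4.
Proof.
by rewrite rot_flip24 rot_flip34 groupMr ?cycle_id //; apply/s2_notin_cycle3/s3_cube.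
Qed.

Lemma flip_cycle_TI_34_23 : cyc 3 4 :&: cyc 2 3 = 1.
Proof.
by rewrite rot_flip34 rot_flip23; apply: (prime_cycle_TI (p := 3)); rewrite ?s3_cube ?s3_notin_s2.
Qed.

Lemma flip_cycle_TI_34_24 : cyc 3 4 :&: cyc 2 4 = 1.
Proof.
by rewrite setIC; apply: (prime_cycle_TI (p := 2)); rewrite ?rot_flip_sqr ?s23_notin_s3.
Qed.

Lemma rot_stabI24 : K 2 :&: K 4 = cyc 3 1.
Proof.
rewrite setIC (@flip_stab_dihedral _ _ 2 4 3 1) ?rot_flip_sqr //.
rewrite -group_modr ?flip_stab_cycle // [cyc 4 3]flip_cycle_sym.
suff -> : K 4 :&: cyc 3 4 = 1 by rewrite mul1g.
apply/trivgP; rewrite -flip_cycle_TI_34_23 -rot_stabI14 !subsetI subsetIl subsetIr andbT.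
by rewrite (subset_trans (subsetIr _ _)) ?flip_stab_cycle.
Qed.

Lemma rot_stabI34 : K 3 :&: K 4 = cyc 1 2.
Proof.
rewrite (@flip_stab_dihedral _ _ 3 1 2 4) ?rot_flip_sqr //.
rewrite -group_modl ?flip_stab_cycle //.
by rewrite (prime_cycle_TI (p := 2)) ?mulg1 ?rot_flip_sqr // s23_notin_stab4.
Qed.

Lemma rot_stabIJ i j k l : proper_type i -> proper_type j -> proper_type k -> proper_type l ->
  K i :&: K j = cyc k l -> K (5 - i) :&: K (5 - j) = cyc (5 - k) (5 - l).
Proof.
move=> pi pj pk pl Iij; have le5 n : proper_type n -> (n <= 5)%N by case/andP=> _ /ltnW.
by rewrite -!rot_stabJ ?le5 // -conjIg Iij -cycleJ rot_flip_quotientJ.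
Qed.

Lemma rot_stabI12 : K 1 :&: K 2 = cyc 4 3.
Proof. by rewrite setIC; apply: (rot_stabIJ (i := 3) (j := 4) (k := 1) (l := 2)) rot_stabI34. Qed.

Lemma rot_stabI13 : K 1 :&: K 3 = cyc 2 4.
Proof. by rewrite setIC; apply: (rot_stabIJ (i := 2) (j := 4) (k := 3) (l := 1)) rot_stabI24. Qed.

Lemma rot_stabI23 : K 2 :&: K 3 = cyc 4 1.
Proof.
rewrite setIC (@flip_stab_dihedral _ _ 2 3 4 1) ?rot_flip_sqr //.
rewrite -group_modr ?flip_stab_cycle //.
suff -> : K 3 :&: cyc 3 4 = 1 by rewrite mul1g.
apply/trivgP; rewrite -flip_cycle_TI_34_24 -rot_stabI13 !subsetI subsetIl subsetIr andbT.
by rewrite (subset_trans (subsetIr _ _)) ?flip_stab_cycle.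
Qed.

Lemma rot_stab_factor i j k : (i < j < k)%N -> (k <= 5)%N ->
  K j \subset (K j :&: K i) * (K j :&: K k).
Proof.
have sub_improper l m : ~~ proper_type m -> K l \subset K m.
  by move/(flip_stab_improper rot_flip)->; apply: flip_stab_sub.
have [pi|/sub_improper/setIidPl->] := boolP (proper_type i); last by rewrite mulG_subl.
have [pk|/sub_improper/setIidPl->] := boolP (proper_type k); last by rewrite mulG_subr.
have factor2 m : m \in [:: 3; 4] -> K 2 \subset (K 2 :&: K 1) * (K 2 :&: K m).
  rewrite !inE (setIC (K 2)) rot_stabI12 => /orP[] /eqP->.
    by rewrite rot_stabI23 (@flip_stab_dihedral _ _ 2 3 4 1) ?rot_flip_sqr // flip_cycle_sym.
  by rewrite rot_stabI24 (@flip_stab_dihedral _ _ 2 4 3 1) ?rot_flip_sqr.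
move=> ijk _; have [j2|j2] := eqVneq j 2%N.
  have [-> k34] : i = 1%N /\ k \in [:: 3; 4].
    by move: pi pk ijk; rewrite j2 /proper_type !inE; clear; lia.
  by rewrite j2 factor2.
have [j3 ->] : j = 3%N /\ k = 4%N by move: pk pi ijk j2; rewrite /proper_type; clear; lia.
rewrite {}j3 in ijk *.
have := factor2 (5 - i)%N; rewrite -(conjSg _ _ d) conjsMg !conjIg !rot_stabJ ?leq_subr //.
rewrite subKn => [sub_KM|]; last by case/andP: pi => _ /ltnW.
have /sub_KM : (5 - i)%N \in [:: 3; 4].
  by rewrite !inE; move: pi ijk; rewrite /proper_type; clear; lia.
by rewrite -invSg invMg !invGid.
Qed.

Lemma rot_stab_diamond i : (i < 4)%N -> exists x,
  [/\ x \in K i :&: K i.+2, x \notin K i.+1 & K i :&: K i.+2 \subset K i.+1 :|: K i.+1 :* x].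
Proof.
pose D j := exists x,
  [/\ x \in K j :&: K j.+2, x \notin K j.+1 & K j :&: K j.+2 \subset K j.+1 :|: K j.+1 :* x].
have dual j : (j <= 3)%N -> D j -> D (3 - j)%N.
  move=> le_j3 [x [xI xK sub_x]]; exists (x ^ d).
  have [-> -> ->] : [/\ (3 - j).+2 = (5 - j)%N, (3 - j).+1 = (5 - j.+1)%N & (3 - j = 5 - j.+2)%N].
    by split; move: le_j3; clear; lia.
  rewrite -!rot_stabJ; try by move: le_j3; clear; lia.
  by rewrite setIC -conjIg -conjg_set1 -conjsMg -conjUg !memJ_conjg conjSg.
have D0 : D 0.
  exists ((a 1)^-1 * a 3); rewrite s12_notin_stab1 (setIidPr _); last first.
    by rewrite (flip_stab_improper rot_flip (isT : ~~ proper_type 0)) flip_stab_sub.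
  split=> //; first by rewrite mem_flip_stab.
  apply/subsetP=> g; rewrite {1}(@flip_stab_dihedral _ _ 2 4 3 1) ?rot_flip_sqr // flip_cycle_sym.
  have s12_2 := rot_flip_sqr (isT : proper_type 1) (isT : proper_type 3) isT.
  case/mulsgP=> k l k34; rewrite flip_cycle_sym => /(mem_cycle2 s12_2)[->|->] ->.
    by rewrite mulg1 inE (subsetP (flip_stab_cycle _ _ _ _ _) _ k34).
  by rewrite inE mem_rcoset mulgK (subsetP (flip_stab_cycle _ _ _ _ _) _ k34) ?orbT.
have D1 : D 1%N.
  exists ((a 2)^-1 * a 4); rewrite rot_stabI13 cycle_id; split=> //.
    apply: contra s23_notin_s3 => s23K2.
    by rewrite flip_cycle_sym -rot_stabI12 inE s23K2 mem_flip_stab.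
  have s23_2 := rot_flip_sqr (isT : proper_type 2) (isT : proper_type 4) isT.
  by apply/subsetP=> g /(mem_cycle2 s23_2)[->|->]; rewrite inE ?group1 ?rcoset_refl ?orbT.
move=> lt_i4; have [lt_i2|le_2i] := ltnP i 2; first by case: i lt_i2 {lt_i4} => [|[]].
have -> : i = (3 - (3 - i))%N by move: lt_i4; clear; lia.
by apply: dual; [apply: leq_subr|case: i lt_i4 le_2i => [|[|[|[]]]]].
Qed.

Lemma rot_stabI_sub i j : proper_type i -> proper_type j -> (i < j)%N ->
  K i :&: K j \subset flip_group a [pred l | other_types i l && (l != j)].
Proof.
case: i => [|[|[|[|[|]]]]] //; case: j => [|[|[|[|[|]]]]] // _ _ _.
- by rewrite rot_stabI12 cycle_subG mem_flip_group.
- by rewrite rot_stabI13 cycle_subG mem_flip_group.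
- by rewrite rot_stabI14 cycle_subG mem_flip_group.
- by rewrite rot_stabI23 cycle_subG mem_flip_group.
- by rewrite rot_stabI24 cycle_subG mem_flip_group.
- by rewrite rot_stabI34 cycle_subG mem_flip_group.
Qed.

Lemma rot_stabI3 i j k : proper_type i -> proper_type k -> (i < j < k)%N ->
  K i :&: K j :&: K k = 1.
Proof.
have dual l m n : (l <= 5)%N -> (m <= 5)%N -> (n <= 5)%N -> K l :&: K m :&: K n = 1 ->
    K (5 - n) :&: K (5 - m) :&: K (5 - l) = 1.
  move=> l5 m5 n5 I1; rewrite -!rot_stabJ // -!conjIg setIC [_ :&: K m]setIC setIA I1.
  exact: conjs1g.
have split_I l m : K 1 :&: K l :&: K m = (K 1 :&: K l) :&: (K 1 :&: K m).
  by rewrite setIACA setIid setIA.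
have I123 : K 1 :&: K 2 :&: K 3 = 1.
  by rewrite split_I rot_stabI12 rot_stabI13 flip_cycle_sym flip_cycle_TI_34_24.
have I124 : K 1 :&: K 2 :&: K 4 = 1.
  by rewrite split_I rot_stabI12 rot_stabI14 flip_cycle_sym flip_cycle_TI_34_23.
case: i => [|[|[|[|[|]]]]] //; case: j => [|[|[|[|[|]]]]] //;
case: k => [|[|[|[|[|]]]]] // _ _ _.
- exact: (dual 1%N 2 4).
- exact: (dual 1%N 2 3).
Qed.

Lemma rot_intersection (M : pred nat) g : {subset M <= proper_type} ->
    g \in flip_group a proper_type ->
    (forall l, proper_type l -> ~~ M l -> g \in K l) ->
  g \in flip_group a M.
Proof.
move=> M_proper gG gK; pose missing := [seq l <- iota 1 4 | ~~ M l].
have missingE l : (l \in missing) = proper_type l && ~~ M l.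
  by rewrite mem_filter andbC mem_iota add1n.
have missing_sorted : sorted ltn missing by apply/sorted_filter/iota_ltn_sorted/ltn_trans.
have missing_proper l : l \in missing -> proper_type l by rewrite missingE => /andP[].
have g_stab l : l \in missing -> g \in K l by rewrite missingE => /andP[/gK].
have of_larger N : g \in flip_group a N ->
    (forall l, N l -> proper_type l && (l \notin missing)) -> g \in flip_group a M.
  move=> gN NM; apply: (subsetP (flip_groupS _ _) _ gN) => l /NM.
  by rewrite missingE => /andP[pl]; rewrite pl negbK.
case: missing missing_sorted missing_proper g_stab of_larger {missingE}
    => [|i [|j [|k missing]]] /= ij_sorted missing_proper g_stab of_larger.
- by apply: of_larger gG _ => l ->.
- apply: of_larger (g_stab i _) _ => [|l /andP[-> li]]; rewrite ?mem_head //.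
  by rewrite inE li.
- have [pi pj] : proper_type i /\ proper_type j.
    by split; apply: missing_proper; rewrite !inE eqxx ?orbT.
  have gij : g \in K i :&: K j by rewrite inE !g_stab // !inE eqxx ?orbT.
  have lt_ij : (i < j)%N by case/andP: ij_sorted.
  apply: of_larger (subsetP (rot_stabI_sub pi pj lt_ij) _ gij) _ => l.
  by case/andP=> /andP[-> li] lj; rewrite !inE (negPf li) (negPf lj).
- have [pi pk] : proper_type i /\ proper_type k.
    by split; apply: missing_proper; rewrite !inE eqxx ?orbT.
  have lt_ijk : (i < j < k)%N by case/and3P: ij_sorted => -> ->.
  have : g \in K i :&: K j :&: K k by rewrite !inE !g_stab // !inE eqxx ?orbT.
  by rewrite rot_stabI3 // => /set1gP->; apply: group1.
Qed.

Lemma s1_notin_stab1 : s1 \notin K 1.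
Proof.
apply: contra s1_notin_s2 => s1K1; rewrite -rot_flip23 -rot_stabI14 inE s1K1 /=.
by rewrite rot_stab4 mem_gen // !inE eqxx.
Qed.

Definition rot_geometry : coset_geometry :=
  @CosetGeometry gT rot_flip erefl s1_notin_stab1
    rot_stab_factor rot_stab_diamond rot_intersection.

Lemma rot_geometry_group : cg_group rot_geometry = <<[set s1; s2; s3]>> :> {set gT}.
Proof.
apply/eqP; rewrite eqEsubset; apply/andP; split.
  have [s1G s2G s3G] : [/\ s1 \in <<[set s1; s2; s3]>>, s2 \in <<[set s1; s2; s3]>> &
                          s3 \in <<[set s1; s2; s3]>>].
    by split; apply: mem_gen; rewrite !inE eqxx ?orbT.
  apply: (@flip_group_sub _ _ _ <<_>>%G 1) => -[|[|[|[|[|i]]]]] // _ /=;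
    by rewrite ?mul1g ?group1 // !groupM.
rewrite gen_subG; apply/subsetP=> t; rewrite !inE => /orP[/orP[]|] /eqP->.
- by rewrite -rot_flip12; apply: mem_flip_group.
- by rewrite -rot_flip23; apply: mem_flip_group.
- by rewrite -rot_flip34; apply: mem_flip_group.
Qed.

Lemma rot_geometry_stabJ l : (l <= 5)%N ->
  cg_stab rot_geometry l :^ d = cg_stab rot_geometry (5 - l).
Proof. exact: rot_stabJ. Qed.

Lemma rot_geometry_facets u : (forall v, tess_tr s1 s2 v = 1 <-> in_lattice u v) ->
  has_facets (coset_polytope rot_geometry) (@map36 u).
Proof.
have [s12P _ _ _ _ _] := rotP; have [rot6 _] := nondegP => tr1.
apply: (@facets_coset_polytope rot_geometry s1 s2 u s12P rot_stab4) => // i i_proper.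
case: i i_proper => [|[|[|[|]]]] //= _.
- by rewrite [LHS]rot_stabI14 rot_flip23.
- by rewrite [LHS]rot_stabI24 flip_cycle_sym rot_flip13.
- by rewrite [LHS]rot_stabI34 rot_flip12.
Qed.

Lemma rot_geometry_has_type u : (forall v, tess_tr s1 s2 v = 1 <-> in_lattice u v) ->
  has_type (coset_polytope rot_geometry) (@map36 u) (@map63 u).
Proof.
move=> tr1; apply: (dual_has_type (cface_dualityP (@rot_geometry_stabJ)) (@map63_dual u)).
exact: rot_geometry_facets.
Qed.

Lemma rot_geometry_properly_self_dual : ~ mirrored rot_geometry ->
  properly_self_dual (coset_polytope rot_geometry).
Proof. by move/properly_self_dual_coset_polytope; apply; apply: rot_geometry_stabJ. Qed.

Lemma mirrored_tess_tr (f : {morphism cg_group rot_geometry >-> gT}) v :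
    (forall i j, proper_type i -> proper_type j -> f ((a i)^-1 * a j) = a i * (a j)^-1) ->
  f (tess_tr s1 s2 v) = tess_tr s1 s2 (reflection v).
Proof.
have [s12P _ _ _ _ _] := rotP; move=> f_flip.
have [s1G s2G] : s1 \in cg_group rot_geometry /\ s2 \in cg_group rot_geometry.
  by rewrite rot_geometry_group; split; apply: mem_gen; rewrite !inE eqxx ?orbT.
have f1 : f s1 = s1^-1 by have := f_flip 1%N 2 isT isT; rewrite rot_flip12 /= mul1g.
have f12 : f (s1 * s2) = s1 * s2.
  have s12_2 : (s1 * s2) ^+ 2 = 1 by case: s12P.
  by have := f_flip 1%N 3 isT isT; rewrite rot_flip13 /= mul1g invg_sqr1.
have f2 : f s2 = s1 * s1 * s2.
  by apply: (mulgI (f s1)); rewrite -morphM // f12 f1 -mulgA mulKg.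
by rewrite morph_tess_tr // f1 f2; apply: tess_tr_reflection.
Qed.

End RotationGeometry.

(** * Mixing two rotation groups *)

Section Products.
Variables (aT bT : finGroupType).
Local Open Scope group_scope.
Implicit Types (s : aT) (t : bT) (v : point).

Lemma tess_tr_prod s1 s2 t1 t2 v :
  tess_tr ((s1, t1) : aT * bT) (s2, t2) v = (tess_tr s1 s2 v, tess_tr t1 t2 v).
Proof.
rewrite [LHS]surjective_pairing; congr (_, _).
  exact: (morph_tess_tr [morphism of @fst aT bT]).
exact: (morph_tess_tr [morphism of @snd aT bT]).
Qed.

Lemma self_dual_rotations_prod s1 s2 s3 d t1 t2 t3 e :
  self_dual_rotations s1 s2 s3 d -> self_dual_rotations t1 t2 t3 e ->
  self_dual_rotations ((s1, t1) : aT * bT) (s2, t2) (s3, t3) (d, e).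
Proof.
case=> [[s1_3 s2_6 s12] s123 d1 d2 d3 s_vertex] [[t1_3 t2_6 t12] t123 e1 e2 e3 t_vertex].
have pair_gen (f g : aT * bT) h : h \in <<[set f; g]>> ->
    h.1 \in <<[set f.1; g.1]>> /\ h.2 \in <<[set f.2; g.2]>>.
  move=> h_fg; have h1 := mem_morphim [morphism of @fst aT bT] (in_setT h) h_fg.
  have h2 := mem_morphim [morphism of @snd aT bT] (in_setT h) h_fg.
  by move: h1 h2; rewrite !morphim_gen ?subsetT // !morphimEsub ?subsetT // !imsetU !imset_set1.
split; try by apply: injective_projections.
  by split; apply: injective_projections.
by move=> v /pair_gen[]; rewrite tess_tr_prod /= => /s_vertex-> /t_vertex->.
Qed.

Lemma nondegenerate_rotations_prod s1 s2 t1 t2 :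
  nondegenerate_rotations s1 s2 -> nondegenerate_rotations ((s1, t1) : aT * bT) (s2, t2).
Proof.
case=> rot6 unit_neq1; split=> [v k /(congr1 fst)|/(congr1 fst)/unit_neq1//].
by rewrite [LHS](morph_tess_rot [morphism of @fst aT bT]) //; apply: rot6.
Qed.

End Products.

Section ChiralMix.
Variables (aT bT : finGroupType) (A : {group aT}) (B : {group bT}).
Variables (s1 s2 s3 d : aT) (t1 t2 t3 e : bT) (v : point).
Local Open Scope group_scope.
Hypotheses (sP : self_dual_rotations s1 s2 s3 d) (s_nondeg : nondegenerate_rotations s1 s2)
  (gen_s : <<[set s1; s2; s3]>> = A).
Hypotheses (tP : self_dual_rotations t1 t2 t3 e) (gen_t : <<[set t1; t2; t3]>> = B).
Hypotheses (simpleA : simple A) (ndvdAB : ~~ (#|A| %| #|B|)%N).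
Hypotheses (tr_v : tess_tr s1 s2 v = 1) (tr_reflection : tess_tr s1 s2 (reflection v) <> 1).

Definition mix_geometry : coset_geometry :=
  rot_geometry (self_dual_rotations_prod sP tP)
    (nondegenerate_rotations_prod t1 t2 s_nondeg).

Lemma mix_group : cg_group mix_geometry = setX A B :> {set _}.
Proof.
apply: (goursat_simple simpleA ndvdAB); rewrite rot_geometry_group morphim_gen ?subsetT //;
  by rewrite morphimEsub ?subsetT // !imsetU !imset_set1.
Qed.

(* The cofactor [B] is characteristic, so that an automorphism reversing the flips
   would reflect the translations in the kernel of the projection to [A]. *)
Lemma mix_not_mirrored : ~ mirrored mix_geometry.
Proof.
case=> f [inj_f im_f f_flip].
have charB : setX 1 B \char cg_group mix_geometry by rewrite mix_group simple_cofactor_char.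
have [_ /(_ f inj_f im_f) fB] := charP _ _ charB.
pose r := tess_tr ((s1, t1) : aT * bT) (s2, t2).
have r_v : r v = (1, tess_tr t1 t2 v) by rewrite /r tess_tr_prod tr_v.
have rG : r v \in cg_group mix_geometry.
  have := tess_rot_mem ((s1, t1) : aT * bT) (s2, t2) v 0; rewrite tess_rot0 rot_geometry_group.
  by apply/subsetP/genS/subsetUl.
have rB : r v \in setX (1 : {set aT}) B.
  by move: rG; rewrite mix_group r_v => /setXP[_ tB]; apply/setXP; split; rewrite ?group1.
have := mem_morphim f rG rB; rewrite fB (mirrored_tess_tr _ f_flip) tess_tr_prod.
by case/setXP=> /set1P.
Qed.

Lemma chiral_mix : exists P : polytope 4,
  [/\ chiral P, properly_self_dual P, Gamma P \isog setX A B &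
      forall u, (forall w, tess_tr s1 s2 w = 1 /\ tess_tr t1 t2 w = 1 <-> in_lattice u w) ->
        has_type P (@map36 u) (@map63 u)].
Proof.
exists (coset_polytope mix_geometry); split.
- exact: chiral_coset_polytope mix_not_mirrored.
- exact: rot_geometry_properly_self_dual mix_not_mirrored.
- by rewrite -mix_group; apply: Gamma_coset_polytope_isog mix_not_mirrored.
move=> u u_lattice; apply: rot_geometry_has_type => w; rewrite tess_tr_prod -u_lattice.
by split=> [[-> ->]|[-> ->]].
Qed.

End ChiralMix.

Theorem theorem8p2 (p b c : nat) (m : int) (Q : polytope 4) (Phi : {set Q})
    (p_prime : prime p) (p_mod12 : p = 1 %[mod 12])
    (b_gt0 : (0 < b)%N) (c_gt0 : (0 < c)%N)
    (p_eq : p = (b ^ 2 + b * c + c ^ 2)%N)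
    (m_odd : ~~ (2 %| m)%Z) (m_not3 : ~~ (3 %| m)%Z)
    (Phi_flag : flag Phi)
    (Q_self_dual : self_dual Q)
    (Q_directly_regular : directly_regular Phi)
    (Q_type : has_type Q (@map36 (m, 0)) (@map63 (m, 0)))
    (Q_order : ~~ (p * (p ^ 2 - 1) %| #|Gamma Q|)%N) :
  exists P : polytope 4,
    [/\ chiral P,
        properly_self_dual P,
        Gamma P \isog setX (PSL2 p) (Gamma_plus Phi),
        ((p%:Z %| m)%Z -> has_type P (@map36 (m, 0)) (@map63 (m, 0)))
      & (~~ (p%:Z %| m)%Z ->
           has_type P (@map36 (m * b%:Z, m * c%:Z)) (@map63 (m * b%:Z, m * c%:Z)))].
Proof.
have p_gt12 := prime_mod12_gt12 p_prime p_mod12.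
have [Q_regular index2] := Q_directly_regular; have [Q_facets _] := Q_type.
have [[e tP] tr_t] := regular_self_dual_rotations Phi_flag Q_regular Q_self_dual Q_facets.
have [s1 [s2 [s3 [d [sP s_nondeg gen_s tr_s]]]]] :=
  PSL2_rotations p_prime p_mod12 b_gt0 c_gt0 p_eq.
have PSL2_simple : simple (PSL2 p) by apply: simple_PSL2 => //; apply: ltn_trans p_gt12.
have PSL2_ndvd : ~~ (#|PSL2 p| %| #|Gamma_plus Phi|)%N.
  apply: contra Q_order => dvd_PSL2; apply: dvdn_trans (card_PSL2 p_prime) _.
  by rewrite -(Lagrange (Gamma_plus_sub Phi)) index2 mulnC dvdn_pmul2r.
have tr_bc : tess_tr s1 s2 (b%:Z, c%:Z) = 1%g.
  by apply/tr_s; exists 1, 0; rewrite mulr1z mulr0z addr0.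
have tr_reflection : tess_tr s1 s2 (reflection (b%:Z, c%:Z)) <> 1%g.
  rewrite tr_s; apply: (reflection_notin_lattice p_prime b_gt0 c_gt0 p_eq).
  by rewrite gtnNdvd // (ltn_trans _ p_gt12).
have [P [P_chiral P_self_dual P_Gamma P_type]] :=
  chiral_mix sP s_nondeg gen_s tP (esym (Gamma_plus_sigma Phi))
    PSL2_simple PSL2_ndvd tr_bc tr_reflection.
exists P; split=> // m_p; apply: P_type => v; rewrite tr_s tr_t.
- exact: in_latticeI_dvd p_prime b_gt0 c_gt0 p_eq _ _ m_p.
- exact: in_latticeI_ndvd p_prime b_gt0 c_gt0 p_eq _ _ m_p.
Qed.
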